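(* Let $k$ be a field of characteristic $0$, $V$ a finite-dimensional $k$-vector space, $v,w\in V$, $s=v\otimes w$, and $g=(s+s^{21})/2\in V^{\otimes 2}$. Let $(L(V),\delta_g,\varphi_g)$ be the quasi-Lie bialgebra on the free Lie algebra $L(V)$ with $\delta_g(x)=[g,x\otimes1-1\otimes x]$ for $x\in V$ and $\varphi_g=-[g^{12},g^{13}]+[g^{12},g^{23}]-[g^{13},g^{23}]$. Put $J=e^{-hs/2}\in T(V)^{\otimes2}[[h]]$, let $\Delta:T(V)[[h]]\to(T(V)^{\otimes2})[[h]]$ be the ($k[[h]]$-linear, $h$-adically continuous) algebra morphism with $$\Delta(x)=J^{-1}(x\otimes1)J+J(1\otimes x)J^{-1}\qquad(x\in V),$$ and let $$\Phi=(J^{-1})^{23}J^{12}J^{23}(J^{-1})^{12}.$$ Then $A_h=(T(V)[[h]],\mu_0,\Delta,\Phi)$, where $\mu_0$ is the undeformed multiplication of $T(V)$, is a quantization of $(L(V),\delta_g,\varphi_g)$.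
   Context: $T(V)=U(L(V))$ is the tensor algebra, with coproduct $\Delta_0$, the algebra morphism with $\Delta_0(x)=x\otimes1+1\otimes x$ for $x\in V$, and counit $\varepsilon_0$ with $\varepsilon_0(V)=0$ (unit and counit are not deformed). Tensor products over $k[[h]]$ are $h$-adically completed. $X^{ij}$ denotes $X\in T(V)^{\otimes 2}$ placed in the tensor factors $i,j$; $X^{21}$ is the flip. $\operatorname{cp}$ is the sum over cyclic permutations of three tensor factors, $\operatorname{Alt}$ the (unnormalized) alternating sum over all permutations of tensor factors. A quasi-Lie bialgebra $(\mathfrak g,\delta,\varphi)$ is a Lie algebra with a $1$-cocycle $\delta:\mathfrak g\to\bigwedge^2\mathfrak g$ (i.e. $\delta([x,y])=[x\otimes1+1\otimes x,\delta(y)]-[y\otimes 1+1\otimes y,\delta(x)]$) and $\varphi\in\bigwedge^3\mathfrak g$ such that $\operatorname{cp}(\delta\otimes\mathrm{id})\delta(x)=[x\otimes1\otimes1+1\otimes x\otimes1+1\otimes1\otimes x,\varphi]$ for all $x$ and $\operatorname{Alt}(\delta\otimes\mathrm{id}\otimes\mathrm{id})(\varphi)=0$. A $1$-cocycle on $L(V)$ is determined by its values on $V$. A quasi-Hopf algebra $(A,\mu,\Delta,\Phi)$ is a unital associative algebra with algebra morphisms $\Delta:A\to A\otimes A$ and $\varepsilon:A\to$ (ground ring), and an invertible $\Phi\in A^{\otimes3}$ such that $(\mathrm{id}\otimes\Delta)\Delta(x)\,\Phi=\Phi\,(\Delta\otimes\mathrm{id})\Delta(x)$ for all $x$; $(\varepsilon\otimes\mathrm{id})\Delta=(\mathrm{id}\otimes\varepsilon)\Delta=\mathrm{id}$;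 $(\mathrm{id}\otimes\varepsilon\otimes\mathrm{id})(\Phi)=1\otimes1$; the pentagon $\Phi^{1,2,34}\Phi^{12,3,4}=\Phi^{2,3,4}\Phi^{1,23,4}\Phi^{1,2,3}$ holds (where $\Phi^{1,2,34}=(\mathrm{id}\otimes\mathrm{id}\otimes\Delta)(\Phi)$, $\Phi^{12,3,4}=(\Delta\otimes\mathrm{id}\otimes\mathrm{id})(\Phi)$, $\Phi^{1,23,4}=(\mathrm{id}\otimes\Delta\otimes\mathrm{id})(\Phi)$, $\Phi^{2,3,4}=1\otimes\Phi$, $\Phi^{1,2,3}=\Phi\otimes1$); and there is a quasi-antipode: an anti-automorphism $S$ of $A$ and $\alpha,\beta\in A$ with $\sum S(x_{(1)})\alpha x_{(2)}=\varepsilon(x)\alpha$, $\sum x_{(1)}\beta S(x_{(2)})=\varepsilon(x)\beta$ (with $\Delta(x)=\sum x_{(1)}\otimes x_{(2)}$), $\sum_i X_i\beta S(Y_i)\alpha Z_i=1$ and $\sum_j S(P_j)\alpha Q_j\beta S(R_j)=1$, where $\Phi=\sum_i X_i\otimes Y_i\otimes Z_i$ and $\Phi^{-1}=\sum_j P_j\otimes Q_j\otimes R_j$. A quantization of a quasi-Lie bialgebra $(\mathfrak g,\delta,\varphi)$ is a quasi-Hopf algebra $A_h=(A,\mu,\Delta,\Phi)$ over $k[[h]]$ (completed tensor products) with $A\simeq (A/hA)[[h]]$, $\Phi\equiv1\otimes1\otimes1\bmod h^2$, $A_h/hA_h\simeq(U(\mathfrak g),\mu_0,\Delta_0,1\otimes1\otimes1)$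 as quasi-Hopf algebras, and such that $\delta(x)\equiv(\Delta(x)-\Delta(x)^{21})/h\bmod h$ for $x\in\mathfrak g$ and $\varphi\equiv(\operatorname{Alt}\Phi)/h^2\bmod h$. *)

(* Defs.v *)
From HB Require Import structures.
From mathcomp Require Import all_boot all_fingroup all_algebra.
From mathcomp Require Import generic_quotient boolp.

Set Implicit Arguments.
Unset Strict Implicit.
Unset Printing Implicit Defensive.

Import GRing.Theory.
Local Open Scope ring_scope.
Local Open Scope quotient_scope.

HB.mixin Record Lmodule_isLie (k : comNzRingType) g of GRing.Lmodule k g := {
  lie : g -> g -> g;
  lieZDl : forall (a : k) x y z, lie (a *: x + y) z = a *: lie x z + lie y z;
  lieZDr : forall (a : k) x y z, lie z (a *: x + y) = a *: lie z x + lie z y;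
  liexx : forall x, lie x x = 0;
  jacobi : forall x y z,
    lie x (lie y z) + lie y (lie z x) + lie z (lie x y) = 0
}.

#[short(type="lieAlgType")]
HB.structure Definition LieAlgebra (k : comNzRingType) :=
  {g of GRing.Lmodule k g & Lmodule_isLie k g}.

Definition comm (R : pzRingType) (x y : R) : R := x * y - y * x.

Definition lie_to_alg (k : comNzRingType) (g : lieAlgType k) (A : algType k)
  (f : g -> A) := forall x y, f (lie x y) = comm (f x) (f y).

Definition is_enveloping (k : comNzRingType) (g : lieAlgType k) (A : algType k)
    (i : {linear g -> A}) : Prop :=
  [/\ lie_to_alg i,
      forall (B : algType k) (f : {linear g -> B}), lie_to_alg f ->
        exists F : {lrmorphism A -> B}, forall x, F (i x) = f x
    & forall (B : algType k) (F G : {lrmorphism A -> B}),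
        (forall x, F (i x) = G (i x)) -> F =1 G].

(** [tens n M] is the n-th tensor power of M over k: formal sums of pairs
   (scalar, n-tuple), two of them being identified when every multilinear map
   takes the same value on both. *)

Section Tensors.
Variable k : comNzRingType.

Definition upd (M : choiceType) n (a : {ffun 'I_n -> M}) i x :=
  [ffun j => if j == i then x else a j].

Definition multilinear (M W : lmodType k) n (f : {ffun 'I_n -> M} -> W) :=
  forall a i c x y,
    f (upd a i (c *: x + y)) = c *: f (upd a i x) + f (upd a i y).

Section Quotient.
Variables (n : nat) (M : lmodType k).

Definition fsum := seq (k * {ffun 'I_n -> M}).

Definition fsum_eval (W : lmodType k) (f : {ffun 'I_n -> M} -> W) (s : fsum) :=
  \sum_(p <- s) p.1 *: f p.2.

Definition fsum_equiv : rel fsum := fun s t =>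
  `[< forall (W : lmodType k) (f : {ffun 'I_n -> M} -> W),
        multilinear f -> fsum_eval f s = fsum_eval f t >].

Lemma fsum_equivP s t :
  reflect (forall (W : lmodType k) (f : {ffun 'I_n -> M} -> W),
            multilinear f -> fsum_eval f s = fsum_eval f t) (fsum_equiv s t).
Proof. exact: asboolP. Qed.

Lemma fsum_equiv_refl : reflexive fsum_equiv.
Proof. by move=> s; apply/fsum_equivP. Qed.

Lemma fsum_equiv_sym : symmetric fsum_equiv.
Proof.
by move=> s t; apply/fsum_equivP/fsum_equivP => H W f mf; rewrite H.
Qed.

Lemma fsum_equiv_trans : transitive fsum_equiv.
Proof.
move=> t s u /fsum_equivP H1 /fsum_equivP H2.
by apply/fsum_equivP => W f mf; rewrite H1 // H2.
Qed.

Canonical fsum_equiv_rel :=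
  EquivRel fsum_equiv fsum_equiv_refl fsum_equiv_sym fsum_equiv_trans.

Definition tens := {eq_quot fsum_equiv}.
HB.instance Definition _ : EqQuotient _ fsum_equiv tens := EqQuotient.on tens.
HB.instance Definition _ := Choice.on tens.

Definition pure (a : {ffun 'I_n -> M}) : tens := \pi_tens [:: (1, a)].

(** Meaningful only for multilinear f, for which it is the linear map sending
   [pure a] to [f a]. *)
Definition tlift (W : lmodType k) (f : {ffun 'I_n -> M} -> W) (x : tens) : W :=
  fsum_eval f (repr x).

Lemma tlift_pi (W : lmodType k) (f : {ffun 'I_n -> M} -> W) s :
  multilinear f -> tlift f (\pi_tens s) = fsum_eval f s.
Proof.
move=> mf; have /eqquotP/fsum_equivP := reprK (\pi_tens s); exact.
Qed.

Lemma tens_ext (x y : tens) :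
  (forall (W : lmodType k) (f : {ffun 'I_n -> M} -> W),
     multilinear f -> tlift f x = tlift f y) -> x = y.
Proof.
move=> H; rewrite -[x]reprK -[y]reprK; apply/eqquotP/fsum_equivP => W f mf.
exact: H.
Qed.

Definition tens_add (x y : tens) : tens := \pi_tens (repr x ++ repr y).
Definition tens_scale (c : k) (x : tens) : tens :=
  \pi_tens [seq (c * p.1, p.2) | p <- repr x].
Definition tens_zero : tens := \pi_tens [::].
Definition tens_opp := tens_scale (-1).

Section Eval.
Variables (W : lmodType k) (f : {ffun 'I_n -> M} -> W).
Hypothesis mf : multilinear f.

Lemma tlift_add x y : tlift f (tens_add x y) = tlift f x + tlift f y.
Proof. by rewrite tlift_pi // /fsum_eval big_cat. Qed.

Lemma tlift_scale c x : tlift f (tens_scale c x) = c *: tlift f x.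
Proof.
rewrite tlift_pi // /fsum_eval big_map scaler_sumr.
by apply: eq_bigr => p _; rewrite scalerA.
Qed.

Lemma tlift_zero : tlift f tens_zero = 0.
Proof. by rewrite tlift_pi // /fsum_eval big_nil. Qed.

Lemma tlift_pure a : tlift f (pure a) = f a.
Proof. by rewrite tlift_pi // /fsum_eval big_seq1 scale1r. Qed.
End Eval.

Lemma tens_addA : associative tens_add.
Proof. by move=> x y z; apply: tens_ext => W f mf; rewrite !tlift_add ?addrA. Qed.
Lemma tens_addC : commutative tens_add.
Proof. by move=> x y; apply: tens_ext => W f mf; rewrite !tlift_add // addrC. Qed.
Lemma tens_add0 : left_id tens_zero tens_add.
Proof.
by move=> x; apply: tens_ext => W f mf; rewrite tlift_add ?tlift_zero ?add0r.
Qed.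
Lemma tens_addN : left_inverse tens_zero tens_opp tens_add.
Proof.
move=> x; apply: tens_ext => W f mf.
by rewrite tlift_add ?tlift_scale ?tlift_zero // scaleN1r addNr.
Qed.

HB.instance Definition _ :=
  GRing.isZmodule.Build tens tens_addA tens_addC tens_add0 tens_addN.

Lemma tens_scaleA a b x : tens_scale a (tens_scale b x) = tens_scale (a * b) x.
Proof. by apply: tens_ext => W f mf; rewrite !tlift_scale ?scalerA. Qed.
Lemma tens_scale1 : left_id 1 tens_scale.
Proof. by move=> x; apply: tens_ext => W f mf; rewrite !tlift_scale ?scale1r. Qed.
Lemma tens_scaleDr : right_distributive tens_scale +%R.
Proof.
move=> c x y; apply: tens_ext => W f mf.
by rewrite tlift_add ?tlift_scale // tlift_add // scalerDr.
Qed.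
Lemma tens_scaleDl x : {morph tens_scale^~ x : a b / a + b}.
Proof.
move=> a b; apply: tens_ext => W f mf.
by rewrite tlift_add ?tlift_scale // scalerDl.
Qed.

HB.instance Definition _ := GRing.Zmodule_isLmodule.Build k tens
  tens_scaleA tens_scale1 tens_scaleDr tens_scaleDl.

Lemma tlift_linear (W : lmodType k) (f : {ffun 'I_n -> M} -> W) c x y :
  multilinear f -> tlift f (c *: x + y) = c *: tlift f x + tlift f y.
Proof. by move=> mf; rewrite tlift_add ?tlift_scale. Qed.

End Quotient.

Arguments tlift {n M W} f x.
Arguments pure {n M} a.

Lemma prod_insert (A : nzRingType) n (i : 'I_n) (a : 'I_n -> A) u :
  \prod_(j < n) (if j == i then u else a j) =
  (\prod_(j < n | (j < i)%N) a j) * u * \prod_(j < n | (i < j)%N) a j.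
Proof.
elim: n i a => [[] //|n IH] i a; rewrite big_ord_recl.
rewrite [in RHS]big_mkcond [X in _ = _ * X]big_mkcond !big_ord_recl /=.
case: (unliftP ord0 i) => [i' ->|->] /=.
  rewrite (eq_bigr (fun j => if j == i' then u else a (lift ord0 j))); last first.
    by move=> j _; rewrite (inj_eq (@lift_inj _ _)).
  by rewrite IH -!big_mkcond mul1r !mulrA.
by rewrite [X in 1 * X * _ * _]big1 // !mul1r.
Qed.

Section Algebra.
Variables (n : nat) (A : algType k).


Let mulf (a b : {ffun 'I_n -> A}) := [ffun i => a i * b i].

Definition tens_mul (x y : tens n A) : tens n A :=
  \pi_(tens n A) [seq (p.1 * q.1, mulf p.2 q.2) | p <- repr x, q <- repr y].
Definition tens_one : tens n A := pure [ffun=> 1].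

Lemma mulf_updl (a b : {ffun 'I_n -> A}) i x :
  mulf (upd a i x) b = upd (mulf a b) i (x * b i).
Proof. by apply/ffunP => j; rewrite !ffunE; case: eqP => // ->. Qed.
Lemma mulf_updr (a b : {ffun 'I_n -> A}) i x :
  mulf a (upd b i x) = upd (mulf a b) i (a i * x).
Proof. by apply/ffunP => j; rewrite !ffunE; case: eqP => // ->. Qed.

Section MulEval.
Variables (W : lmodType k) (f : {ffun 'I_n -> A} -> W).
Hypothesis mf : multilinear f.

Lemma multilinear_mulr a : multilinear (fun b => f (mulf a b)).
Proof.
by move=> b i c x y; rewrite !mulf_updr mulrDr -scalerAr mf.
Qed.

Lemma multilinear_mull y : multilinear (fun a => tlift (fun b => f (mulf a b)) y).
Proof.
move=> a i c u v; rewrite /tlift /fsum_eval scaler_sumr -big_split /=.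
apply: eq_bigr => p _; rewrite !mulf_updl mulrDl -scalerAl mf scalerDr.
by rewrite !scalerA mulrC.
Qed.

Lemma tlift_mul x y :
  tlift f (tens_mul x y) = tlift (fun a => tlift (fun b => f (mulf a b)) y) x.
Proof.
rewrite tlift_pi // /tlift /fsum_eval big_allpairs_dep /=.
apply: eq_bigr => p _; rewrite scaler_sumr; apply: eq_bigr => q _.
by rewrite scalerA.
Qed.
End MulEval.

Lemma eq_tlift (W : lmodType k) (f g : {ffun 'I_n -> A} -> W) x :
  f =1 g -> tlift f x = tlift g x.
Proof. by move=> fg; apply: eq_bigr => p _; rewrite fg. Qed.

Lemma mulfA a b c : mulf (mulf a b) c = mulf a (mulf b c).
Proof. by apply/ffunP => i; rewrite !ffunE mulrA. Qed.

Lemma tens_mulA : associative tens_mul.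
Proof.
move=> x y z; apply: tens_ext => W f mf.
rewrite !tlift_mul //; last exact: multilinear_mull.
apply: eq_tlift => a; rewrite tlift_mul; last exact: multilinear_mulr.
by apply: eq_tlift => b; apply: eq_tlift => c; rewrite mulfA.
Qed.

Lemma tens_mul1x : left_id tens_one tens_mul.
Proof.
move=> x; apply: tens_ext => W f mf; rewrite tlift_mul // tlift_pure.
  by apply: eq_tlift => a; congr f; apply/ffunP => i; rewrite !ffunE mul1r.
exact: multilinear_mull.
Qed.

Lemma tens_mulx1 : right_id tens_one tens_mul.
Proof.
move=> x; apply: tens_ext => W f mf; rewrite tlift_mul //.
apply: eq_tlift => a; rewrite tlift_pure; last exact: multilinear_mulr.
by congr f; apply/ffunP => i; rewrite !ffunE mulr1.
Qed.

Lemma tens_mulDl : left_distributive tens_mul +%R.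
Proof.
move=> x y z; apply: tens_ext => W f mf.
by rewrite tlift_add ?tlift_mul // tlift_add //; apply: multilinear_mull.
Qed.

Lemma tens_mulDr : right_distributive tens_mul +%R.
Proof.
move=> x y z; apply: tens_ext => W f mf; rewrite tlift_add ?tlift_mul //.
rewrite /tlift {1 4 6}/fsum_eval -big_split /=.
apply: eq_bigr => p _; rewrite -scalerDr; congr (_ *: _).
by apply: tlift_add; apply: multilinear_mulr.
Qed.

(* The ordered product A^n -> A is multilinear and separates 1 from 0. *)
Lemma multilinear_prod :
  multilinear (fun a : {ffun 'I_n -> A} => \prod_(i < n) a i : A).
Proof.
move=> a i c x y; have E u : \prod_(j < n) upd a i u j =
   (\prod_(j < n | (j < i)%N) a j) * u * \prod_(j < n | (i < j)%N) a j.
  rewrite -prod_insert; apply: eq_bigr => j _; by rewrite ffunE.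
by rewrite !E mulrDr mulrDl -scalerAr -scalerAl.
Qed.

Lemma tens_one_neq0 : tens_one != 0.
Proof.
have mp := multilinear_prod.
apply/eqP => /(congr1 (tlift (fun a : {ffun 'I_n -> A} => \prod_(i < n) a i : A))).
rewrite tlift_pure // [RHS]tlift_zero // big1 => [/eqP|i _].
  by rewrite oner_eq0.
by rewrite ffunE.
Qed.

HB.instance Definition _ := GRing.Zmodule_isNzRing.Build (tens n A)
  tens_mulA tens_mul1x tens_mulx1 tens_mulDl tens_mulDr tens_one_neq0.

Lemma tens_scaleAl (c : k) (x y : tens n A) : c *: (x * y) = (c *: x) * y.
Proof.
apply: tens_ext => W f mf; rewrite tlift_scale ?tlift_mul //.
by rewrite tlift_scale //; apply: multilinear_mull.
Qed.

HB.instance Definition _ := GRing.Lmodule_isLalgebra.Build k (tens n A)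
  tens_scaleAl.

Lemma tens_scaleAr (c : k) (x y : tens n A) : c *: (x * y) = x * (c *: y).
Proof.
apply: tens_ext => W f mf; rewrite tlift_scale ?tlift_mul //.
rewrite /tlift {1 3}/fsum_eval scaler_sumr; apply: eq_bigr => p _.
rewrite scalerA mulrC -scalerA; congr (_ *: _).
by symmetry; apply: tlift_scale; apply: multilinear_mulr.
Qed.

HB.instance Definition _ := GRing.Lalgebra_isAlgebra.Build k (tens n A)
  tens_scaleAr.

End Algebra.
End Tensors.

Arguments tlift {k n M W} f x.
Arguments pure {k n M} a.

(** T(V) is the free associative algebra on the vector space V: terms in the
   algebra operations over V, two of them being identified when they take the
   same value under every linear map from V to an algebra. *)

Inductive talg_term (k V : Type) :=
  | TVar of V
  | TOne
  | TAdd of talg_term k V & talg_term k V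
  | TScale of k & talg_term k V
  | TMul of talg_term k V & talg_term k V.
Arguments TOne {k V}.
Arguments TVar {k V} _.

HB.instance Definition _ (k V : Type) := gen_eqMixin (talg_term k V).
HB.instance Definition _ (k V : Type) := gen_choiceMixin (talg_term k V).

Section TensorAlgebra.
Variables (k : comNzRingType) (V : lmodType k).
Local Notation term := (talg_term k V).

Fixpoint tterm_eval (B : algType k) (f : V -> B) (t : term) : B :=
  match t with
  | TVar x => f x
  | TOne => 1
  | TAdd a b => tterm_eval f a + tterm_eval f b
  | TScale c a => c *: tterm_eval f a
  | TMul a b => tterm_eval f a * tterm_eval f b
  end.

Definition tterm_equiv : rel term := fun s t =>
  `[< forall (B : algType k) (f : {linear V -> B}),
        tterm_eval f s = tterm_eval f t >].

Lemma tterm_equivP s t :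
  reflect (forall (B : algType k) (f : {linear V -> B}),
             tterm_eval f s = tterm_eval f t) (tterm_equiv s t).
Proof. exact: asboolP. Qed.

Lemma tterm_equiv_refl : reflexive tterm_equiv.
Proof. by move=> s; apply/tterm_equivP. Qed.
Lemma tterm_equiv_sym : symmetric tterm_equiv.
Proof. by move=> s t; apply/tterm_equivP/tterm_equivP => H B f; rewrite H. Qed.
Lemma tterm_equiv_trans : transitive tterm_equiv.
Proof.
move=> t s u /tterm_equivP H1 /tterm_equivP H2.
by apply/tterm_equivP => B f; rewrite H1.
Qed.

Canonical tterm_equiv_rel :=
  EquivRel tterm_equiv tterm_equiv_refl tterm_equiv_sym tterm_equiv_trans.

Definition talg := {eq_quot tterm_equiv}.
HB.instance Definition _ : EqQuotient _ tterm_equiv talg := EqQuotient.on talg.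
HB.instance Definition _ := Choice.on talg.

Definition talg_lift (B : algType k) (f : V -> B) (x : talg) : B :=
  tterm_eval f (repr x).

Lemma talg_lift_pi (B : algType k) (f : {linear V -> B}) t :
  talg_lift f (\pi_talg t) = tterm_eval f t.
Proof. by have /eqquotP/tterm_equivP := reprK (\pi_talg t); apply. Qed.

Lemma talg_ext (x y : talg) :
  (forall (B : algType k) (f : {linear V -> B}), talg_lift f x = talg_lift f y) ->
  x = y.
Proof.
move=> H; rewrite -[x]reprK -[y]reprK; apply/eqquotP/tterm_equivP => B f.
exact: H.
Qed.

Definition talg_gen (x : V) : talg := \pi_talg (TVar x).
Definition talg_one : talg := \pi_talg TOne.
Definition talg_add (x y : talg) : talg := \pi_talg (TAdd (repr x) (repr y)).
Definition talg_scale (c : k) (x : talg) : talg := \pi_talg (TScale c (repr x)).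
Definition talg_mul (x y : talg) : talg := \pi_talg (TMul (repr x) (repr y)).
Definition talg_zero : talg := talg_scale 0 talg_one.
Definition talg_opp := talg_scale (-1).

Section Eval.
Variables (B : algType k) (f : {linear V -> B}).
Lemma talg_lift_gen x : talg_lift f (talg_gen x) = f x.
Proof. exact: talg_lift_pi. Qed.
Lemma talg_lift_one : talg_lift f talg_one = 1.
Proof. exact: talg_lift_pi. Qed.
Lemma talg_lift_add x y :
  talg_lift f (talg_add x y) = talg_lift f x + talg_lift f y.
Proof. exact: talg_lift_pi. Qed.
Lemma talg_lift_scale c x : talg_lift f (talg_scale c x) = c *: talg_lift f x.
Proof. exact: talg_lift_pi. Qed.
Lemma talg_lift_mul x y :
  talg_lift f (talg_mul x y) = talg_lift f x * talg_lift f y.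
Proof. exact: talg_lift_pi. Qed.
Lemma talg_lift_zero : talg_lift f talg_zero = 0.
Proof. by rewrite talg_lift_scale scale0r. Qed.
End Eval.

Let simp := (talg_lift_one, talg_lift_add, talg_lift_scale, talg_lift_mul,
             talg_lift_zero).

Lemma talg_addA : associative talg_add.
Proof. by move=> x y z; apply: talg_ext => B f; rewrite !simp addrA. Qed.
Lemma talg_addC : commutative talg_add.
Proof. by move=> x y; apply: talg_ext => B f; rewrite !simp addrC. Qed.
Lemma talg_add0 : left_id talg_zero talg_add.
Proof. by move=> x; apply: talg_ext => B f; rewrite !simp add0r. Qed.
Lemma talg_addN : left_inverse talg_zero talg_opp talg_add.
Proof. by move=> x; apply: talg_ext => B f; rewrite !simp scaleN1r addNr. Qed.

HB.instance Definition _ :=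
  GRing.isZmodule.Build talg talg_addA talg_addC talg_add0 talg_addN.

Lemma talg_mulA : associative talg_mul.
Proof. by move=> x y z; apply: talg_ext => B f; rewrite !simp mulrA. Qed.
Lemma talg_mul1x : left_id talg_one talg_mul.
Proof. by move=> x; apply: talg_ext => B f; rewrite !simp mul1r. Qed.
Lemma talg_mulx1 : right_id talg_one talg_mul.
Proof. by move=> x; apply: talg_ext => B f; rewrite !simp mulr1. Qed.
Lemma talg_mulDl : left_distributive talg_mul +%R.
Proof. by move=> x y z; apply: talg_ext => B f; rewrite !simp mulrDl. Qed.
Lemma talg_mulDr : right_distributive talg_mul +%R.
Proof. by move=> x y z; apply: talg_ext => B f; rewrite !simp mulrDr. Qed.
Lemma talg_one_neq0 : talg_one != 0.
Proof.
apply/eqP => /(congr1 (talg_lift (\0 : {linear V -> k^o}))).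
by rewrite talg_lift_one [RHS]talg_lift_zero => /eqP; rewrite oner_eq0.
Qed.

HB.instance Definition _ := GRing.Zmodule_isNzRing.Build talg
  talg_mulA talg_mul1x talg_mulx1 talg_mulDl talg_mulDr talg_one_neq0.

Lemma talg_scaleA a b x : talg_scale a (talg_scale b x) = talg_scale (a * b) x.
Proof. by apply: talg_ext => B f; rewrite !simp scalerA. Qed.
Lemma talg_scale1 : left_id 1 talg_scale.
Proof. by move=> x; apply: talg_ext => B f; rewrite !simp scale1r. Qed.
Lemma talg_scaleDr : right_distributive talg_scale +%R.
Proof. by move=> c x y; apply: talg_ext => B f; rewrite !simp scalerDr. Qed.
Lemma talg_scaleDl x : {morph talg_scale^~ x : a b / a + b}.
Proof. by move=> a b; apply: talg_ext => B f; rewrite !simp scalerDl. Qed.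

HB.instance Definition _ := GRing.Zmodule_isLmodule.Build k talg
  talg_scaleA talg_scale1 talg_scaleDr talg_scaleDl.

Lemma talg_scaleAl (c : k) (x y : talg) : c *: (x * y) = (c *: x) * y.
Proof. by apply: talg_ext => B f; rewrite !simp scalerAl. Qed.
HB.instance Definition _ := GRing.Lmodule_isLalgebra.Build k talg talg_scaleAl.

Lemma talg_scaleAr (c : k) (x y : talg) : c *: (x * y) = x * (c *: y).
Proof. by apply: talg_ext => B f; rewrite !simp scalerAr. Qed.
HB.instance Definition _ := GRing.Lalgebra_isAlgebra.Build k talg talg_scaleAr.

Lemma talg_gen_linear : linear talg_gen.
Proof.
by move=> c x y; apply: talg_ext => B f; rewrite !simp !talg_lift_gen linearP.
Qed.
HB.instance Definition _ :=
  GRing.isLinear.Build k V talg *:%R talg_gen talg_gen_linear.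

Section Lift.
Variables (B : algType k) (f : {linear V -> B}).
Lemma talg_lift_linear : linear (talg_lift f).
Proof. by move=> c x y; rewrite talg_lift_add talg_lift_scale. Qed.
Lemma talg_lift_monoid_morphism : monoid_morphism (talg_lift f).
Proof. by split; [exact: talg_lift_one | exact: talg_lift_mul]. Qed.
HB.instance Definition _ :=
  GRing.isLinear.Build k talg B *:%R (talg_lift f) talg_lift_linear.
HB.instance Definition _ :=
  GRing.isMonoidMorphism.Build talg B (talg_lift f) talg_lift_monoid_morphism.
End Lift.

Lemma talg_ind (P : talg -> Prop) :
  (forall x, P (talg_gen x)) -> P 1 ->
  (forall x y, P x -> P y -> P (x + y)) -> (forall c x, P x -> P (c *: x)) ->
  (forall x y, P x -> P y -> P (x * y)) -> forall x, P x.
Proof.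
move=> Pg P1 PD PZ PM x; rewrite -[x]reprK; elim: (repr x) => [v||s Ps t Pt|c s Ps|s Ps t Pt].
- exact: Pg.
- exact: P1.
- suff ->: \pi_talg (TAdd s t) = \pi_talg s + \pi_talg t by exact: PD.
  by apply: talg_ext => B f; rewrite [RHS]talg_lift_add !talg_lift_pi.
- suff ->: \pi_talg (TScale c s) = c *: \pi_talg s by exact: PZ.
  by apply: talg_ext => B f; rewrite [RHS]talg_lift_scale !talg_lift_pi.
- suff ->: \pi_talg (TMul s t) = \pi_talg s * \pi_talg t by exact: PM.
  by apply: talg_ext => B f; rewrite [RHS]talg_lift_mul !talg_lift_pi.
Qed.

Lemma talg_lift_unique (B : algType k) (F G : {lrmorphism talg -> B}) :
  (forall x, F (talg_gen x) = G (talg_gen x)) -> F =1 G.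
Proof.
move=> FG; apply: talg_ind => [//||x y Fx Fy|c x Fx|x y Fx Fy].
- by rewrite !rmorph1.
- by rewrite !rmorphD /= Fx Fy.
- by rewrite !linearZ /= Fx.
- by rewrite !rmorphM /= Fx Fy.
Qed.

End TensorAlgebra.

(** L(V) is obtained in the same way: two Lie terms over V are identified when
   they take the same value under every linear map from V to a Lie algebra. *)

Inductive flie_term (k V : Type) :=
  | LVar of V
  | LAdd of flie_term k V & flie_term k V
  | LScale of k & flie_term k V
  | LLie of flie_term k V & flie_term k V.
Arguments LVar {k V} _.

HB.instance Definition _ (k V : Type) := gen_eqMixin (flie_term k V).
HB.instance Definition _ (k V : Type) := gen_choiceMixin (flie_term k V).

Section FreeLie.
Variables (k : comNzRingType) (V : lmodType k).
Local Notation term := (flie_term k V).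

Fixpoint lterm_eval (g : lieAlgType k) (f : V -> g) (t : term) : g :=
  match t with
  | LVar x => f x
  | LAdd a b => lterm_eval f a + lterm_eval f b
  | LScale c a => c *: lterm_eval f a
  | LLie a b => lie (lterm_eval f a) (lterm_eval f b)
  end.

Definition lterm_equiv : rel term := fun s t =>
  `[< forall (g : lieAlgType k) (f : {linear V -> g}),
        lterm_eval f s = lterm_eval f t >].

Lemma lterm_equivP s t :
  reflect (forall (g : lieAlgType k) (f : {linear V -> g}),
             lterm_eval f s = lterm_eval f t) (lterm_equiv s t).
Proof. exact: asboolP. Qed.

Lemma lterm_equiv_refl : reflexive lterm_equiv.
Proof. by move=> s; apply/lterm_equivP. Qed.
Lemma lterm_equiv_sym : symmetric lterm_equiv.
Proof. by move=> s t; apply/lterm_equivP/lterm_equivP => H g f; rewrite H. Qed.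
Lemma lterm_equiv_trans : transitive lterm_equiv.
Proof.
move=> t s u /lterm_equivP H1 /lterm_equivP H2.
by apply/lterm_equivP => g f; rewrite H1.
Qed.

Canonical lterm_equiv_rel :=
  EquivRel lterm_equiv lterm_equiv_refl lterm_equiv_sym lterm_equiv_trans.

Definition flie := {eq_quot lterm_equiv}.
HB.instance Definition _ : EqQuotient _ lterm_equiv flie := EqQuotient.on flie.
HB.instance Definition _ := Choice.on flie.

Definition flie_lift (g : lieAlgType k) (f : V -> g) (x : flie) : g :=
  lterm_eval f (repr x).

Lemma flie_lift_pi (g : lieAlgType k) (f : {linear V -> g}) t :
  flie_lift f (\pi_flie t) = lterm_eval f t.
Proof. by have /eqquotP/lterm_equivP := reprK (\pi_flie t); apply. Qed.

Lemma flie_ext (x y : flie) :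
  (forall (g : lieAlgType k) (f : {linear V -> g}),
     flie_lift f x = flie_lift f y) -> x = y.
Proof.
move=> H; rewrite -[x]reprK -[y]reprK; apply/eqquotP/lterm_equivP => g f.
exact: H.
Qed.

Definition flie_gen (x : V) : flie := \pi_flie (LVar x).
Definition flie_add (x y : flie) : flie := \pi_flie (LAdd (repr x) (repr y)).
Definition flie_scale (c : k) (x : flie) : flie := \pi_flie (LScale c (repr x)).
Definition flie_lie (x y : flie) : flie := \pi_flie (LLie (repr x) (repr y)).
Definition flie_zero : flie := flie_gen 0.
Definition flie_opp := flie_scale (-1).

Section Eval.
Variables (g : lieAlgType k) (f : {linear V -> g}).
Lemma flie_lift_gen x : flie_lift f (flie_gen x) = f x.
Proof. exact: flie_lift_pi. Qed.
Lemma flie_lift_add x y :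
  flie_lift f (flie_add x y) = flie_lift f x + flie_lift f y.
Proof. exact: flie_lift_pi. Qed.
Lemma flie_lift_scale c x : flie_lift f (flie_scale c x) = c *: flie_lift f x.
Proof. exact: flie_lift_pi. Qed.
Lemma flie_lift_lie x y :
  flie_lift f (flie_lie x y) = lie (flie_lift f x) (flie_lift f y).
Proof. exact: flie_lift_pi. Qed.
Lemma flie_lift_zero : flie_lift f flie_zero = 0.
Proof. by rewrite flie_lift_gen linear0. Qed.
End Eval.

Let simp := (flie_lift_add, flie_lift_scale, flie_lift_lie, flie_lift_zero).

Lemma flie_addA : associative flie_add.
Proof. by move=> x y z; apply: flie_ext => g f; rewrite !simp addrA. Qed.
Lemma flie_addC : commutative flie_add.
Proof. by move=> x y; apply: flie_ext => g f; rewrite !simp addrC. Qed.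
Lemma flie_add0 : left_id flie_zero flie_add.
Proof. by move=> x; apply: flie_ext => g f; rewrite !simp add0r. Qed.
Lemma flie_addN : left_inverse flie_zero flie_opp flie_add.
Proof. by move=> x; apply: flie_ext => g f; rewrite !simp scaleN1r addNr. Qed.

HB.instance Definition _ :=
  GRing.isZmodule.Build flie flie_addA flie_addC flie_add0 flie_addN.

Lemma flie_scaleA a b x : flie_scale a (flie_scale b x) = flie_scale (a * b) x.
Proof. by apply: flie_ext => g f; rewrite !simp scalerA. Qed.
Lemma flie_scale1 : left_id 1 flie_scale.
Proof. by move=> x; apply: flie_ext => g f; rewrite !simp scale1r. Qed.
Lemma flie_scaleDr : right_distributive flie_scale +%R.
Proof. by move=> c x y; apply: flie_ext => g f; rewrite !simp scalerDr. Qed.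
Lemma flie_scaleDl x : {morph flie_scale^~ x : a b / a + b}.
Proof. by move=> a b; apply: flie_ext => g f; rewrite !simp scalerDl. Qed.

HB.instance Definition _ := GRing.Zmodule_isLmodule.Build k flie
  flie_scaleA flie_scale1 flie_scaleDr flie_scaleDl.

Lemma flie_lieZDl (c : k) (x y z : flie) :
  flie_lie (c *: x + y) z = c *: flie_lie x z + flie_lie y z.
Proof. by apply: flie_ext => g f; rewrite !simp lieZDl. Qed.
Lemma flie_lieZDr (c : k) (x y z : flie) :
  flie_lie z (c *: x + y) = c *: flie_lie z x + flie_lie z y.
Proof. by apply: flie_ext => g f; rewrite !simp lieZDr. Qed.
Lemma flie_liexx x : flie_lie x x = 0.
Proof. by apply: flie_ext => g f; rewrite !simp liexx. Qed.
Lemma flie_jacobi x y z :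
  flie_lie x (flie_lie y z) + flie_lie y (flie_lie z x)
    + flie_lie z (flie_lie x y) = 0.
Proof. by apply: flie_ext => g f; rewrite !simp jacobi. Qed.

HB.instance Definition _ := Lmodule_isLie.Build k flie
  flie_lieZDl flie_lieZDr flie_liexx flie_jacobi.

Lemma flie_gen_linear : linear flie_gen.
Proof.
by move=> c x y; apply: flie_ext => g f; rewrite !simp !flie_lift_gen linearP.
Qed.
HB.instance Definition _ :=
  GRing.isLinear.Build k V flie *:%R flie_gen flie_gen_linear.

Section Lift.
Variables (g : lieAlgType k) (f : {linear V -> g}).
Lemma flie_lift_linear : linear (flie_lift f).
Proof. by move=> c x y; rewrite flie_lift_add flie_lift_scale. Qed.
HB.instance Definition _ :=
  GRing.isLinear.Build k flie g *:%R (flie_lift f) flie_lift_linear.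
Lemma flie_liftL x y :
  flie_lift f (lie x y) = lie (flie_lift f x) (flie_lift f y).
Proof. exact: flie_lift_lie. Qed.
End Lift.

Lemma flie_ind (P : flie -> Prop) :
  (forall x, P (flie_gen x)) ->
  (forall x y, P x -> P y -> P (x + y)) -> (forall c x, P x -> P (c *: x)) ->
  (forall x y, P x -> P y -> P (lie x y)) -> forall x, P x.
Proof.
move=> Pg PD PZ PM x; rewrite -[x]reprK; elim: (repr x) => [v|s Ps t Pt|c s Ps|s Ps t Pt].
- exact: Pg.
- suff ->: \pi_flie (LAdd s t) = \pi_flie s + \pi_flie t by exact: PD.
  by apply: flie_ext => g f; rewrite [RHS]flie_lift_add !flie_lift_pi.
- suff ->: \pi_flie (LScale c s) = c *: \pi_flie s by exact: PZ.
  by apply: flie_ext => g f; rewrite [RHS]flie_lift_scale !flie_lift_pi.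
- suff ->: \pi_flie (LLie s t) = lie (\pi_flie s) (\pi_flie t) by exact: PM.
  by apply: flie_ext => g f; rewrite [RHS]flie_lift_lie !flie_lift_pi.
Qed.

End FreeLie.

Definition commutator_lie (k : comNzRingType) (A : algType k) : Type := A.

Section CommutatorLie.
Variables (k : comNzRingType) (A : algType k).
HB.instance Definition _ := GRing.Lmodule.on (commutator_lie A).
Let brk (x y : commutator_lie A) : commutator_lie A := comm (x : A) y.

Lemma commutator_lieZDl (c : k) x y z :
  brk (c *: x + y) z = c *: brk x z + brk y z.
Proof.
rewrite /brk /comm mulrDl mulrDr -scalerAl -scalerAr scalerBr opprD.
by rewrite addrACA.
Qed.
Lemma commutator_lieZDr (c : k) x y z :
  brk z (c *: x + y) = c *: brk z x + brk z y.
Proof.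
rewrite /brk /comm mulrDl mulrDr -scalerAl -scalerAr scalerBr opprD.
by rewrite addrACA.
Qed.
Lemma commutator_liexx x : brk x x = 0.
Proof. exact: subrr. Qed.
Lemma commutator_jacobi x y z :
  brk x (brk y z) + brk y (brk z x) + brk z (brk x y) = 0.
Proof.
have E (a b c d : A) : a - b - (c - d) = a + d - (b + c).
  by rewrite opprB opprD addrACA.
rewrite /brk /comm !mulrBl !mulrBr !mulrA !E.
rewrite [y * z * x + _]addrC [z * x * y + _]addrC [z * y * x + _]addrC.
by rewrite !subrKA subrr.
Qed.
HB.instance Definition _ := Lmodule_isLie.Build k (commutator_lie A)
  commutator_lieZDl commutator_lieZDr commutator_liexx commutator_jacobi.
End CommutatorLie.

(** The canonical morphism L(V) -> T(V) = U(L(V)). *)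
Definition flie_talg (k : comNzRingType) (V : lmodType k) (x : flie V) : talg V :=
  flie_lift (@talg_gen k V : V -> commutator_lie (talg V)) x.

Section Inclusion.
Variables (k : comNzRingType) (V : lmodType k).
Let gen (x : V) : commutator_lie (talg V) := talg_gen x.
Let gen_linear : linear gen. Proof. exact: linearP. Qed.
HB.instance Definition _ :=
  GRing.isLinear.Build k V (commutator_lie (talg V)) *:%R gen gen_linear.
Lemma flie_talg_linear : linear (@flie_talg k V).
Proof. exact: (flie_lift_linear gen). Qed.
HB.instance Definition _ :=
  GRing.isLinear.Build k (flie V) (talg V) *:%R (@flie_talg k V) flie_talg_linear.
Lemma flie_talg_gen (x : V) : flie_talg (flie_gen x) = talg_gen x.
Proof. exact: (flie_lift_gen gen). Qed.
Lemma flie_talg_lie : lie_to_alg (@flie_talg k V).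
Proof. exact: (flie_lift_lie gen). Qed.
End Inclusion.

(** [series M] is M[[h]], viewed as a module over k[[h]] = [series k].
   The h-adic completion of M[[h]] ⊗ N[[h]] over k[[h]] is (M ⊗ N)[[h]], so the
   n-th completed tensor power of M[[h]] is [series (tens n M)].
   A k[[h]]-linear map between such modules is automatically h-adically
   continuous, since it maps h^n M[[h]] to h^n N[[h]]. *)

Record series (A : Type) := Series { coef :> nat -> A }.

HB.instance Definition _ (A : Type) := gen_eqMixin (series A).
HB.instance Definition _ (A : Type) := gen_choiceMixin (series A).

Lemma seriesP (A : Type) (X Y : series A) : (forall n, X n = Y n) -> X = Y.
Proof. by case: X Y => [X] [Y] XY; congr Series; apply/funext. Qed.

Lemma conv3 (U : zmodType) (F : nat -> nat -> nat -> U) n :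
  \sum_(i < n.+1) \sum_(j < (n - i).+1) F i j (n - i - j)%N =
  \sum_(i < n.+1) \sum_(j < i.+1) F j (i - j)%N (n - i)%N.
Proof.
transitivity (\sum_(i < n.+1) \sum_(j < n.+1 | (i <= j)%N) F i (j - i)%N (n - j)%N).
  apply: eq_bigr => i _; have le_in : (i <= n)%N by rewrite -ltnS.
  rewrite -(big_mkord (fun j => true) (fun j => F i j (n - i - j)%N)).
  rewrite -(big_mkord (fun j => (i <= j)%N) (fun j => F i (j - i)%N (n - j)%N)).
  rewrite [RHS](big_cat_nat (n := i)) //=; last by rewrite ltnW ?ltnS.
  rewrite [X in _ = X + _]big1_seq ?add0r; last first.
    by move=> j /andP[ij]; rewrite mem_index_iota /= ltnNge ij.
  have := @big_addn _ 0 +%R 0 n.+1 i (fun j => (i <= j)%N)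
    (fun j => F i (j - i)%N (n - j)%N).
  rewrite add0n => ->; rewrite subSn // [RHS]big_mkcond /=.
  rewrite big_nat_cond [RHS]big_nat_cond; apply: eq_bigr => j _.
  by rewrite leq_addl addnK addnC subnDA.
rewrite (exchange_big_dep predT) //=; apply: eq_bigr => i _.
by rewrite (big_ord_narrow_leq (leq_ord i)).
Qed.

Section SeriesZmod.
Variable A : zmodType.
Implicit Types X Y Z : series A.
Definition series_add X Y := Series (fun n => X n + Y n).
Definition series_zero : series A := Series (fun=> 0).
Definition series_opp X := Series (fun n => - X n).
Lemma series_addA : associative series_add.
Proof. by move=> X Y Z; apply: seriesP => n; apply: addrA. Qed.
Lemma series_addC : commutative series_add.
Proof. by move=> X Y; apply: seriesP => n; apply: addrC. Qed.
Lemma series_add0 : left_id series_zero series_add.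
Proof. by move=> X; apply: seriesP => n; apply: add0r. Qed.
Lemma series_addN : left_inverse series_zero series_opp series_add.
Proof. by move=> X; apply: seriesP => n; apply: addNr. Qed.
HB.instance Definition _ := GRing.isZmodule.Build (series A)
  series_addA series_addC series_add0 series_addN.
Definition cst (a : A) : series A := Series (fun n => if n is 0%N then a else 0).
End SeriesZmod.

Section SeriesRing.
Variable A : nzRingType.
Implicit Types X Y Z : series A.
Definition series_mul X Y :=
  Series (fun n => \sum_(i < n.+1) X i * Y (n - i)%N).
Lemma series_mulA : associative series_mul.
Proof.
move=> X Y Z; apply: seriesP => n /=.
under eq_bigr do rewrite mulr_sumr.
under [RHS]eq_bigr do rewrite mulr_suml.
rewrite (conv3 (fun i j l => X i * (Y j * Z l))).
by apply: eq_bigr => i _; apply: eq_bigr => j _; rewrite mulrA.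
Qed.
Lemma series_mul1x : left_id (cst 1) series_mul.
Proof.
move=> X; apply: seriesP => n /=; rewrite big_ord_recl /= mul1r subn0.
by rewrite big1 ?addr0 // => i _; rewrite mul0r.
Qed.
Lemma series_mulx1 : right_id (cst 1) series_mul.
Proof.
move=> X; apply: seriesP => n /=; rewrite big_ord_recr /= subnn mulr1.
rewrite big1 ?add0r // => i _.
have : (0 < n - i)%N by rewrite subn_gt0.
by case: (n - _)%N => // m _; rewrite mulr0.
Qed.
Lemma series_mulDl : left_distributive series_mul +%R.
Proof.
move=> X Y Z; apply: seriesP => n /=; rewrite -big_split /=.
by apply: eq_bigr => i _; rewrite mulrDl.
Qed.
Lemma series_mulDr : right_distributive series_mul +%R.
Proof.
move=> X Y Z; apply: seriesP => n /=; rewrite -big_split /=.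
by apply: eq_bigr => i _; rewrite mulrDr.
Qed.
Lemma series_one_neq0 : cst (1 : A) != 0.
Proof.
by apply/eqP => /(congr1 (fun X : series A => X 0%N)) /= /eqP; rewrite oner_eq0.
Qed.
HB.instance Definition _ := GRing.Zmodule_isNzRing.Build (series A)
  series_mulA series_mul1x series_mulx1 series_mulDl series_mulDr
  series_one_neq0.
End SeriesRing.

Section SeriesComRing.
Variable k : comNzRingType.
Lemma series_mulC : commutative (@series_mul k).
Proof.
move=> X Y; apply: seriesP => n /=; rewrite (reindex_inj rev_ord_inj) /=.
by apply: eq_bigr => i _; rewrite subSS mulrC subKn // -ltnS.
Qed.
HB.instance Definition _ :=
  GRing.PzRing_hasCommutativeMul.Build (series k) series_mulC.
Definition hvar : series k := Series (fun n => (n == 1%N)%:R).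
End SeriesComRing.
Arguments hvar {k}.

Section SeriesLmod.
Variables (k : comNzRingType) (M : lmodType k).
Implicit Types (c : series k) (X Y : series M).
Definition series_scale c X :=
  Series (fun n => \sum_(i < n.+1) c i *: X (n - i)%N).
Lemma series_scaleA a b X :
  series_scale a (series_scale b X) = series_scale (a * b) X.
Proof.
apply: seriesP => n /=.
under eq_bigr do rewrite scaler_sumr.
under [RHS]eq_bigr do rewrite scaler_suml.
rewrite (conv3 (fun i j l => a i *: (b j *: X l))).
by apply: eq_bigr => i _; apply: eq_bigr => j _; rewrite scalerA.
Qed.
Lemma series_scale1 : left_id 1 series_scale.
Proof.
move=> X; apply: seriesP => n /=; rewrite big_ord_recl /= scale1r subn0.
by rewrite big1 ?addr0 // => i _; rewrite scale0r.
Qed.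
Lemma series_scaleDr : right_distributive series_scale +%R.
Proof.
move=> c X Y; apply: seriesP => n /=; rewrite -big_split /=.
by apply: eq_bigr => i _; rewrite scalerDr.
Qed.
Lemma series_scaleDl X : {morph series_scale^~ X : a b / a + b}.
Proof.
move=> a b; apply: seriesP => n /=; rewrite -big_split /=.
by apply: eq_bigr => i _; rewrite scalerDl.
Qed.
HB.instance Definition _ := GRing.Zmodule_isLmodule.Build (series k) (series M)
  series_scaleA series_scale1 series_scaleDr series_scaleDl.

(** X ≡ Y mod h^n. *)
Definition eqmodh n X Y := exists Z : series M, X = Y + hvar ^+ n *: Z.
End SeriesLmod.

Section SeriesAlg.
Variables (k : comNzRingType) (A : algType k).
Lemma series_scaleAl (c : series k) (X Y : series A) :
  c *: (X * Y) = (c *: X) * Y.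
Proof.
apply: seriesP => n /=.
under eq_bigr do rewrite scaler_sumr.
under [RHS]eq_bigr do rewrite mulr_suml.
rewrite (conv3 (fun i j l => c i *: (X j * Y l))).
by apply: eq_bigr => i _; apply: eq_bigr => j _; rewrite scalerAl.
Qed.
HB.instance Definition _ :=
  GRing.Lmodule_isLalgebra.Build (series k) (series A) series_scaleAl.
Lemma series_scaleAr (c : series k) (X Y : series A) :
  c *: (X * Y) = X * (c *: Y).
Proof.
apply: seriesP => n /=.
under eq_bigr do rewrite scaler_sumr.
under [RHS]eq_bigr do rewrite mulr_sumr.
rewrite (conv3 (fun i j l => c i *: (X j * Y l))).
rewrite (conv3 (fun j i l => X j * (c i *: Y l))).
apply: eq_bigr => i _; rewrite [RHS](reindex_inj rev_ord_inj) /=.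
apply: eq_bigr => j _; rewrite subSS subKn ?scalerAr //.
by rewrite -ltnS.
Qed.
HB.instance Definition _ :=
  GRing.Lalgebra_isAlgebra.Build (series k) (series A) series_scaleAr.
End SeriesAlg.

Section TensorOps.
Variable k : comNzRingType.

Definition tens2 (M : lmodType k) (x y : M) : tens 2 M :=
  pure [ffun i : 'I_2 => if i == 0 then x else y].

Definition tmap (M N : lmodType k) n (f : M -> N) : tens n M -> tens n N :=
  tlift (fun a => pure [ffun i => f (a i)]).

Definition tpermute (M : lmodType k) n (s : 'I_n -> 'I_n) : tens n M -> tens n M :=
  tlift (fun a => pure [ffun i => a (s i)]).

Definition talt (M : lmodType k) n (t : tens n M) : tens n M :=
  \sum_(s : 'S_n) (-1) ^+ s *: tpermute s t.

Definition tcyc (M : lmodType k) (t : tens 3 M) : tens 3 M :=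
  \sum_(j : 'I_3) tpermute (fun i => i + j) t.

(** Membership in Λ^n M, seen as the antisymmetric tensors. *)
Definition antisymmetric_tens (M : lmodType k) n (t : tens n M) : Prop :=
  forall s : 'S_n, tpermute s t = (-1) ^+ s *: t.

(** 1⊗…⊗a⊗…⊗1 with a in the i-th factor; factors are numbered from 1. *)
Definition leg (A : algType k) n (i : nat) (a : A) : tens n A :=
  pure [ffun j : 'I_n => if j.+1 == i then a else 1].

(** [place n [:: i1; ...; im] X] is X^{i1...im} in A^{⊗n}, for pairwise
    distinct i1, ..., im. *)
Definition place (A : algType k) m n (s : seq nat) : tens m A -> tens n A :=
  tlift (fun a => \prod_(i < m) leg n (nth 0%N s i) (a i)).

Definition smap (M N : Type) (f : M -> N) (X : series M) : series N :=
  Series (fun n => f (X n)).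

(** The k[[h]]-linear continuous map sending the constant series [pure a] to
    [F a], for multilinear F. *)
Definition hlift (M W : lmodType k) n (F : {ffun 'I_n -> M} -> series W)
    (X : series (tens n M)) : series W :=
  Series (fun m => \sum_(i < m.+1) tlift (fun a => F a (m - i)%N) (X i)).

End TensorOps.

Arguments place {k A m} n s.
Arguments leg {k A} n i a.

Section QuasiLieBialgebra.
Variables (k : comNzRingType) (g : lieAlgType k).

(** The adjoint action, i.e. the bracket with Σ_i x^{(i)}. *)
Definition lie_act n (x : g) : tens n g -> tens n g :=
  tlift (fun a => \sum_(i < n) pure (upd a i (lie x (a i)))).

(** δ ⊗ id ⊗ … ⊗ id *)
Definition cobr_first n (delta : g -> tens 2 g) : tens n.+1 g -> tens n.+2 g :=
  tlift (fun a => tlift (fun b : {ffun 'I_2 -> g} =>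
    pure [ffun i : 'I_n.+2 => if (i < 2)%N then b (inord i) else a (inord i.-1)])
    (delta (a ord0))).

Record quasiLieBialg := QuasiLieBialg {
  cobr : {linear g -> tens 2 g};
  coass : tens 3 g;
  cobr_antisym : forall x, antisymmetric_tens (cobr x);
  coass_antisym : antisymmetric_tens coass;
  cobr_cocycle : forall x y,
    cobr (lie x y) = lie_act x (cobr y) - lie_act y (cobr x);
  cobr_cojacobi : forall x, tcyc (cobr_first cobr (cobr x)) = lie_act x coass;
  coass_closed : talt (cobr_first cobr coass) = 0
}.

End QuasiLieBialgebra.

(** Quasi-Hopf algebras over k[[h]] with underlying algebra A[[h]], for a
   k-algebra A; tensor products over k[[h]] are completed. *)

Section QuasiHopf.
Variables (k : comNzRingType) (A : algType k).
Variable Delta : {lrmorphism series A -> series (tens 2 A)}.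
Variable eps : {lrmorphism series A -> (series k)^o}.
Variable Phi : series (tens 3 A).

Definition hleg n i (a : A) : series (tens n A) := cst (leg n i a).
(** Δ(a)^{ij} in A^{⊗n}[[h]] *)
Definition cop n i j (a : A) : series (tens n A) :=
  smap (place n [:: i; j]) (Delta (cst a)).

Definition Delta_id : series (tens 2 A) -> series (tens 3 A) :=
  hlift (fun a => cop 3 1 2 (a 0) * hleg 3 3 (a 1)).
Definition id_Delta : series (tens 2 A) -> series (tens 3 A) :=
  hlift (fun a => hleg 3 1 (a 0) * cop 3 2 3 (a 1)).
Definition Phi_12_3_4 : series (tens 4 A) :=
  hlift (fun a => cop 4 1 2 (a 0) * hleg 4 3 (a 1) * hleg 4 4 (a 2%:R)) Phi.
Definition Phi_1_23_4 : series (tens 4 A) :=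
  hlift (fun a => hleg 4 1 (a 0) * cop 4 2 3 (a 1) * hleg 4 4 (a 2%:R)) Phi.
Definition Phi_1_2_34 : series (tens 4 A) :=
  hlift (fun a => hleg 4 1 (a 0) * hleg 4 2 (a 1) * cop 4 3 4 (a 2%:R)) Phi.
Definition Phi_1_2_3 : series (tens 4 A) := smap (place 4 [:: 1; 2; 3]%N) Phi.
Definition Phi_2_3_4 : series (tens 4 A) := smap (place 4 [:: 2; 3; 4]%N) Phi.

(** Psi stands for Φ^{-1}. *)
Record quasi_antipode (Psi : series (tens 3 A))
    (S : {linear series A -> series A}) (alpha beta : series A) : Prop :=
  QuasiAntipode {
  antipode_bij : bijective S;
  antipode1 : S 1 = 1;
  antipodeM : forall x y, S (x * y) = S y * S x;
  antipode_alpha : forall x,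
    hlift (fun a => S (cst (a 0)) * alpha * cst (a 1)) (Delta x)
      = (eps x : series k) *: alpha;
  antipode_beta : forall x,
    hlift (fun a => cst (a 0) * beta * S (cst (a 1))) (Delta x)
      = (eps x : series k) *: beta;
  antipode_Phi :
    hlift (fun a => cst (a 0) * beta * S (cst (a 1)) * alpha * cst (a 2%:R)) Phi
      = 1;
  antipode_Psi :
    hlift (fun a => S (cst (a 0)) * alpha * cst (a 1) * beta * S (cst (a 2%:R)))
      Psi = 1
}.

Record quasi_hopf : Prop := QuasiHopf {
  qh_coassoc : forall x,
    id_Delta (Delta x) * Phi = Phi * Delta_id (Delta x);
  qh_counitl : forall x,
    hlift (fun a => (eps (cst (a 0)) : series k) *: cst (a 1)) (Delta x) = x;
  qh_counitr : forall x,
    hlift (fun a => (eps (cst (a 1)) : series k) *: cst (a 0)) (Delta x) = x;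
  qh_counit_Phi :
    hlift (fun a => (eps (cst (a 1)) : series k) *: cst (tens2 (a 0) (a 2%:R)))
      Phi = 1;
  qh_pentagon : Phi_1_2_34 * Phi_12_3_4 = Phi_2_3_4 * Phi_1_23_4 * Phi_1_2_3;
  qh_antipode : exists Psi, [/\ Phi * Psi = 1, Psi * Phi = 1
    & exists S alpha beta, quasi_antipode Psi S alpha beta]
}.

(** A[[h]] / h A[[h]] is A, and the algebra isomorphism A = U(g) is given by the
   canonical map i from g, required to have the universal property of U(g).
   Since Δ and ε reduce mod h to algebra morphisms on A, it is compatible with
   Δ_0 and ε_0 as soon as the reductions have the right values on g. Division
   by h or h^2 modulo h is written as a congruence modulo h^2 or h^3. *)
Record is_quantization (g : lieAlgType k) (B : quasiLieBialg g)
    (i : {linear g -> A}) : Prop := IsQuantization {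
  quant_quasi_hopf : quasi_hopf;
  quant_Phi : eqmodh 2 Phi 1;
  quant_enveloping : is_enveloping i;
  quant_Delta0 : forall x,
    eqmodh 1 (Delta (cst (i x))) (cst (tens2 (i x) 1 + tens2 1 (i x)));
  quant_eps0 : forall x, eqmodh 1 (eps (cst (i x)) : series k^o) 0;
  quant_cobr : forall x,
    eqmodh 2 (Delta (cst (i x)) - smap (place 2 [:: 2; 1]%N) (Delta (cst (i x))))
             (hvar *: cst (tmap i (cobr B x)));
  quant_coass :
    eqmodh 3 (smap (@talt k A 3) Phi) (hvar ^+ 2 *: cst (tmap i (coass B)))
}.

End QuasiHopf.

(** e^{ha} *)
Definition hexp (k : fieldType) (A : algType k) (a : A) : series A :=
  Series (fun n => n`!%:R^-1 *: a ^+ n).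

Lemma hexp_mulN (k : fieldType) (A : algType k) (a : A) :
  [pchar k] =i pred0 -> hexp a * hexp (- a) = 1.
Proof.
move=> k0; apply: seriesP => n; rewrite [LHS]/=.
have f0 m : m`!%:R != 0 :> k by rewrite (pcharf0P k).1 // -lt0n fact_gt0.
transitivity (n`!%:R^-1 *: (- a + a) ^+ n).
  rewrite exprDn_comm; last by rewrite /GRing.comm mulrN mulNr.
  rewrite scaler_sumr; apply: eq_bigr => i _.
  have le_in : (i <= n)%N by rewrite -ltnS.
  have aNa : GRing.comm (a ^+ i) ((- a) ^+ (n - i)).
    by apply: commrX; apply/commr_sym/commrX; rewrite /GRing.comm mulrN mulNr.
  rewrite -scalerAl -scalerAr scalerA aNa -[X in _ = _ *: X]scaler_nat scalerA.
  congr (_ *: _); apply: (mulfI (f0 n)); rewrite mulVKf //.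
  by rewrite -(bin_fact le_in) !natrM -invfM mulfK ?mulf_neq0.
rewrite addNr; case: n => [|n]; first by rewrite expr0 fact0 invr1 scale1r.
by rewrite expr0n scaler0.
Qed.

(* Main.v *)
(** Write [s_ij = v_i w_j] and [J^ij = e^{-h s_ij/2}]. Two of the [s_ij] and [s_kl]
   commute unless [j = k] or [l = i], which gives
     [(Δ⊗id)(J) = J^13 J^12 J^23 (J^12)^-1] and
     [(id⊗Δ)(J) = (J^23)^-1 J^12 J^23 J^13];
   coassociativity and the pentagon become identities between words in the
   [J^ij].

   Twisting by [J] turns [(Δ, Φ)] into a coassociative coproduct with
   [x ↦ x⊗1 + e^{-hs} (1⊗x) e^{hs}] for [x ∈ V], for which [w] is primitive. With
     [N_z(a) = Σ (-h)^n/n! z^n ad(w)^n(a)],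
   one has [N_v N_y = id] as soon as [N_v(y) = -v], and such a [y] exists since
   [N_v] is the identity mod [h]. The antiautomorphism [S] with [S(x) = -N_y(x)]
   is then an antipode of the twisted bialgebra; untwisting yields
   [α = Σ S(J_1) J_2] and [β = Σ J'_1 S(J'_2)] with [J' = J^-1].

   Finally [Φ] is a group commutator, so [Φ = 1 + h^2 [s_12, s_23]/4 + O(h^3)]. *)

(* The components of Δ(v) and Δ(w) are themselves series in h, so their exponentials cannot be taken
   coefficient by coefficient. They are formed in a second variable t over A[[h]], and then t is set
   to h; this evaluation is multiplicative, so identities between exponentials survive it. The
   equation for y comes from the right antipode axiom. Since e^{-hs}(1⊗x)e^{hs} is the sum of
   (-h)^n/n! v^n ⊗ ad(w)^n(x), the left axiom reads S(x) + N_{S(v)}(x) = 0, which at x = v is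
   implicit in S(v). If S(w) = -w, then S commutes with the operators (-ad w)^n/n!, and the right
   axiom reads x + N_v(S(x)) = 0; at x = v this is linear in S(v) and can be solved. The axioms that
   contain Φ and Φ^-1 are the reason for choosing α and β as twists: absorbing them turns Φ into the
   product of (id⊗Δ_J)(J^-1) and (Δ_J⊗id)(J), where Δ_J is the twisted coproduct, and Φ^-1 into a
   similar product. Each factor is an exponential whose exponent is annihilated by the
   contraction. *)
From HB Require Import structures.
From mathcomp Require Import ssrAC all_boot all_fingroup all_algebra.
From mathcomp Require Import generic_quotient.
Require Import Defs.
Set Implicit Arguments.
Unset Strict Implicit.
Unset Printing Implicit Defensive.
Import GRing.Theory.
Local Open Scope ring_scope.

(** * Power series *)

(** M[[h]] as a module over the ground ring k only, so that power series with
   coefficients in M[[h]] can themselves be formed. *)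
Definition kser (M : Type) : Type := series M.

Section KSeriesLmod.
Variables (k : comNzRingType) (M : lmodType k).
Implicit Types (X Y : kser M) (c : k).
HB.instance Definition _ := GRing.Zmodule.on (kser M).

Definition kser_scale c X : kser M := Series (fun n => c *: X n).

Lemma kser_scaleA a b X : kser_scale a (kser_scale b X) = kser_scale (a * b) X.
Proof. by apply: seriesP => n; apply: scalerA. Qed.
Lemma kser_scale1 : left_id 1 kser_scale.
Proof. by move=> X; apply: seriesP => n; apply: scale1r. Qed.
Lemma kser_scaleDr : right_distributive kser_scale +%R.
Proof. by move=> c X Y; apply: seriesP => n; apply: scalerDr. Qed.
Lemma kser_scaleDl X : {morph kser_scale^~ X : a b / a + b}.
Proof. by move=> a b; apply: seriesP => n; apply: scalerDl. Qed.
HB.instance Definition _ := GRing.Zmodule_isLmodule.Build k (kser M)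
  kser_scaleA kser_scale1 kser_scaleDr kser_scaleDl.
End KSeriesLmod.

Section KSeriesAlg.
Variables (k : comNzRingType) (A : algType k).
HB.instance Definition _ := GRing.NzRing.on (kser A).

Lemma kser_scaleAl (c : k) (X Y : kser A) : c *: (X * Y) = (c *: X) * Y.
Proof.
apply: seriesP => n /=; rewrite scaler_sumr.
by apply: eq_bigr => i _; rewrite scalerAl.
Qed.
HB.instance Definition _ := GRing.Lmodule_isLalgebra.Build k (kser A) kser_scaleAl.
Lemma kser_scaleAr (c : k) (X Y : kser A) : c *: (X * Y) = X * (c *: Y).
Proof.
apply: seriesP => n /=; rewrite scaler_sumr.
by apply: eq_bigr => i _; rewrite scalerAr.
Qed.
HB.instance Definition _ := GRing.Lalgebra_isAlgebra.Build k (kser A) kser_scaleAr.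
End KSeriesAlg.

Section Coefficients.
Lemma coefD (M : zmodType) (X Y : series M) n : (X + Y) n = X n + Y n.
Proof. by []. Qed.
Lemma coefN (M : zmodType) (X : series M) n : (- X) n = - X n.
Proof. by []. Qed.
Lemma coefM (A : nzRingType) (X Y : series A) n :
  (X * Y) n = \sum_(i < n.+1) X i * Y (n - i)%N.
Proof. by []. Qed.
Lemma coefZ (k : comNzRingType) (M : lmodType k) (c : series k) (X : series M) n :
  (c *: X) n = \sum_(i < n.+1) c i *: X (n - i)%N.
Proof. by []. Qed.
Lemma coef_sum (M : zmodType) I (r : seq I) (P : pred I) (F : I -> series M) n :
  (\sum_(i <- r | P i) F i) n = \sum_(i <- r | P i) F i n.
Proof. exact: (big_morph (fun X : series M => X n)). Qed.

Lemma coef_cst_gt0 (M : zmodType) (x : M) n : (0 < n)%N -> cst x n = 0.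
Proof. by case: n. Qed.

Lemma cst_linear (k : comNzRingType) (M : lmodType k) :
  linear (@cst M : M -> kser M).
Proof.
by move=> c x y; apply: seriesP => -[|n] //=; rewrite scaler0 addr0.
Qed.
Lemma cst_mul (A : nzRingType) (x y : A) : cst (x * y) = cst x * cst y.
Proof.
apply: seriesP => -[|n]; rewrite coefM ?big_ord1 // big1 // => i _.
by case: i => -[|i] ltin; rewrite /= ?mul0r ?mulr0.
Qed.
Lemma cst0 (M : zmodType) : cst (0 : M) = 0.
Proof. by apply: seriesP => -[|n]. Qed.
Lemma cstD (M : zmodType) (x y : M) : cst (x + y) = cst x + cst y.
Proof. by apply: seriesP => -[|n] //; rewrite /= addr0. Qed.
Lemma cstN (M : zmodType) (x : M) : cst (- x) = - cst x.
Proof. by apply: seriesP => -[|n] //; rewrite /= oppr0. Qed.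
Lemma coef_cstM (A : nzRingType) (x : A) X n : (cst x * X) n = x * X n.
Proof.
by rewrite coefM big_ord_recl subn0 big1 ?addr0 // => i _; rewrite mul0r.
Qed.
Lemma coef_Mcst (A : nzRingType) (x : A) X n : (X * cst x) n = X n * x.
Proof.
rewrite coefM big_ord_recr [nat_of_ord ord_max]/= subnn big1 => [|i _].
  by rewrite /= add0r.
by rewrite coef_cst_gt0 ?mulr0 ?subn_gt0 /= ?ltn_ord.
Qed.
Lemma coef_cstZ (k : comNzRingType) (M : lmodType k) (c : k) (X : series M) n :
  (cst c *: X) n = c *: X n.
Proof.
by rewrite coefZ big_ord_recl subn0 big1 ?addr0 // => i _; rewrite scale0r.
Qed.
Lemma kscaleE (k : comNzRingType) (M : lmodType k) (c : k) (X : series M) :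
  cst c *: X = (c *: (X : kser M)).
Proof. by apply: seriesP => n; rewrite coef_cstZ. Qed.

Lemma coef_hZ (k : comNzRingType) (M : lmodType k) (X : series M) n :
  (hvar *: X : series M) n = if n is n'.+1 then X n' else 0.
Proof.
rewrite coefZ; case: n => [|n]; first by rewrite big_ord1 scale0r.
rewrite 2!big_ord_recl scale0r add0r scale1r subSS subn0 big1 ?addr0 //.
by move=> i _; rewrite scale0r.
Qed.
Lemma coef_hXZ (k : comNzRingType) (M : lmodType k) (X : series M) m n :
  (hvar ^+ m *: X : series M) n = if (m <= n)%N then X (n - m)%N else 0.
Proof.
elim: m n => [|m IH] n; first by rewrite scale1r subn0.
by rewrite exprS -scalerA coef_hZ; case: n => [|n] //; rewrite IH.
Qed.
Lemma eqmodhP (k : comNzRingType) (M : lmodType k) n (X Y : series M) :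
  (forall i, (i < n)%N -> X i = Y i) -> eqmodh n X Y.
Proof.
move=> XY; exists (Series (fun i => X (i + n)%N - Y (i + n)%N)).
apply: seriesP => i; rewrite coefD coef_hXZ; case: leqP => [le|/XY->].
  by rewrite /= subnK // addrC subrK.
by rewrite addr0.
Qed.
End Coefficients.

Section HSum.
(** The h-adically convergent sum of h^n Y_n; on k[[h]][[t]] it is evaluation at
   t = h. *)
Definition hsum (M : zmodType) (Y : nat -> series M) : kser M :=
  Series (fun m => \sum_(i < m.+1) Y i (m - i)%N).

Lemma coef_hsum (M : zmodType) (Y : nat -> series M) m :
  hsum Y m = \sum_(i < m.+1) Y i (m - i)%N.
Proof. by []. Qed.

Lemma eq_hsum (M : zmodType) (Y Z : nat -> series M) :
  Y =1 Z -> hsum Y = hsum Z.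
Proof. by move=> YZ; apply: seriesP => n; apply: eq_bigr => i _; rewrite YZ. Qed.

Lemma hsum_cst (M : zmodType) (X : series M) : hsum (fun n => cst (X n)) = X.
Proof.
apply: seriesP => n; rewrite coef_hsum big_ord_recr.
rewrite [nat_of_ord ord_max]/= subnn big1 => [|i _].
  by rewrite /= add0r.
by rewrite coef_cst_gt0 ?subn_gt0 /= ?ltn_ord.
Qed.

Lemma hsum_head (M : zmodType) (Y : nat -> series M) :
  (forall n, Y n.+1 = 0) -> hsum Y = Y 0%N.
Proof.
move=> Y0; apply: seriesP => n /=; rewrite big_ord_recl subn0 big1 ?addr0 //.
by move=> i _; rewrite Y0.
Qed.

Lemma hsumD (M : zmodType) (Y Z : nat -> series M) :
  hsum (fun n => Y n + Z n) = hsum Y + hsum Z.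
Proof. by apply: seriesP => n; rewrite coefD /= -big_split. Qed.

Lemma hsum_recl (k : comNzRingType) (M : lmodType k) (Y : nat -> series M) :
  hsum Y = Y 0%N + hvar *: (hsum (fun n => Y n.+1) : series M).
Proof.
apply: seriesP => -[|n]; rewrite coefD coef_hZ /= ?big_ord1 ?addr0 //.
by rewrite big_ord_recl subn0; congr (_ + _); apply: eq_bigr.
Qed.

(** Linearity over [series k] already forces h-adic continuity: splitting off [Y 0] leaves a
    multiple of h, so a coefficient of index m+1 reduces to one of index m. *)
Lemma hsum_linear (k : comNzRingType) (M N : lmodType k)
    (L : series M -> series N) (Y : nat -> series M) :
  linear L -> L (hsum Y) = hsum (fun n => L (Y n)).
Proof.
move=> linL.
have LD a b : L (a + b) = L a + L b by have := linL 1 a b; rewrite !scale1r.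
have L0 : L 0 = 0 by apply: (addrI (L 0)); rewrite -LD !addr0.
have LZ c a : L (c *: a) = c *: L a by have := linL c a 0; rewrite !addr0 L0 addr0.
apply: seriesP => m; elim: m Y => [|m IH] Y.
  by rewrite hsum_recl LD LZ coefD coef_hZ addr0 /= big_ord1.
rewrite hsum_recl LD LZ coefD coef_hZ IH /= [RHS]big_ord_recl subn0.
by congr (_ + _); apply: eq_bigr.
Qed.

Lemma linear_series_ext (k : comNzRingType) (M N : lmodType k)
    (L L' : series M -> series N) :
  linear L -> linear L' -> (forall x, L (cst x) = L' (cst x)) -> L =1 L'.
Proof.
move=> linL linL' LL' X; rewrite -(hsum_cst X) !hsum_linear //.
exact: eq_hsum.
Qed.

Lemma hsum_hsum (M : zmodType) (Y : nat -> nat -> series M) :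
  hsum (fun j => hsum (Y j)) =
  hsum (fun n => \sum_(j < n.+1) Y j (n - j)%N).
Proof.
apply: seriesP => n /=.
under [RHS]eq_bigr do rewrite coef_sum.
exact: (conv3 (fun i j l => Y i j l)).
Qed.

Variables (k : comNzRingType) (A : algType k).

Lemma hsum_mull (X : series A) (Y : nat -> series A) :
  X * hsum Y = hsum (fun n => X * Y n).
Proof. by apply: (@hsum_linear k A A ( *%R X)) => c x y; rewrite mulrDr scalerAr. Qed.

Lemma hsum_mulr (X : series A) (Y : nat -> series A) :
  hsum Y * X = hsum (fun n => Y n * X).
Proof.
by apply: (@hsum_linear k A A ( *%R^~ X)) => c x y; rewrite mulrDl scalerAl.
Qed.

(** Setting t = h is multiplicative from A[[h]][[t]] to A[[h]]; this is what carries identities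
    between exponentials over. *)
Lemma hsumM (X Y : series (kser A)) : hsum (X * Y) = hsum X * hsum Y.
Proof.
rewrite hsum_mulr; under [RHS]eq_hsum => n do rewrite hsum_mull.
rewrite hsum_hsum; exact: eq_hsum.
Qed.

(** On the left [c] is a series in t acting on M[[h]][[t]], on the right it is a series in h. *)
Lemma hsumZ (M : lmodType k) (c : series k) (Y : series (kser M)) :
  hsum (c *: Y) = c *: (hsum Y : series M).
Proof.
apply: seriesP => n /=.
under eq_bigr do rewrite coef_sum.
under [RHS]eq_bigr do rewrite scaler_sumr.
by rewrite (conv3 (fun i j l => c i *: (Y j : series M) l)).
Qed.
End HSum.

Section Unipotent.
Variables (k : comNzRingType) (M : lmodType k) (L : series M -> series M).
Hypothesis linL : linear L.
Hypothesis L0 : forall X, L X 0%N = X 0%N.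

Let quo (X : series M) : series M := Series (fun n => L X n.+1 - X n.+1).
Let quoE X : L X = X + hvar *: quo X.
Proof.
apply: seriesP => -[|n]; rewrite coefD coef_hZ /= ?addr0 ?L0 //.
by rewrite addrC subrK.
Qed.

Let linL0 : L 0 = 0.
Proof. by have := linL (-1) 0 0; rewrite scaler0 addr0 scaleN1r addNr. Qed.
Let linLZ c X : L (c *: X) = c *: L X.
Proof. by have := linL c X 0; rewrite !addr0 linL0 addr0. Qed.

Let hvar_inj (X Y : series M) : hvar *: X = hvar *: Y -> X = Y.
Proof.
move=> e; apply: seriesP => n.
by have := congr1 (fun Z : series M => Z n.+1) e; rewrite !coef_hZ.
Qed.

Let linear_quo : linear quo.
Proof.
move=> c x y; apply: hvar_inj; apply: (addrI (c *: x + y)).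
rewrite -quoE linL !quoE !scalerDr !scalerA (mulrC hvar) -!scalerA.
by rewrite addrACA.
Qed.

(** By [L0] the constant term of a kernel element vanishes, so the element is h times another kernel
    element; descent on the coefficient index concludes. *)
Let L_eq0 X : L X = 0 -> X = 0.
Proof.
move=> LX; apply: seriesP => n; elim: n X LX => [|n IH] X LX.
  by rewrite -L0 LX.
pose Y : series M := Series (fun i => X i.+1).
have XY : X = hvar *: Y.
  apply: seriesP => -[|i]; rewrite coef_hZ //.
  by rewrite -L0 LX.
rewrite XY coef_hZ IH //; apply: hvar_inj.
by rewrite -linLZ -XY LX scaler0.
Qed.

(* The inverse is the Neumann series of L = id + h quo. *)
Lemma linear_unipotent_bij : bijective L.
Proof.
pose G (X : series M) : series M := hsum (fun n => iter n (fun X => - quo X) X).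
have LG X : L (G X) = X.
  rewrite quoE {1}/G hsum_recl -addrA -scalerDr.
  rewrite /G (hsum_linear _ linear_quo) -hsumD.
  rewrite (@eq_hsum _ _ (fun=> 0)) => [|n]; last by rewrite iterS addNr.
  by rewrite hsum_head // scaler0 addr0.
(* [G] is a right inverse by [LG]; it is also a left one because [G (L X) - X] lies in the kernel of
   [L]. *)
exists G => // X; apply/eqP; rewrite -subr_eq0; apply/eqP/L_eq0.
by rewrite addrC -scaleN1r linL LG scaleN1r addNr.
Qed.
End Unipotent.

(** A predicate on bare functions, because one and the same map, such as [smap f], serves as a
    morphism over k[[h]] and over k. *)
Definition is_alg_morph (k : comNzRingType) (A B : algType k) (f : A -> B) :=
  [/\ linear f, f 1 = 1 & {morph f : x y / x * y}].

Section Linear.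
Variables (k : comNzRingType) (M N : lmodType k) (f : M -> N).
Hypothesis linf : linear f.
Lemma lin0 : f 0 = 0.
Proof. by have := linf (-1) 0 0; rewrite scaler0 addr0 scaleN1r addNr. Qed.
Lemma linZ c x : f (c *: x) = c *: f x.
Proof. by have := linf c x 0; rewrite !addr0 lin0 addr0. Qed.
Lemma linD x y : f (x + y) = f x + f y.
Proof. by have := linf 1 x y; rewrite !scale1r. Qed.
Lemma linN x : f (- x) = - f x.
Proof. by rewrite -scaleN1r linZ scaleN1r. Qed.
Lemma linB x y : f (x - y) = f x - f y.
Proof. by rewrite linD linN. Qed.
Lemma lin_sum I (r : seq I) (P : pred I) (F : I -> M) :
  f (\sum_(i <- r | P i) F i) = \sum_(i <- r | P i) f (F i).
Proof. exact: (big_morph f linD lin0). Qed.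

Lemma smap_linear : linear (smap f).
Proof.
move=> c X Y; apply: seriesP => n.
by rewrite /smap coefD /= linD lin_sum; congr (_ + _); apply: eq_bigr => i _; rewrite linZ.
Qed.
Lemma smap_cst x : smap f (cst x) = cst (f x).
Proof. by apply: seriesP => -[|n] //=; rewrite lin0. Qed.
End Linear.

Section AlgMorph.
Variables (k : comNzRingType) (A B : algType k) (f : A -> B).
Hypothesis mf : is_alg_morph f.
Lemma alg_lin : linear f. Proof. by case: mf. Qed.
Lemma alg1 : f 1 = 1. Proof. by case: mf. Qed.
Lemma algM x y : f (x * y) = f x * f y. Proof. by case: mf => _ _; apply. Qed.
Lemma algX x n : f (x ^+ n) = f x ^+ n.
Proof. by elim: n => [|n IH]; rewrite ?alg1 // !exprS algM IH. Qed.

Lemma smap_alg : is_alg_morph (smap f).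
Proof.
split; first exact: (smap_linear alg_lin).
  by apply: seriesP => -[|n] /=; rewrite ?alg1 ?(lin0 alg_lin).
move=> X Y; apply: seriesP => n; rewrite coefM /= (lin_sum alg_lin).
by apply: eq_bigr => i _; rewrite algM.
Qed.
End AlgMorph.

Lemma cst_alg (k : comNzRingType) (A : algType k) :
  is_alg_morph (@cst A : A -> kser A).
Proof. by split=> //; [exact: cst_linear | exact: cst_mul]. Qed.

Section Exp.
Variable k : fieldType.
Hypothesis k0 : [pchar k] =i pred0.

Lemma fact_neq0 n : n`!%:R != 0 :> k.
Proof. by rewrite (pcharf0P k).1 // -lt0n fact_gt0. Qed.

Lemma hexp0 (A : algType k) : hexp (0 : A) = 1.
Proof.
apply: seriesP => -[|n] /=; first by rewrite invr1 scale1r.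
by rewrite expr0n scaler0.
Qed.

Lemma hexpD (A : algType k) (a b : A) :
  a * b = b * a -> hexp (a + b) = hexp a * hexp b.
Proof.
move=> ab; apply: seriesP => n /=; rewrite exprDn_comm // scaler_sumr.
rewrite [RHS](reindex_inj rev_ord_inj) /=; apply: eq_bigr => i _.
have lein : (i <= n)%N by rewrite -ltnS.
rewrite subSS subKn // -scalerAl -scalerAr scalerA -[X in _ *: X]scaler_nat scalerA.
congr (_ *: _); apply: (mulfI (fact_neq0 n)); rewrite mulVKf ?fact_neq0 //.
by rewrite -(bin_fact lein) !natrM [_^-1 * _]mulrC -invfM mulfK ?mulf_neq0 ?fact_neq0.
Qed.

Lemma hexpNK (A : algType k) (a : A) : hexp (- a) * hexp a = 1.
Proof. by rewrite -{2}(opprK a) hexp_mulN. Qed.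

Lemma smap_hexp (A B : algType k) (f : A -> B) a :
  is_alg_morph f -> smap f (hexp a) = hexp (f a).
Proof.
by move=> mf; apply: seriesP => n /=; rewrite (linZ (alg_lin mf)) algX.
Qed.

(** This is e^{hX} for an X that depends on h: e^{tX} is formed in A[[h]][[t]] and t is set to h. *)
Definition sexp (A : algType k) (X : series A) : series A :=
  hsum (hexp (X : kser A)).

Lemma sexp_cst (A : algType k) (a : A) : sexp (cst a) = hexp a.
Proof.
rewrite -[RHS]hsum_cst; apply: eq_hsum => n.
by rewrite (linZ (@cst_linear _ A)) (algX (@cst_alg _ A)).
Qed.

Variable A : algType k.
Implicit Types X Y Z U : series A.

Lemma sexpD X Y : X * Y = Y * X -> sexp (X + Y) = sexp X * sexp Y.
Proof.
by move=> XY; rewrite -hsumM /sexp; congr hsum; rewrite -(@hexpD (kser A)).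
Qed.

Lemma sexp0 : sexp (0 : series A) = 1.
Proof. by rewrite -(cst0 A) sexp_cst hexp0. Qed.

Lemma sexpNK X : sexp (- X) * sexp X = 1.
Proof. by rewrite -sexpD ?addNr ?sexp0 // mulNr mulrN. Qed.
Lemma sexp_comm X Z : X * Z = Z * X -> sexp X * Z = Z * sexp X.
Proof.
move=> XZ; rewrite hsum_mull hsum_mulr; apply: eq_hsum => n.
have XnZ : (X : kser A) ^+ n * (Z : kser A) = (Z : kser A) * (X : kser A) ^+ n.
  by symmetry; apply: (@commrX (kser A)); exact/esym.
transitivity (n`!%:R^-1 *: ((X : kser A) ^+ n * (Z : kser A))).
  exact: (esym (@scalerAl _ (kser A) _ _ _)).
by rewrite XnZ; apply: (@scalerAr _ (kser A)).
Qed.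

Lemma sexp_conj X U U' : U' * U = 1 -> U * U' = 1 ->
  sexp (U * X * U') = U * sexp X * U'.
Proof.
move=> U'U UU'; rewrite hsum_mull hsum_mulr; apply: eq_hsum => n.
transitivity (n`!%:R^-1 *: ((U : kser A) * (X : kser A) ^+ n * (U' : kser A))); last first.
  by rewrite scalerAl scalerAr.
apply: (congr1 (fun z : kser A => n`!%:R^-1 *: z)).
elim: n => [|n IH]; first by rewrite !expr0 mulr1 UU'.
by rewrite !exprSr IH !mulrA; congr (_ * _); rewrite -!mulrA (mulrA U') U'U mul1r.
Qed.
End Exp.

(** * Tensor powers *)

Section TensInd.
Variables (k : comNzRingType) (n : nat) (M : lmodType k).

Lemma pure_multilinear : multilinear (@pure k n M).
Proof.
move=> a i c x y; apply: tens_ext => W f mf.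
by rewrite tlift_linear // !tlift_pure // mf.
Qed.

Lemma tens_sum (x : tens n M) : x = \sum_(p <- repr x) p.1 *: pure p.2.
Proof.
apply: tens_ext => W f mf.
have linf : linear (tlift f) by move=> c u z; exact: tlift_linear.
rewrite [RHS](lin_sum linf); apply: eq_bigr => p _.
by rewrite (linZ linf) tlift_pure.
Qed.

Lemma linear_tens_ext (N : lmodType k) (f g : tens n M -> N) :
  linear f -> linear g -> (forall a, f (pure a) = g (pure a)) -> f =1 g.
Proof.
move=> lf lg fg x; rewrite (tens_sum x) (lin_sum lf) (lin_sum lg).
by apply: eq_bigr => p _; rewrite (linZ lf) (linZ lg) fg.
Qed.
End TensInd.

Section TensAlg.
Variables (k : comNzRingType) (n : nat) (A : algType k).
Implicit Types a b : {ffun 'I_n -> A}.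

Lemma pureM a b : pure a * pure b = pure [ffun i => a i * b i].
Proof.
apply: tens_ext => W f mf; rewrite [LHS]tlift_mul // !tlift_pure //.
  by move=> *; apply: multilinear_mulr.
by move=> *; apply: multilinear_mull.
Qed.

Lemma tlift_alg (B : algType k) (F : {ffun 'I_n -> A} -> B) :
  multilinear F -> F [ffun=> 1] = 1 ->
  (forall a b, F [ffun i => a i * b i] = F a * F b) ->
  is_alg_morph (tlift F).
Proof.
move=> mF F1 FM; have lF : linear (tlift F) by move=> b u z; apply: tlift_linear.
split=> //; first by rewrite tlift_pure.
move=> x y; move: x.
apply: linear_tens_ext => [c u z|c u z|a].
- by rewrite mulrDl -scalerAl lF.
- by rewrite lF mulrDl -scalerAl.
move: y; apply: linear_tens_ext => [c u z|c u z|b].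
- by rewrite mulrDr -scalerAr lF.
- by rewrite lF mulrDr -scalerAr.
by rewrite pureM !tlift_pure.
Qed.
End TensAlg.

Lemma prodM_comm (R : nzRingType) m (x y : 'I_m -> R) :
  (forall i j, i != j -> x i * y j = y j * x i) ->
  \prod_(i < m) (x i * y i) = \prod_(i < m) x i * \prod_(i < m) y i.
Proof.
elim: m x y => [|m IH] x y xy; first by rewrite !big_ord0 mulr1.
rewrite !big_ord_recl IH => [|i j ij]; last by rewrite xy // (inj_eq lift_inj).
rewrite !mulrA; congr (_ * _); rewrite -!mulrA; congr (_ * _).
apply: (big_ind (fun z => y ord0 * z = z * y ord0)) => [|u z yu yz|i _].
- by rewrite mulr1 mul1r.
- by rewrite mulrA yu -mulrA yz mulrA.
by rewrite xy.
Qed.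

(** Universal property of a tensor power of algebras: morphisms with pairwise commuting images
    multiply to a morphism. *)
Lemma prod_alg (k : comNzRingType) (A B : algType k) m (f : 'I_m -> A -> B) :
  (forall i, is_alg_morph (f i)) ->
  (forall i j x y, i != j -> f i x * f j y = f j y * f i x) ->
  let F (a : {ffun 'I_m -> A}) := \prod_(i < m) f i (a i) in
  multilinear F /\ is_alg_morph (tlift F).
Proof.
move=> mf cf F; have mF : multilinear F.
  move=> a i c x y.
  have E u : F (upd a i u) = (\prod_(j < m | (j < i)%N) f j (a j)) * f i u *
                             \prod_(j < m | (i < j)%N) f j (a j).
    rewrite -prod_insert; apply: eq_bigr => j _; rewrite ffunE.
    by case: eqP => // ->.
  by rewrite !E (alg_lin (mf i)) mulrDr mulrDl -scalerAr -scalerAl.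
split=> //; apply: tlift_alg => // [|a b].
  by rewrite /F big1 // => i _; rewrite ffunE alg1.
rewrite /F -prodM_comm => [|i j ij]; last exact: cf.
by apply: eq_bigr => i _; rewrite ffunE algM.
Qed.

Section Legs.
Variables (k : comNzRingType) (A : algType k).

Lemma leg_alg n i : (0 < i <= n)%N -> is_alg_morph (leg n i : A -> tens n A).
Proof.
case: i => // i /= ltin; split=> [c x y||x y].
- have E u : leg n i.+1 u = pure (upd [ffun=> 1] (Ordinal ltin) u) :> tens n A.
    by congr pure; apply/ffunP => j; rewrite !ffunE eqSS.
  by rewrite !E pure_multilinear.
- by congr pure; apply/ffunP => j; rewrite !ffunE; case: eqP.
by rewrite /leg pureM; congr pure; apply/ffunP => j; rewrite !ffunE; case: eqP; rewrite ?mulr1.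
Qed.

Lemma leg_comm n i j (x y : A) : i != j ->
  leg n i x * leg n j y = leg n j y * leg n i x.
Proof.
move=> ij; rewrite /leg !pureM; congr pure; apply/ffunP => l; rewrite !ffunE.
case: eqP => [->|_]; first by rewrite (negPf ij) mul1r mulr1.
by rewrite mul1r mulr1.
Qed.

Definition places m n (s : seq nat) :=
  [&& size s == m, uniq s & all (fun i => 0 < i <= n)%N s].

Lemma place_alg m n s : places m n s -> is_alg_morph (@place k A m n s).
Proof.
case/and3P => /eqP sz us /allP sn; apply: (prod_alg (f := fun i => leg n (nth 0%N s i)) _ _).2.
  by move=> i; apply: leg_alg; apply: sn; rewrite mem_nth ?sz.
by move=> i j x y ij; apply: leg_comm; rewrite nth_uniq ?sz.
Qed.

Lemma place_pure m n s a : places m n s ->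
  place n s (pure a) = \prod_(i < m) leg n (nth 0%N s i) (a i) :> tens n A.
Proof.
case/and3P => /eqP sz us /allP sn; apply: tlift_pure.
apply: (prod_alg (f := fun i => leg n (nth 0%N s i)) _ _).1.
  by move=> i; apply: leg_alg; apply: sn; rewrite mem_nth ?sz.
by move=> i j x y ij; apply: leg_comm; rewrite nth_uniq ?sz.
Qed.

Lemma place_leg m n s i (x : A) : places m n s -> (i < m)%N ->
  place n s (leg m i.+1 x) = leg n (nth 0%N s i) x.
Proof.
move=> ps lim; rewrite place_pure //.
rewrite (eq_bigr (fun j : 'I_m => if j == Ordinal lim then leg n (nth 0%N s i) x else 1)).
  by rewrite -big_mkcond big_pred1_eq.
move=> j _; rewrite ffunE eqSS -(inj_eq val_inj) /=; case: eqP => [->//|_].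
case/and3P: ps => /eqP sz us /allP sn.
by apply: (alg1 (leg_alg _)); apply: sn; rewrite mem_nth ?sz.
Qed.

Lemma tens2E (x y : A) : tens2 x y = leg 2 1 x * leg 2 2 y.
Proof.
rewrite /leg pureM; congr pure; apply/ffunP => i; rewrite !ffunE.
by case: i => -[|[|]] //= i; rewrite ?mulr1 ?mul1r.
Qed.
End Legs.
Arguments leg_alg {k A n i}.
Arguments place_alg {k A m n s}.
Arguments leg_comm {k A n i j}.

Section HLift.
Variables (k : comNzRingType) (n : nat) (A W : algType k).
Variable F : {ffun 'I_n -> A} -> kser W.
Hypothesis mF : multilinear F.

(** A multilinear map with values in W[[h]] is lifted coefficientwise to W[[h]][[t]], and then t is
    set to h. Linearity, multiplicativity and the values on exponentials follow from those of the
    two steps. *)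
Lemma hliftE X : hlift (F : _ -> series W) X = hsum (smap (tlift F) X).
Proof.
apply: seriesP => m; apply: eq_bigr => i _.
by rewrite /= /tlift /fsum_eval coef_sum.
Qed.

Lemma hlift_linear : linear (hlift (F : _ -> series W)).
Proof.
move=> c X Y; rewrite !hliftE (smap_linear (f := tlift F)).
  by rewrite -hsumZ -hsumD; apply: eq_hsum.
by move=> b u z; apply: tlift_linear.
Qed.

Lemma hlift_cst x : hlift (F : _ -> series W) (cst x) = tlift F x.
Proof.
have lF : linear (tlift F) by move=> b u z; apply: tlift_linear.
by rewrite hliftE smap_cst // hsum_head.
Qed.

Lemma hlift_cst_pure a : hlift (F : _ -> series W) (cst (pure a)) = F a.
Proof. by rewrite hlift_cst tlift_pure. Qed.

Lemma hlift_alg : is_alg_morph (tlift F) ->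
  is_alg_morph (hlift (F : _ -> series W)).
Proof.
move=> aF; split; first exact: hlift_linear.
  by rewrite [1]/(cst 1) hlift_cst (alg1 aF).
by move=> X Y; rewrite !hliftE (algM (smap_alg aF)) hsumM.
Qed.
End HLift.

Lemma hlift_hexp (k : fieldType) n (A W : algType k)
    (F : {ffun 'I_n -> A} -> kser W) a : is_alg_morph (tlift F) ->
  hlift (F : _ -> series W) (hexp a) = sexp (tlift F a).
Proof. by move=> aF; rewrite hliftE smap_hexp. Qed.

Section Multilinear.
Variables (k : comNzRingType) (M N : lmodType k).

Lemma multilinear2 (G : M -> M -> N) :
  (forall y, linear (G^~ y)) -> (forall x, linear (G x)) ->
  multilinear (fun a : {ffun 'I_2 -> M} => G (a 0) (a 1)).
Proof.
by move=> G1 G2 a [[|[|//]] i] c x y; rewrite !ffunE /= ?G1 ?G2.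
Qed.

Lemma multilinear3 (G : M -> M -> M -> N) :
  (forall y z, linear (fun x => G x y z)) ->
  (forall x z, linear (fun y => G x y z)) ->
  (forall x y, linear (fun z => G x y z)) ->
  multilinear (fun a : {ffun 'I_3 -> M} => G (a 0) (a 1) (a 2%:R)).
Proof.
by move=> G1 G2 G3 a [[|[|[|//]]] i] c x y; rewrite !ffunE /= ?G1 ?G2 ?G3.
Qed.
End Multilinear.

Section Tuples.
Variables (k : comNzRingType) (A B : algType k).
Implicit Types f g h : A -> B.

Definition commuting f g := forall x y, f x * g y = g y * f x.

Lemma alg_mull f x : is_alg_morph f -> linear (fun y => f y * x).
Proof. by move=> mf c y z; rewrite (alg_lin mf) mulrDl scalerAl. Qed.

Lemma alg_mulr f x : is_alg_morph f -> linear (fun y => x * f y).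
Proof. by move=> mf c y z; rewrite (alg_lin mf) mulrDr scalerAr. Qed.

Section Pair.
Variables f g : A -> B.
Hypotheses (mf : is_alg_morph f) (mg : is_alg_morph g) (fg : commuting f g).
(** A bare product, so that [Delta_id] and [id_Delta] are instances by conversion; [tripleF] plays
    the same part for [Phi_12_3_4] and its two companions. *)
Definition pairF (a : {ffun 'I_2 -> A}) := f (a 0) * g (a 1).

Lemma pair_multilinear : multilinear pairF.
Proof.
apply: (multilinear2 (G := fun x y => f x * g y)) => x.
  exact: alg_mull.
exact: alg_mulr.
Qed.

Lemma pair_alg : is_alg_morph (tlift pairF).
Proof.
apply: tlift_alg; first exact: pair_multilinear.
  by rewrite /pairF !ffunE (alg1 mf) (alg1 mg) mulr1.
move=> a b; rewrite /pairF !ffunE (algM mf) (algM mg).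
by rewrite -!mulrA (mulrA (f (b 0))) fg -!mulrA.
Qed.

Lemma pair_leg1 x : tlift pairF (leg 2 1 x) = f x.
Proof.
rewrite tlift_pure; last exact: pair_multilinear.
by rewrite /pairF !ffunE /= (alg1 mg) mulr1.
Qed.
Lemma pair_leg2 x : tlift pairF (leg 2 2 x) = g x.
Proof.
rewrite tlift_pure; last exact: pair_multilinear.
by rewrite /pairF !ffunE /= (alg1 mf) mul1r.
Qed.
End Pair.

Section Triple.
Variables f g h : A -> B.
Hypotheses (mf : is_alg_morph f) (mg : is_alg_morph g) (mh : is_alg_morph h).
Hypotheses (fg : commuting f g) (fh : commuting f h) (gh : commuting g h).
Definition tripleF (a : {ffun 'I_3 -> A}) := f (a 0) * g (a 1) * h (a 2%:R).

Lemma triple_multilinear : multilinear tripleF.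
Proof.
apply: (multilinear3 (G := fun x y z => f x * g y * h z)) => x y.
- by move=> c u z; rewrite (alg_lin mf) !mulrDl -!scalerAl.
- by move=> c u z; rewrite (alg_lin mg) mulrDr mulrDl -scalerAr -scalerAl.
exact: alg_mulr.
Qed.

Lemma triple_alg : is_alg_morph (tlift tripleF).
Proof.
apply: tlift_alg; first exact: triple_multilinear.
  by rewrite /tripleF !ffunE (alg1 mf) (alg1 mg) (alg1 mh) !mulr1.
move=> a b; rewrite /tripleF !ffunE (algM mf) (algM mg) (algM mh) -!mulrA; congr (_ * _).
rewrite [in RHS](mulrA (h (a _))) -fh -!mulrA [RHS]mulrA -fg -!mulrA.
by congr (_ * _); congr (_ * _); rewrite !mulrA gh.
Qed.

Lemma triple_leg1 x : tlift tripleF (leg 3 1 x) = f x.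
Proof.
rewrite tlift_pure; last exact: triple_multilinear.
by rewrite /tripleF !ffunE /= ?(alg1 mf) ?(alg1 mg) ?(alg1 mh) ?mulr1 ?mul1r.
Qed.
Lemma triple_leg2 x : tlift tripleF (leg 3 2 x) = g x.
Proof.
rewrite tlift_pure; last exact: triple_multilinear.
by rewrite /tripleF !ffunE /= ?(alg1 mf) ?(alg1 mg) ?(alg1 mh) ?mulr1 ?mul1r.
Qed.
Lemma triple_leg3 x : tlift tripleF (leg 3 3 x) = h x.
Proof.
rewrite tlift_pure; last exact: triple_multilinear.
by rewrite /tripleF !ffunE /= ?(alg1 mf) ?(alg1 mg) ?(alg1 mh) ?mulr1 ?mul1r.
Qed.
End Triple.
End Tuples.

(** * Word identities in the letters J^ij *)

Section Words.
Variable R : nzRingType.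

(* Letters: a = J^12, b = J^23, c = J^13, with primes for inverses. *)
Lemma coassoc_words (a a' b b' c c' x1 x2 x3 : R) :
  a * a' = 1 -> a' * a = 1 -> b * b' = 1 -> b' * b = 1 -> c * c' = 1 -> c' * c = 1 ->
  (forall y, y \in [:: a; a'; b; b'; x2] -> forall z, z \in [:: c; c'] -> y * z = z * y) ->
  (forall y, y \in [:: b; b'] -> y * x1 = x1 * y) ->
  (forall y, y \in [:: a; a'] -> y * x3 = x3 * y) ->
  (c' * (b' * a' * b) * x1 * (c * (b' * a * b)) +
   c * (b' * a * b) * (b' * x2 * b + b * x3 * b') * (c' * (b' * a' * b))) *
  (b' * a * b * a') =
  (b' * a * b * a') *
  (c' * (a * b' * a') * (a' * x1 * a + a * x2 * a') * (c * (a * b * a')) +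
   c * (a * b * a') * x3 * (c' * (a * b' * a'))).
Proof.
move=> aa' a'a bb' b'b cc' c'c Hc Hx1 Hx3.
have K (p p' : R) : p * p' = 1 -> forall z, p * (p' * z) = z.
  by move=> pp' z; rewrite mulrA pp' mul1r.
have C (p p' : R) : p * p' = p' * p -> forall z, p * (p' * z) = p' * (p * z).
  by move=> pp' z; rewrite !mulrA pp'.
have [aK a'K bK b'K] := And4 (K _ _ aa') (K _ _ a'a) (K _ _ bb') (K _ _ b'b).
have [cK c'K] := (K _ _ cc', K _ _ c'c).
have ins (p : R) s : p \in p :: s by rewrite inE eqxx.
have in1 (p q : R) s : p \in s -> p \in q :: s by rewrite inE => ->; rewrite orbT.
have Rc := (C _ _ (Hc a ltac:(auto) c ltac:(auto)), C _ _ (Hc a' ltac:(auto) c ltac:(auto)),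
  C _ _ (Hc b ltac:(auto) c ltac:(auto)), C _ _ (Hc b' ltac:(auto) c ltac:(auto)),
  C _ _ (Hc x2 ltac:(auto) c ltac:(auto)),
  (C _ _ (Hc a ltac:(auto) c' ltac:(auto)), C _ _ (Hc a' ltac:(auto) c' ltac:(auto)),
  C _ _ (Hc b ltac:(auto) c' ltac:(auto)), C _ _ (Hc b' ltac:(auto) c' ltac:(auto)),
  C _ _ (Hc x2 ltac:(auto 7) c' ltac:(auto)))).
have Rx := (C _ _ (Hx1 b ltac:(auto)), C _ _ (Hx1 b' ltac:(auto)),
            C _ _ (Hx3 a ltac:(auto)), C _ _ (Hx3 a' ltac:(auto))).
(* The trailing 1 gives every letter a successor, so that the rules, stated for [p * (p' * z)],
   apply at each place of a right-associated word. *)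
rewrite -[LHS]mulr1 -[RHS]mulr1 !(mulrDr, mulrDl) -!mulrA.
by rewrite !(aK, a'K, bK, b'K, cK, c'K, Rc, Rx) addrA.
Qed.

(* Letters: a = J^12, b = J^23, c = J^13, d = J^34, e = J^24, with primes for
   inverses. *)
Lemma pentagon_words (a a' b b' c c' d d' e e' : R) :
  a * a' = 1 -> a' * a = 1 -> b * b' = 1 -> b' * b = 1 ->
  d * d' = 1 -> d' * d = 1 ->
  (forall y, y \in [:: a; a'; b; b'] -> forall z, z \in [:: c; c'] -> y * z = z * y) ->
  (forall y, y \in [:: a; a'] -> forall z, z \in [:: d; d'] -> y * z = z * y) ->
  (forall y, y \in [:: b; b'; c; c'; d; d'] -> forall z, z \in [:: e; e'] -> y * z = z * y) ->
  e' * (d' * b' * d) * a * (e * (d' * b * d)) * a' *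
  (d' * (c * (a * b * a')) * d * (c' * (a * b' * a'))) =
  d' * b * d * b' *
  (e' * (b * d' * b') * (c * (b' * a * b)) * (e * (b * d * b')) * (c' * (b' * a' * b))) *
  (b' * a * b * a').
Proof.
move=> aa' a'a bb' b'b dd' d'd Hc Ha He.
have K (p p' : R) : p * p' = 1 -> forall z, p * (p' * z) = z.
  by move=> pp' z; rewrite mulrA pp' mul1r.
have C (p p' : R) : p * p' = p' * p -> forall z, p * (p' * z) = p' * (p * z).
  by move=> pp' z; rewrite !mulrA pp'.
have [aK a'K bK b'K] := And4 (K _ _ aa') (K _ _ a'a) (K _ _ bb') (K _ _ b'b).
have [dK d'K] := (K _ _ dd', K _ _ d'd).
have ins (p : R) s : p \in p :: s by rewrite inE eqxx.
have in1 (p q : R) s : p \in s -> p \in q :: s by rewrite inE => ->; rewrite orbT.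
have Rc := (C _ _ (Hc a ltac:(auto) c ltac:(auto)), C _ _ (Hc a' ltac:(auto) c ltac:(auto)),
  C _ _ (Hc b ltac:(auto) c ltac:(auto)), C _ _ (Hc b' ltac:(auto) c ltac:(auto)),
  (C _ _ (Hc a ltac:(auto) c' ltac:(auto)), C _ _ (Hc a' ltac:(auto) c' ltac:(auto)),
  C _ _ (Hc b ltac:(auto) c' ltac:(auto)), C _ _ (Hc b' ltac:(auto) c' ltac:(auto)))).
have Re := (C _ _ (He b ltac:(auto) e ltac:(auto)), C _ _ (He b' ltac:(auto) e ltac:(auto)),
  C _ _ (He c ltac:(auto) e ltac:(auto)), C _ _ (He c' ltac:(auto) e ltac:(auto)),
  C _ _ (He d ltac:(auto 7) e ltac:(auto)), C _ _ (He d' ltac:(auto 8) e ltac:(auto)),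
  (C _ _ (He b ltac:(auto) e' ltac:(auto)), C _ _ (He b' ltac:(auto) e' ltac:(auto)),
  C _ _ (He c ltac:(auto) e' ltac:(auto)), C _ _ (He c' ltac:(auto) e' ltac:(auto)),
  C _ _ (He d ltac:(auto 7) e' ltac:(auto)), C _ _ (He d' ltac:(auto 8) e' ltac:(auto)))).
have Ra := (C _ _ (Ha a ltac:(auto) d ltac:(auto)), C _ _ (Ha a' ltac:(auto) d ltac:(auto)),
  C _ _ (Ha a ltac:(auto) d' ltac:(auto)), C _ _ (Ha a' ltac:(auto) d' ltac:(auto))).
rewrite -[LHS]mulr1 -[RHS]mulr1 -!mulrA.
rewrite !(aK, a'K, bK, b'K, dK, d'K, Rc, Re, Ra).
(* The left side still contains [d * a * e * d'], and no rule lets [e] cross [a]. Moving [e] back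
   over [d'] lets [d'] cross [a] and cancel [d]; moving it back over [c] then lets [c] cross [a]. *)
rewrite -(C _ _ (He d' ltac:(auto 8) e ltac:(auto))) !Ra dK.
by rewrite -(C _ _ (He c ltac:(auto) e ltac:(auto))) !Rc.
Qed.
End Words.

Section MoreMorphisms.
Variable k : comNzRingType.

Lemma smap_kalg (A B : algType k) (f : A -> B) :
  is_alg_morph f -> is_alg_morph (smap f : kser A -> kser B).
Proof.
move=> mf; have [lsf sf1 sfM] := smap_alg mf; split=> //.
by move=> c x y; rewrite -!kscaleE lsf.
Qed.

Lemma comp_alg (A B C : algType k) (f : B -> C) (g : A -> B) :
  is_alg_morph f -> is_alg_morph g -> is_alg_morph (f \o g).
Proof.
move=> mf mg; split=> [c x y||x y] /=.
- by rewrite (alg_lin mg) (alg_lin mf).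
- by rewrite (alg1 mg) (alg1 mf).
by rewrite (algM mg) (algM mf).
Qed.

Lemma place_leg_comm (A : algType k) m n s l (t : tens m A) y : places m n s ->
  l \notin s -> place n s t * leg n l y = leg n l y * place n s t.
Proof.
move=> ps ls; move: t; apply: linear_tens_ext.
- by move=> c u z; rewrite (alg_lin (place_alg ps)) mulrDl scalerAl.
- by move=> c u z; rewrite (alg_lin (place_alg ps)) mulrDr scalerAr.
move=> a; rewrite place_pure //.
apply: (big_ind (fun z => z * leg n l y = leg n l y * z)) => [|u z yu yz|i _].
- by rewrite mulr1 mul1r.
- by rewrite -mulrA yz mulrA yu mulrA.
apply: leg_comm; apply: contraNneq ls => <-; rewrite mem_nth //.
by case/and3P: ps => /eqP->.
Qed.
End MoreMorphisms.

Lemma sexp_scale_conj (k : fieldType) (B : algType k) (c : k) (x y : B)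
    (U U' : series B) : [pchar k] =i pred0 -> U' * U = 1 -> U * U' = 1 ->
  cst x * (U * cst y * U') = U * cst y * U' * cst x ->
  sexp (c *: ((cst x + U * cst y * U' : series B) : kser B)) =
  hexp (c *: x) * (U * hexp (c *: y) * U').
Proof.
move=> k0 U'U UU' C.
rewrite -kscaleE scalerDr scalerAl scalerAr.
have cZ z : cst c *: cst z = cst (c *: z) :> series B.
  by rewrite kscaleE (linZ (@cst_linear k B)).
rewrite (sexpD k0) ?cZ ?cZ; last first.
  by rewrite -!cZ -!scalerAr -!scalerAl -!scalerAr C.
by rewrite sexp_conj ?sexp_cst.
Qed.

(** The pattern of Δ(v)^{ij} w_l, with [e] = (J^ij)^-1 and [z] = w_l: the conjugation disappears
    from v_i w_l, which commutes with s_ij, and stays on v_j w_l. *)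
Lemma conj_sum_mulr (R : nzRingType) (e e' z x y : R) :
  e * e' = 1 -> e * z = z * e -> e' * z = z * e' -> e * (x * z) = x * z * e ->
  (e * x * e' + e' * y * e) * z = x * z + e' * (y * z) * e.
Proof.
move=> ee' ez e'z exz; rewrite mulrDl; congr (_ + _).
  by rewrite -!mulrA e'z (mulrA x) mulrA exz -mulrA ee' mulr1.
by rewrite -mulrA ez !mulrA.
Qed.

Lemma conj_sum_mull (R : nzRingType) (e e' z x y : R) :
  e' * e = 1 -> e * z = z * e -> e' * z = z * e' -> e' * (z * y) = z * y * e' ->
  z * (e * x * e' + e' * y * e) = z * y + e * (z * x) * e'.
Proof.
move=> e'e ez e'z ezy; rewrite mulrDr addrC; congr (_ + _).
  by rewrite !mulrA -e'z -(mulrA e') ezy -!mulrA e'e mulr1.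
by rewrite !mulrA -ez.
Qed.

(** * Coassociativity and the pentagon *)

Section LegExp.
Variable k : fieldType.
Hypothesis k0 : [pchar k] =i pred0.
Variables (A : algType k) (v w : A).

(** e^{c h v_i w_j}, so that J^ij and its inverse are the values at c = -1/2 and
   c = 1/2. *)
Definition legexp c n i j : series (tens n A) :=
  hexp (c *: (leg n i v * leg n j w)).
Local Notation E := legexp.

Lemma legexpK c n i j : E c n i j * E (- c) n i j = 1.
Proof. by rewrite /legexp scaleNr hexp_mulN. Qed.
Lemma legexpNK c n i j : E (- c) n i j * E c n i j = 1.
Proof. by rewrite /legexp scaleNr hexpNK. Qed.
Lemma legexpD c d n i j : E (c + d) n i j = E c n i j * E d n i j.
Proof. by rewrite /legexp scalerDl hexpD // -!scalerAl -!scalerAr !scalerA mulrC. Qed.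

(** Only a v and a w in the same leg can fail to commute, and the two hypotheses exclude this for
    letters of different factors; two letters v in one leg are equal, and so are two letters w. *)
Lemma leg_prod_comm n i j l m : j != l -> i != m ->
  (leg n i v * leg n j w) * (leg n l v * leg n m w) =
  (leg n l v * leg n m w) * (leg n i v * leg n j w) :> tens n A.
Proof.
move=> jl im; rewrite -!mulrA (mulrA (leg n j w)) (leg_comm _ _ jl) !mulrA.
have vv : leg n i v * leg n l v = leg n l v * leg n i v :> tens n A.
  by have [->|il] := eqVneq i l; last exact: leg_comm.
have ww : leg n j w * leg n m w = leg n m w * leg n j w :> tens n A.
  by have [->|jm] := eqVneq j m; last exact: leg_comm.
by rewrite vv -mulrA ww mulrA -(mulrA (leg n l v)) (leg_comm _ _ im) !mulrA.
Qed.

Lemma legexp_comm c d n i j l m : j != l -> i != m ->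
  E c n i j * E d n l m = E d n l m * E c n i j.
Proof.
move=> jl im; rewrite /legexp -!hexpD //; first by rewrite addrC.
all: by rewrite -!scalerAl -!scalerAr !scalerA mulrC (leg_prod_comm _ jl im).
Qed.

Lemma legexp_prod c n i j l m : j != l -> i != m ->
  E c n i j * cst (leg n l v * leg n m w) = cst (leg n l v * leg n m w) * E c n i j.
Proof.
move=> jl im; rewrite /legexp -sexp_cst sexp_comm // -!cst_mul.
by congr cst; rewrite -scalerAl -scalerAr (leg_prod_comm _ jl im).
Qed.

Lemma legexp_leg c n i j l x : l != i -> l != j ->
  E c n i j * cst (leg n l x) = cst (leg n l x) * E c n i j.
Proof.
move=> li lj; rewrite /legexp -sexp_cst sexp_comm // -!cst_mul.
congr cst; rewrite -scalerAl -scalerAr; congr (_ *: _).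
by rewrite !mulrA (leg_comm x v li) -!mulrA (leg_comm x w lj).
Qed.

Lemma place_legexp c m n s i j : places m n s -> (i < m)%N -> (j < m)%N ->
  smap (place n s) (E c m i.+1 j.+1) = E c n (nth 0%N s i) (nth 0%N s j).
Proof.
move=> ps im jm; have mp := @place_alg k A m n s ps.
by rewrite (smap_hexp _ mp) (linZ (alg_lin mp)) (algM mp) !place_leg.
Qed.

Variables (q : k) (D : A -> kser (tens 2 A)).
Local Notation J := (E (- q) 2 1 2).
Local Notation J' := (E q 2 1 2).
Hypothesis mD : is_alg_morph D.
Hypothesis Dv : D v = J' * cst (leg 2 1 v) * J + J * cst (leg 2 2 v) * J'.
Hypothesis Dw : D w = J' * cst (leg 2 1 w) * J + J * cst (leg 2 2 w) * J'.

Definition copi n i j (x : A) : kser (tens n A) := smap (place n [:: i; j]) (D x).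

Lemma copi_alg n i j : places 2 n [:: i; j] -> is_alg_morph (copi n i j).
Proof.
move=> pij; apply: (comp_alg (f := smap (place n [:: i; j]) : kser _ -> kser _)) => //.
by apply: smap_kalg; apply: place_alg.
Qed.

Lemma copi_comm n i j l x y : places 2 n [:: i; j] -> l \notin [:: i; j] ->
  copi n i j x * cst (leg n l y) = cst (leg n l y) * copi n i j x.
Proof.
move=> pij lij; apply: seriesP => m; rewrite coef_Mcst coef_cstM.
by rewrite [copi n i j x m]/= place_leg_comm.
Qed.

Lemma copi_gen n i j x : places 2 n [:: i; j] ->
  D x = J' * cst (leg 2 1 x) * J + J * cst (leg 2 2 x) * J' ->
  copi n i j x = E q n i j * cst (leg n i x) * E (- q) n i j +
                 E (- q) n i j * cst (leg n j x) * E q n i j.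
Proof.
move=> pij Dx; rewrite /copi Dx; have mp := @place_alg k A 2 n _ pij.
have [sl _ sM] := smap_alg mp.
rewrite (linD sl) !sM !place_legexp // !(smap_cst (alg_lin mp)).
by rewrite !(place_leg _ pij).
Qed.

(** Here Δ(v)^{ij} w_l = s_il + J^ij s_jl (J^ij)^-1, because s_il commutes with s_ij. The summands
    commute since s_il also commutes with s_jl, so the exponential splits. *)
Lemma sexp_copi_leg c n i j l :
    places 2 n [:: i; j] -> l \notin [:: i; j] ->
  sexp (c *: (copi n i j v * (cst (leg n l w) : kser (tens n A)))) =
  E c n i l * (E (- q) n i j * E c n j l * E q n i j).
Proof.
move=> pij; rewrite !inE negb_or => /andP[li lj].
have ij : i != j by case/and3P: pij => _ /=; rewrite inE andbT.
pose s a b : series (tens n A) := cst (leg n a v * leg n b w).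
have X : copi n i j v * cst (leg n l w) =
         s i l + E (- q) n i j * s j l * E q n i j :> series _.
  rewrite (copi_gen pij Dv).
  rewrite (@conj_sum_mulr _ _ _ (cst (leg n l w))) ?legexpK ?legexp_leg //.
    by rewrite -!cst_mul.
  by rewrite -cst_mul legexp_prod 1?eq_sym.
rewrite X sexp_scale_conj ?legexpK ?legexpNK //.
have Cs d : s i l * E d n i j = E d n i j * s i l by rewrite legexp_prod 1?eq_sym.
have ss : s i l * s j l = s j l * s i l.
  by rewrite -!cst_mul leg_prod_comm // eq_sym.
rewrite -/(s i l) -/(s j l) !mulrA Cs -(mulrA _ (s i l)) ss.
rewrite -!mulrA Cs.
done.
Qed.

(** Mirror image of the preceding case: in v_l Δ(w)^{ij} it is s_lj that commutes with s_ij, while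
    s_li stays conjugated, now by the inverse of J^ij. *)
Lemma sexp_leg_copi c n i j l :
    places 2 n [:: i; j] -> l \notin [:: i; j] ->
  sexp (c *: ((cst (leg n l v) : kser (tens n A)) * copi n i j w)) =
  E c n l j * (E q n i j * E c n l i * E (- q) n i j).
Proof.
move=> pij; rewrite !inE negb_or => /andP[li lj].
have ij : i != j by case/and3P: pij => _ /=; rewrite inE andbT.
pose s a b : series (tens n A) := cst (leg n a v * leg n b w).
have X : cst (leg n l v) * copi n i j w =
         s l j + E q n i j * s l i * E (- q) n i j :> series _.
  rewrite (copi_gen pij Dw).
  rewrite (@conj_sum_mull _ _ _ (cst (leg n l v))) ?legexpNK ?legexp_leg //.
    by rewrite -!cst_mul.
  by rewrite -cst_mul legexp_prod // eq_sym.
rewrite X sexp_scale_conj ?legexpK ?legexpNK //.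
have Cs d : s l j * E d n i j = E d n i j * s l j by rewrite legexp_prod // eq_sym.
have ss : s l j * s l i = s l i * s l j.
  by rewrite -!cst_mul leg_prod_comm // eq_sym.
rewrite -/(s l j) -/(s l i) !mulrA Cs -(mulrA _ (s l j)) ss.
by rewrite -!mulrA Cs.
Qed.
End LegExp.

Section HLiftLegs.
Variables (k : fieldType) (A W : algType k) (v w : A).
Variables f g h : A -> kser W.
Hypotheses (mf : is_alg_morph f) (mg : is_alg_morph g) (mh : is_alg_morph h).
Hypotheses (fg : commuting f g) (fh : commuting f h) (gh : commuting g h).
Local Notation hpair := (hlift (pairF f g : _ -> series W)).
Local Notation htriple := (hlift (tripleF f g h : _ -> series W)).

Lemma hpair_alg : is_alg_morph hpair.
Proof. by apply: hlift_alg; [apply: pair_multilinear | apply: pair_alg]. Qed.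
Lemma hpair_leg1 x : hpair (cst (leg 2 1 x)) = f x.
Proof. by rewrite hlift_cst ?pair_leg1 //; apply: pair_multilinear. Qed.
Lemma hpair_leg2 x : hpair (cst (leg 2 2 x)) = g x.
Proof. by rewrite hlift_cst ?pair_leg2 //; apply: pair_multilinear. Qed.
Lemma hpair_legexp c : hpair (legexp v w c 2 1 2) = sexp (c *: (f v * g w)).
Proof.
have mF := pair_alg mf mg fg.
by rewrite (hlift_hexp _ mF) (linZ (alg_lin mF)) (algM mF) pair_leg1 ?pair_leg2.
Qed.

Lemma htriple_alg : is_alg_morph htriple.
Proof. by apply: hlift_alg; [apply: triple_multilinear | apply: triple_alg]. Qed.
Lemma htriple_legexp12 c : htriple (legexp v w c 3 1 2) = sexp (c *: (f v * g w)).
Proof.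
have mF := triple_alg mf mg mh fg fh gh.
by rewrite (hlift_hexp _ mF) (linZ (alg_lin mF)) (algM mF) triple_leg1 ?triple_leg2.
Qed.
Lemma htriple_legexp23 c : htriple (legexp v w c 3 2 3) = sexp (c *: (g v * h w)).
Proof.
have mF := triple_alg mf mg mh fg fh gh.
by rewrite (hlift_hexp _ mF) (linZ (alg_lin mF)) (algM mF) triple_leg2 ?triple_leg3.
Qed.
End HLiftLegs.

(* With the generic morphism laws, products in [series (tens n A)] would be taken
   for its algebra structure; comparing them with the canonical ones blows up. *)
Lemma series_tensM (k : fieldType) (A : algType k) m n
    (G : series (tens m A) -> series (tens n A)) (X Y : series (tens m A)) :
  is_alg_morph G -> G (X * Y) = G X * G Y.
Proof. by case=> _ _; apply. Qed.
Lemma series_tensD (k : fieldType) (A : algType k) m n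
    (G : series (tens m A) -> series (tens n A)) (X Y : series (tens m A)) :
  is_alg_morph G -> G (X + Y) = G X + G Y.
Proof. by case=> lG _ _; apply: linD. Qed.

Opaque legexp.

Section Twisted.
Variable k : fieldType.
Hypothesis k0 : [pchar k] =i pred0.
Variables (A : algType k) (v w : A) (q : k).
Variable Delta : {lrmorphism series A -> series (tens 2 A)}.
Local Notation E := (legexp v w).
Definition twisted_primitive x := Delta (cst x) =
  E q 2 1 2 * cst (leg 2 1 x) * E (- q) 2 1 2 +
  E (- q) 2 1 2 * cst (leg 2 2 x) * E q 2 1 2.
Hypothesis (Dv : twisted_primitive v) (Dw : twisted_primitive w).
Let D (x : A) : kser (tens 2 A) := Delta (cst x).

Definition assoc3 : series (tens 3 A) :=
  E q 3 2 3 * E (- q) 3 1 2 * E (- q) 3 2 3 * E q 3 1 2.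

Lemma D_alg : is_alg_morph D.
Proof.
split=> [c x y||x y]; rewrite /D.
- rewrite (@cst_linear k A c x y) -kscaleE.
  by rewrite linearP kscaleE.
- exact: rmorph1.
by rewrite cst_mul rmorphM.
Qed.

Lemma hleg_alg n i : (0 < i <= n)%N -> is_alg_morph (hleg n i : A -> kser (tens n A)).
Proof.
by move=> ni; apply: (comp_alg (f := @cst _ : _ -> kser _) (cst_alg _) (leg_alg ni)).
Qed.

Lemma hleg_comm n i j : i != j ->
  commuting (hleg n i : A -> kser (tens n A)) (hleg n j : A -> kser (tens n A)).
Proof. by move=> ij x y; rewrite -!cst_mul leg_comm. Qed.

Lemma sexp_hlegs c n i j :
  sexp (c *: ((hleg n i v : kser (tens n A)) * (hleg n j w : kser (tens n A)))) =
  E c n i j.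
Proof.
rewrite /hleg -cst_mul; have := linZ (@cst_linear k (tens n A)) c (leg n i v * leg n j w).
by move=> <-; rewrite sexp_cst.
Qed.

Lemma cop_alg n i j : places 2 n [:: i; j] ->
  is_alg_morph (cop Delta n i j : A -> kser (tens n A)).
Proof. exact: (copi_alg D_alg). Qed.

Lemma cop_hleg n i j l : places 2 n [:: i; j] -> l \notin [:: i; j] ->
  commuting (cop Delta n i j : A -> kser (tens n A)) (hleg n l : A -> kser (tens n A)).
Proof. by move=> pij lij x y; apply: (copi_comm D _ _ pij lij). Qed.

Lemma hleg_cop n i j l : places 2 n [:: i; j] -> l \notin [:: i; j] ->
  commuting (hleg n l : A -> kser (tens n A)) (cop Delta n i j : A -> kser (tens n A)).
Proof. by move=> pij lij x y; rewrite cop_hleg. Qed.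

Lemma Delta_id_alg : is_alg_morph (Delta_id Delta).
Proof. by apply: hpair_alg; [exact: cop_alg | exact: hleg_alg | exact: cop_hleg]. Qed.

Lemma id_Delta_alg : is_alg_morph (id_Delta Delta).
Proof. by apply: hpair_alg; [exact: hleg_alg | exact: cop_alg | exact: hleg_cop]. Qed.

Lemma Delta_id_legexp c : Delta_id Delta (E c 2 1 2) =
  E c 3 1 3 * (E (- q) 3 1 2 * E c 3 2 3 * E q 3 1 2).
Proof.
rewrite -(@sexp_copi_leg k k0 A v w q D Dv) //.
by apply: hpair_legexp; [exact: cop_alg | exact: hleg_alg | exact: cop_hleg].
Qed.

Lemma id_Delta_legexp c : id_Delta Delta (E c 2 1 2) =
  E c 3 1 3 * (E q 3 2 3 * E c 3 1 2 * E (- q) 3 2 3).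
Proof.
rewrite -(@sexp_leg_copi k k0 A v w q D Dw) //.
by apply: hpair_legexp; [exact: hleg_alg | exact: cop_alg | exact: hleg_cop].
Qed.

Lemma Delta_id_leg x y : Delta_id Delta (cst (leg 2 1 x)) = cop Delta 3 1 2 x /\
  Delta_id Delta (cst (leg 2 2 y)) = hleg 3 3 y.
Proof.
by split; [apply: hpair_leg1 | apply: hpair_leg2];
  do ?[exact: cop_alg | exact: hleg_alg | exact: cop_hleg].
Qed.

Lemma id_Delta_leg x y : id_Delta Delta (cst (leg 2 1 x)) = hleg 3 1 x /\
  id_Delta Delta (cst (leg 2 2 y)) = cop Delta 3 2 3 y.
Proof.
by split; [apply: hpair_leg1 | apply: hpair_leg2];
  do ?[exact: cop_alg | exact: hleg_alg | exact: hleg_cop].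
Qed.

Lemma cop_gen n i j x : places 2 n [:: i; j] -> twisted_primitive x ->
  cop Delta n i j x = E q n i j * cst (leg n i x) * E (- q) n i j +
                      E (- q) n i j * cst (leg n j x) * E q n i j.
Proof. by move=> pij Dx; apply: (@copi_gen k A v w q D n i j x pij Dx). Qed.

(** Δ(x) contains J, whose images under Δ⊗id and id⊗Δ are known from Δ(v) and Δ(w) respectively;
    everything then lies in words in J^12, J^13, J^23 and the three legs of x. *)
Lemma coassoc_gen x : twisted_primitive x ->
  id_Delta Delta (Delta (cst x)) * assoc3 = assoc3 * Delta_id Delta (Delta (cst x)).
Proof.
move=> Dx; rewrite Dx.
rewrite (series_tensD _ _ id_Delta_alg) (series_tensD _ _ Delta_id_alg).
rewrite 4!(series_tensM _ _ id_Delta_alg) 4!(series_tensM _ _ Delta_id_alg).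
rewrite 2!id_Delta_legexp 2!Delta_id_legexp.
have [-> ->] := id_Delta_leg x x; have [-> ->] := Delta_id_leg x x.
rewrite !cop_gen // /hleg /assoc3.
apply: (@coassoc_words _ (E (- q) 3 1 2) (E q 3 1 2) (E (- q) 3 2 3) (E q 3 2 3)
  (E (- q) 3 1 3) (E q 3 1 3) (cst (leg 3 1 x)) (cst (leg 3 2 x)) (cst (leg 3 3 x)));
  try exact: legexpK; try exact: legexpNK.
- move=> y + z; rewrite !inE => /or4P[|||/orP[]] /eqP-> /orP[]/eqP->;
    by [exact: legexp_comm | rewrite legexp_leg].
- by move=> y; rewrite !inE => /orP[]/eqP->; rewrite legexp_leg.
by move=> y; rewrite !inE => /orP[]/eqP->; rewrite legexp_leg.
Qed.

Lemma pentagon : Phi_1_2_34 Delta assoc3 * Phi_12_3_4 Delta assoc3 =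
  Phi_2_3_4 assoc3 * Phi_1_23_4 Delta assoc3 * Phi_1_2_3 assoc3.
Proof.
have A1 : is_alg_morph (Phi_1_2_34 Delta).
  by apply: htriple_alg;
    do ?[exact: cop_alg | exact: hleg_alg |
       exact: hleg_cop | exact: hleg_comm].
have A2 : is_alg_morph (Phi_12_3_4 Delta).
  by apply: htriple_alg;
    do ?[exact: cop_alg | exact: hleg_alg |
       exact: cop_hleg | exact: hleg_comm].
have A3 : is_alg_morph (Phi_1_23_4 Delta).
  by apply: htriple_alg;
    do ?[exact: cop_alg | exact: hleg_alg |
       exact: cop_hleg | exact: hleg_cop | exact: hleg_comm].
have p3 : places 3 4 [:: 1; 2; 3]%N by [].
have p4 : places 3 4 [:: 2; 3; 4]%N by [].
have A4 := smap_alg (@place_alg k A 3 4 _ p3).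
have A5 := smap_alg (@place_alg k A 3 4 _ p4).
(* Values of the five morphisms on the two exponentials of which Φ is made: legs that are not
   doubled are only renumbered, and a doubled leg brings in Δ(v) or Δ(w) according to the letter it
   carries. *)
have E1 c : Phi_1_2_34 Delta (E c 3 1 2) = E c 4 1 2.
  transitivity (sexp (c *: (hleg 4 1 v * hleg 4 2 w : kser (tens 4 A)))); last exact: sexp_hlegs.
  by apply: htriple_legexp12;
    do ?[exact: cop_alg | exact: hleg_alg |
       exact: cop_hleg | exact: hleg_cop | exact: hleg_comm].
have E2 c : Phi_1_2_34 Delta (E c 3 2 3) = E c 4 2 4 * (E q 4 3 4 * E c 4 2 3 * E (- q) 4 3 4).
  transitivity (sexp (c *: (hleg 4 2 v * cop Delta 4 3 4 w : kser (tens 4 A))));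
    last exact: (@sexp_leg_copi k k0 A v w q D Dw).
  by apply: htriple_legexp23;
    do ?[exact: cop_alg | exact: hleg_alg |
       exact: cop_hleg | exact: hleg_cop | exact: hleg_comm].
have E3 c : Phi_12_3_4 Delta (E c 3 1 2) = E c 4 1 3 * (E (- q) 4 1 2 * E c 4 2 3 * E q 4 1 2).
  transitivity (sexp (c *: (cop Delta 4 1 2 v * hleg 4 3 w : kser (tens 4 A))));
    last exact: (@sexp_copi_leg k k0 A v w q D Dv).
  by apply: htriple_legexp12;
    do ?[exact: cop_alg | exact: hleg_alg |
       exact: cop_hleg | exact: hleg_cop | exact: hleg_comm].
have E4 c : Phi_12_3_4 Delta (E c 3 2 3) = E c 4 3 4.
  transitivity (sexp (c *: (hleg 4 3 v * hleg 4 4 w : kser (tens 4 A)))); last exact: sexp_hlegs.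
  by apply: htriple_legexp23;
    do ?[exact: cop_alg | exact: hleg_alg |
       exact: cop_hleg | exact: hleg_cop | exact: hleg_comm].
have E5 c : Phi_1_23_4 Delta (E c 3 1 2) = E c 4 1 3 * (E q 4 2 3 * E c 4 1 2 * E (- q) 4 2 3).
  transitivity (sexp (c *: (hleg 4 1 v * cop Delta 4 2 3 w : kser (tens 4 A))));
    last exact: (@sexp_leg_copi k k0 A v w q D Dw).
  by apply: htriple_legexp12;
    do ?[exact: cop_alg | exact: hleg_alg |
       exact: cop_hleg | exact: hleg_cop | exact: hleg_comm].
have E6 c : Phi_1_23_4 Delta (E c 3 2 3) = E c 4 2 4 * (E (- q) 4 2 3 * E c 4 3 4 * E q 4 2 3).
  transitivity (sexp (c *: (cop Delta 4 2 3 v * hleg 4 4 w : kser (tens 4 A))));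
    last exact: (@sexp_copi_leg k k0 A v w q D Dv).
  by apply: htriple_legexp23;
    do ?[exact: cop_alg | exact: hleg_alg |
       exact: cop_hleg | exact: hleg_cop | exact: hleg_comm].
have E7 c : smap (place 4 [:: 1; 2; 3]%N) (E c 3 1 2) = E c 4 1 2.
  exact: (place_legexp v w c p3 (i := 0) (j := 1)).
have E8 c : smap (place 4 [:: 1; 2; 3]%N) (E c 3 2 3) = E c 4 2 3.
  exact: (place_legexp v w c p3 (i := 1) (j := 2)).
have E9 c : smap (place 4 [:: 2; 3; 4]%N) (E c 3 1 2) = E c 4 2 3.
  exact: (place_legexp v w c p4 (i := 0) (j := 1)).
have E10 c : smap (place 4 [:: 2; 3; 4]%N) (E c 3 2 3) = E c 4 3 4.
  exact: (place_legexp v w c p4 (i := 1) (j := 2)).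
have X1 : Phi_1_2_34 Delta assoc3 =
    E q 4 2 4 * (E q 4 3 4 * E q 4 2 3 * E (- q) 4 3 4) * E (- q) 4 1 2 *
    (E (- q) 4 2 4 * (E q 4 3 4 * E (- q) 4 2 3 * E (- q) 4 3 4)) * E q 4 1 2.
  by rewrite /assoc3 3!(series_tensM _ _ A1) E2 E1 E2 E1; reflexivity.
have X2 : Phi_12_3_4 Delta assoc3 =
    E q 4 3 4 * (E (- q) 4 1 3 * (E (- q) 4 1 2 * E (- q) 4 2 3 * E q 4 1 2)) *
    E (- q) 4 3 4 * (E q 4 1 3 * (E (- q) 4 1 2 * E q 4 2 3 * E q 4 1 2)).
  by rewrite /assoc3 3!(series_tensM _ _ A2) E4 E3 E4 E3; reflexivity.
have X3 : Phi_1_23_4 Delta assoc3 =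
    E q 4 2 4 * (E (- q) 4 2 3 * E q 4 3 4 * E q 4 2 3) *
    (E (- q) 4 1 3 * (E q 4 2 3 * E (- q) 4 1 2 * E (- q) 4 2 3)) *
    (E (- q) 4 2 4 * (E (- q) 4 2 3 * E (- q) 4 3 4 * E q 4 2 3)) *
    (E q 4 1 3 * (E q 4 2 3 * E q 4 1 2 * E (- q) 4 2 3)).
  by rewrite /assoc3 3!(series_tensM _ _ A3) E6 E5 E6 E5; reflexivity.
have X4 : Phi_1_2_3 assoc3 = E q 4 2 3 * E (- q) 4 1 2 * E (- q) 4 2 3 * E q 4 1 2.
  rewrite /Phi_1_2_3 /assoc3 3!(series_tensM _ _ A4) E8 E7 E8 E7; reflexivity.
have X5 : Phi_2_3_4 assoc3 = E q 4 3 4 * E (- q) 4 2 3 * E (- q) 4 3 4 * E q 4 2 3.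
  rewrite /Phi_2_3_4 /assoc3 3!(series_tensM _ _ A5) E10 E9 E10 E9; reflexivity.
rewrite {}X1 {}X2 {}X3 {}X4 {}X5.
apply: (@pentagon_words _ (E (- q) 4 1 2) (E q 4 1 2) (E (- q) 4 2 3) (E q 4 2 3)
  (E (- q) 4 1 3) (E q 4 1 3) (E (- q) 4 3 4) (E q 4 3 4)
  (E (- q) 4 2 4) (E q 4 2 4)); try exact: legexpK; try exact: legexpNK.
- by move=> y + z; rewrite !inE => /or4P[] /eqP-> /orP[]/eqP->; exact: legexp_comm.
- by move=> y + z; rewrite !inE => /orP[] /eqP-> /orP[]/eqP->; exact: legexp_comm.
by move=> y + z; rewrite !inE => /or4P[|||/or3P[]] /eqP-> /orP[]/eqP->;
  exact: legexp_comm.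
Qed.

End Twisted.

Transparent legexp.

(** * The quasi-antipode *)

Section ConjExp.
Variable k : fieldType.
Hypothesis k0 : [pchar k] =i pred0.

(** The generating series of (-ad w)^n(a)/n!. The Leibniz rule and the inversion formula for these
    operators thus become facts about conjugation. *)
Definition conjexp (B : algType k) (w a : B) : series B :=
  hexp (- w) * cst a * hexp w.

Lemma conjexp_coef (B : algType k) (w a : B) n :
  conjexp w a n = \sum_(i < n.+1) hexp (- w) i * a * hexp w (n - i)%N.
Proof. by rewrite /conjexp coefM; apply: eq_bigr => i _; rewrite coef_Mcst. Qed.

Lemma conjexp_coef0 (B : algType k) (w a : B) : conjexp w a 0%N = a.
Proof. by rewrite conjexp_coef big_ord1 /= invr1 !scale1r !expr0 mul1r mulr1. Qed.

Lemma conjexpM (B : algType k) (w a b : B) :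
  conjexp w (a * b) = conjexp w a * conjexp w b.
Proof.
by rewrite /conjexp cst_mul -!mulrA (mulrA (hexp w)) hexp_mulN // mul1r.
Qed.

Lemma conjexp_self (B : algType k) (w : B) : conjexp w w = cst w.
Proof.
rewrite /conjexp -!sexp_cst -mulrA -(@sexp_comm _ _ (cst w)) //.
by rewrite mulrA cstN sexpNK // mul1r.
Qed.

Lemma smap_conjexp (B C : algType k) (f : B -> C) (w a : B) :
  is_alg_morph f -> smap f (conjexp w a) = conjexp (f w) (f a).
Proof.
move=> mf; rewrite /conjexp !(algM (smap_alg mf)) !(smap_hexp _ mf).
by rewrite (smap_cst (alg_lin mf)) (linN (alg_lin mf)).
Qed.

Lemma hexpN_coef (B : algType k) (w : B) n : hexp (- w) n = (-1) ^+ n *: hexp w n.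
Proof. by rewrite /= -scaleN1r exprZn !scalerA mulrC. Qed.

Lemma conjexpN_coef (B : algType k) (w a : B) n :
  conjexp (- w) a n = (-1) ^+ n *: conjexp w a n.
Proof.
rewrite !conjexp_coef scaler_sumr; apply: eq_bigr => i _.
have le_in : (i <= n)%N by rewrite -ltnS.
have sgn : (-1) ^+ n * (-1) ^+ i = (-1) ^+ (n - i) :> k.
  by rewrite -{1}(subnK le_in) exprD -mulrA -expr2 sqrr_sign mulr1.
rewrite opprK !hexpN_coef; move: (hexp w _) (hexp w _) => P Q.
by rewrite -scalerAr -!scalerAl scalerA sgn.
Qed.

(** Conjugation by e^{hw} followed by its inverse, read off in degree n; the sign (-1)^j turns
    [conjexp w] into [conjexp (- w)]. *)
Lemma conjexpK (B : algType k) (w a : B) n :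
  \sum_(j < n.+1) (-1) ^+ j *: conjexp w (conjexp w a j) (n - j)%N =
  if n is 0%N then a else 0.
Proof.
pose L (Z : series B) : series B := hexp (- w) * Z * hexp w.
have linL : linear L by move=> c x y; rewrite /L mulrDr mulrDl -scalerAr -scalerAl.
transitivity (L (conjexp (- w) a) n); last first.
  rewrite /L /conjexp opprK !mulrA hexpNK // mul1r -mulrA hexpNK // mulr1.
  by case: n.
rewrite -(hsum_cst (conjexp (- w) a)) hsum_linear //; apply: eq_bigr => j _.
rewrite conjexpN_coef (linZ (@cst_linear k B)).
rewrite /L /conjexp -kscaleE -scalerAr -scalerAl coef_cstZ.
done.
Qed.
End ConjExp.

(** * The operators N_z *)

Section NormalOrder.
Variable k : fieldType.
Hypothesis k0 : [pchar k] =i pred0.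
Variables (A : algType k) (w : A).
Implicit Types (a y z : series A).

(** The operator (-ad w)^n / n!. *)
Definition divad n a : series A :=
  \sum_(i < n.+1) cst (hexp (- w) i) * a * cst (hexp w (n - i)%N).

(** The operators are the t-coefficients of conjugation in A[[h]][[t]]; the separate variable keeps
    them apart from the powers of h inside [a]. *)
Lemma divadE n a : divad n a = conjexp (cst w : kser A) (a : kser A) n.
Proof.
rewrite conjexp_coef; apply: eq_bigr => i _.
have H b j : hexp (cst b : kser A) j = cst (hexp b j).
  by rewrite -(smap_hexp b (@cst_alg k A)).
by rewrite -(linN (@cst_linear k A)) !H.
Qed.

Lemma divad_linear n : linear (divad n).
Proof.
move=> c x y; rewrite scaler_sumr -big_split; apply: eq_bigr => i _ /=.
by rewrite mulrDr mulrDl -scalerAr -scalerAl.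
Qed.

Lemma divad0 a : divad 0 a = a.
Proof. by rewrite divadE conjexp_coef0. Qed.

Lemma divadM n x y : divad n (x * y) = \sum_(i < n.+1) divad i x * divad (n - i) y.
Proof.
rewrite divadE -[x * y]/((x : kser A) * (y : kser A)) conjexpM // coefM.
by apply: eq_bigr => i _; rewrite !divadE.
Qed.

Lemma divadK n a :
  \sum_(j < n.+1) (-1) ^+ j *: divad (n - j) (divad j a) =
  if n is 0%N then a else 0.
Proof.
rewrite -(conjexpK k0 (cst w : kser A) (a : kser A)); apply: eq_bigr => j _.
rewrite !divadE -kscaleE; congr (_ *: _).
by elim: (nat_of_ord j) => [//|m IH]; rewrite !exprS cst_mul IH cstN.
Qed.

Lemma divad_cst n (x : A) : divad n (cst x) = cst (conjexp w x n).
Proof.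
rewrite divadE; have := smap_conjexp w x (@cst_alg k A).
by move/(congr1 (fun X : series (kser A) => X n)).
Qed.

Lemma divad_self n : divad n (cst w) = if n is 0%N then cst w else 0.
Proof. by rewrite divad_cst conjexp_self //; case: n => // n; rewrite cst0. Qed.

(** Sum over n of (-h)^n/n! z^n ad(w)^n(a). *)
Definition nord z a : series A := hsum (fun n => z ^+ n * divad n a).

Lemma nord_linear z : linear (nord z).
Proof.
move=> c x y; rewrite /nord.
have linc : linear ( *:%R c : series A -> series A).
  by move=> d u u'; rewrite scalerDr !scalerA mulrC.
rewrite (hsum_linear _ linc) -hsumD; apply: eq_hsum => n.
by rewrite divad_linear mulrDr scalerAr.
Qed.

Lemma nord_bij z : bijective (nord z).
Proof.
apply: linear_unipotent_bij; first exact: nord_linear.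
by move=> X; rewrite /nord coef_hsum big_ord1 divad0 expr0 mul1r.
Qed.

(** N_z is not multiplicative, since all powers of z are collected on the left. By the Leibniz rule
    N_z(ya) is the sum over j of z^j N_z(y) D_j(a) with D_j = [divad j], and N_z(y) = -z commutes
    with z^j, so it can be pulled out. *)
Lemma nordM z y a : nord z y = - z -> nord z (y * a) = - z * nord z a.
Proof.
move=> zy.
transitivity (hsum (fun j => hsum (fun i => z ^+ (i + j) * divad i y * divad j a)) : series A).
  rewrite hsum_hsum; apply: eq_hsum => n.
  rewrite divadM mulr_sumr (reindex_inj rev_ord_inj); apply: eq_bigr => i _ /=.
  have le_in : (i <= n)%N by rewrite -ltnS.
  by rewrite subSS subKn // subnK // mulrA.
rewrite /nord (@hsum_mull k); apply: eq_hsum => j.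
transitivity (z ^+ j * nord z y * divad j a).
  rewrite /nord (@hsum_mull k) (@hsum_mulr k); apply: eq_hsum => i.
  by rewrite mulrA -exprD addnC.
by rewrite zy mulrN mulNr mulNr mulrA -exprS -exprSr.
Qed.

Lemma nordXM z y a n : nord z y = - z ->
  nord z (y ^+ n * a) = (- z) ^+ n * nord z a.
Proof.
move=> zy; elim: n => [|n IH]; first by rewrite !mul1r.
by rewrite !exprS -mulrA nordM // IH mulrA.
Qed.

(** Every y inside N_y(a) comes out of N_z as -z, which leaves the double sum of (-1)^j z^{i+j} D_i
    D_j(a); grouped by i+j it collapses to a by [divadK]. *)
Lemma nordK z y a : nord z y = - z -> nord z (nord y a) = a.
Proof.
move=> zy; rewrite {2}/nord (hsum_linear _ (nord_linear z)).
transitivity (hsum (fun j => hsum (fun i =>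
    z ^+ (i + j) * ((-1) ^+ j *: divad i (divad j a)))) : series A).
  apply: eq_hsum => j; rewrite nordXM // /nord (@hsum_mull k); apply: eq_hsum => i.
  by rewrite -scaleN1r exprZn -scalerAl mulrA -exprD addnC scalerAr.
rewrite hsum_hsum.
transitivity (hsum (fun n => z ^+ n * if n is 0%N then a else 0)).
  apply: eq_hsum => n; rewrite -divadK mulr_sumr; apply: eq_bigr => j _.
  by rewrite subnK // -ltnS.
by rewrite hsum_head ?mul1r // => n; rewrite mulr0.
Qed.
End NormalOrder.

(** With the opposite algebra as target, the universal property of T(V) produces antimorphisms. *)
Definition opalg (k : comNzRingType) (B : algType k) : Type := (B : Type)^c.

Section OppositeAlgebra.
Variables (k : comNzRingType) (B : algType k).
HB.instance Definition _ := GRing.NzRing.on (opalg B).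
HB.instance Definition _ := GRing.Zmodule_isLmodule.Build k (opalg B)
  (@scalerA k B) (@scale1r k B) (@scalerDr k B) (fun v => @scalerDl k B v).
Lemma opalg_scaleAl (c : k) (x y : opalg B) : c *: (x * y) = (c *: x) * y.
Proof. exact: (@scalerAr k B c y x). Qed.
HB.instance Definition _ := GRing.Lmodule_isLalgebra.Build k (opalg B) opalg_scaleAl.
Lemma opalg_scaleAr (c : k) (x y : opalg B) : c *: (x * y) = x * (c *: y).
Proof. exact: (@scalerAl k B c y x). Qed.
HB.instance Definition _ := GRing.Lalgebra_isAlgebra.Build k (opalg B) opalg_scaleAr.
End OppositeAlgebra.

Definition is_antimorph (k : comNzRingType) (A B : algType k) (f : A -> B) :=
  [/\ linear f, f 1 = 1 & forall x y, f (x * y) = f y * f x].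

Lemma talg_antimorph (k : comNzRingType) (V : lmodType k) (B : algType k)
    (s : V -> B) : linear s ->
  exists F : talg V -> B, is_antimorph F /\ forall x, F (talg_gen x) = s x.
Proof.
move=> lins.
pose s' : {linear V -> opalg B} :=
  HB.pack (s : V -> opalg B) (GRing.isLinear.Build k V (opalg B) *:%R s lins).
exists (talg_lift s' : talg V -> opalg B); split; last exact: (talg_lift_gen s').
split; first exact: (talg_lift_linear s').
  exact: (talg_lift_one s').
exact: (talg_lift_mul s').
Qed.

Section Kill.
Variables (k : fieldType) (A B : algType k).
Variables (L : series A -> series B) (X : series A).
Hypothesis linL : linear L.

Let sexp_coef n : (hexp (X : kser A) n : series A) = cst n`!%:R^-1 *: (X ^+ n).
Proof. by rewrite kscaleE. Qed.

(** If L vanishes on all multiples of X, only the term of degree 0 of e^{hX} survives. This is how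
    exponentials disappear from the antipode axioms. *)
Lemma sexp_kill_left Z : (forall Z, L (X * Z) = 0) -> L (sexp X * Z) = L Z.
Proof.
move=> XZ; rewrite /sexp (@hsum_mulr k) (hsum_linear _ linL).
have E n : L ((hexp (X : kser A) n : series A) * Z) = if n is 0%N then L Z else 0.
  rewrite sexp_coef.
  rewrite -scalerAl (linZ linL); case: n => [|n].
    by rewrite invr1 scale1r mul1r.
  by rewrite exprS -mulrA XZ scaler0.
by rewrite (eq_hsum E) hsum_head.
Qed.

Lemma sexp_kill_right Z : (forall Z, L (Z * X) = 0) -> L (Z * sexp X) = L Z.
Proof.
move=> XZ; rewrite /sexp (@hsum_mull k) (hsum_linear _ linL).
have E n : L (Z * (hexp (X : kser A) n : series A)) = if n is 0%N then L Z else 0.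
  rewrite sexp_coef.
  rewrite -scalerAr (linZ linL); case: n => [|n].
    by rewrite invr1 scale1r mulr1.
  by rewrite exprSr mulrA XZ scaler0.
by rewrite (eq_hsum E) hsum_head.
Qed.
End Kill.

Section SeriesTensExt.
Variables (k : comNzRingType) (n : nat) (A W : algType k).
Lemma series_tens_ext (L L' : series (tens n A) -> series W) :
  linear L -> linear L' -> (forall a, L (cst (pure a)) = L' (cst (pure a))) ->
  L =1 L'.
Proof.
move=> lL lL' e; apply: linear_series_ext => // x.
have lc f : linear f -> linear (fun x => f (cst x) : kser W).
  move=> lf c y z; rewrite -kscaleE -(linZ lf) -(linD lf).
  by rewrite (@cst_linear k _ c y z) -kscaleE.
exact: (@linear_tens_ext k n A (kser W) _ _ (lc _ _ lL) (lc _ _ lL') e x).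
Qed.
End SeriesTensExt.

Section Placement.
Variables (k : comNzRingType) (A : algType k) (b : {ffun 'I_2 -> A}).

Lemma place12_pure : place 3 [:: 1; 2]%N (pure b) =
  pure [ffun i : 'I_3 => if i == 0 then b 0 else if i == 1 then b 1 else 1].
Proof.
rewrite place_pure // !big_ord_recl big_ord0 mulr1 /leg pureM.
congr pure; apply/ffunP => i; rewrite !ffunE.
have -> : b (lift ord0 ord0) = b 1 by congr (b _); apply: val_inj.
by case: i => -[|[|[|//]]] //= i; rewrite ?mulr1 ?mul1r.
Qed.

Lemma place23_pure : place 3 [:: 2; 3]%N (pure b) =
  pure [ffun i : 'I_3 => if i == 0 then 1 else if i == 1 then b 0 else b 1].
Proof.
rewrite place_pure // !big_ord_recl big_ord0 mulr1 /leg pureM.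
congr pure; apply/ffunP => i; rewrite !ffunE.
have -> : b (lift ord0 ord0) = b 1 by congr (b _); apply: val_inj.
by case: i => -[|[|[|//]]] //= i; rewrite ?mulr1 ?mul1r.
Qed.
End Placement.

(** * Contractions by an antimorphism *)

Section Contractions.
Variables (k : comNzRingType) (A : algType k) (S : series A -> series A).
Hypothesis linS : linear S.
Hypothesis S1 : S 1 = 1.
Hypothesis SM : forall x y, S (x * y) = S y * S x.
Implicit Types (g d : series A).

(** The left sides of the four antipode axioms, with the inserted elements as parameters: a factor
    of the contracted tensor can then be traded for a change of the insertion. *)
Definition contr2 g := hlift (fun a : {ffun 'I_2 -> A} =>
  S (cst (a 0)) * g * cst (a 1)).
Definition contr2' g := hlift (fun a : {ffun 'I_2 -> A} =>
  cst (a 0) * g * S (cst (a 1))).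
Definition contr3 g d := hlift (fun a : {ffun 'I_3 -> A} =>
  cst (a 0) * g * S (cst (a 1)) * d * cst (a 2%:R)).
Definition contr3' g d := hlift (fun a : {ffun 'I_3 -> A} =>
  S (cst (a 0)) * g * cst (a 1) * d * S (cst (a 2%:R))).

Let lc : linear (fun x => cst x : kser A). Proof. exact: cst_linear. Qed.
Let lS : linear (fun x => S (cst x) : kser A).
Proof.
by move=> c x y; rewrite cst_linear -kscaleE (linD linS) -[c *: _]kscaleE (linZ linS).
Qed.

Let ml (f : A -> kser A) (x : kser A) : linear f -> linear (fun y => f y * x : kser A).
Proof. by move=> lf c y z; rewrite lf mulrDl scalerAl. Qed.
Let mr (f : A -> kser A) (x : kser A) : linear f -> linear (fun y => x * f y : kser A).
Proof. by move=> lf c y z; rewrite lf mulrDr scalerAr. Qed.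

Let m2 g : multilinear (fun a : {ffun 'I_2 -> A} =>
  S (cst (a 0)) * g * cst (a 1) : kser A).
Proof.
apply: (multilinear2 (G := fun x y => S (cst x) * g * cst y : kser A)) => x.
  by apply: (ml (f := fun y => S (cst y) * g)); apply: ml.
exact: mr.
Qed.
Let m2' g : multilinear (fun a : {ffun 'I_2 -> A} =>
  cst (a 0) * g * S (cst (a 1)) : kser A).
Proof.
apply: (multilinear2 (G := fun x y => cst x * g * S (cst y) : kser A)) => x.
  by apply: (ml (f := fun y => cst y * g)); apply: ml.
exact: mr.
Qed.
Let m3 g d : multilinear (fun a : {ffun 'I_3 -> A} =>
  cst (a 0) * g * S (cst (a 1)) * d * cst (a 2%:R) : kser A).
Proof.
apply: (multilinear3 (G := fun x y z => cst x * g * S (cst y) * d * cst z : kser A)) => x y.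
- by do 4! (apply: (ml (f := fun y => _)) => //).
- by do 2! (apply: (ml (f := fun y => _)) => //); apply: mr.
exact: mr.
Qed.
Let m3' g d : multilinear (fun a : {ffun 'I_3 -> A} =>
  S (cst (a 0)) * g * cst (a 1) * d * S (cst (a 2%:R)) : kser A).
Proof.
apply: (multilinear3 (G := fun x y z => S (cst x) * g * cst y * d * S (cst z) : kser A)) => x y.
- by do 4! (apply: (ml (f := fun y => _)) => //).
- by do 2! (apply: (ml (f := fun y => _)) => //); apply: mr.
exact: mr.
Qed.

Lemma contr2_linear g : linear (contr2 g). Proof. exact: hlift_linear. Qed.
Lemma contr2'_linear g : linear (contr2' g). Proof. exact: hlift_linear. Qed.
Lemma contr3_linear g d : linear (contr3 g d). Proof. exact: hlift_linear. Qed.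
Lemma contr3'_linear g d : linear (contr3' g d). Proof. exact: hlift_linear. Qed.

Lemma contr2_pure g a : contr2 g (cst (pure a)) = S (cst (a 0)) * g * cst (a 1).
Proof. exact: hlift_cst_pure. Qed.
Lemma contr2'_pure g a : contr2' g (cst (pure a)) = cst (a 0) * g * S (cst (a 1)).
Proof. exact: hlift_cst_pure. Qed.
Lemma contr3_pure g d a : contr3 g d (cst (pure a)) =
  cst (a 0) * g * S (cst (a 1)) * d * cst (a 2%:R).
Proof. exact: hlift_cst_pure. Qed.
Lemma contr3'_pure g d a : contr3' g d (cst (pure a)) =
  S (cst (a 0)) * g * cst (a 1) * d * S (cst (a 2%:R)).
Proof. exact: hlift_cst_pure. Qed.

Let flin_mulr (B C : algType (series k)) (f : B -> C) X :
  linear f -> linear (fun Y => f (X * Y)).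
Proof. by move=> lf c x y; rewrite mulrDr -scalerAr lf. Qed.
Let flin_mull (B C : algType (series k)) (f : B -> C) X :
  linear f -> linear (fun Y => f (Y * X)).
Proof. by move=> lf c x y; rewrite mulrDl -scalerAl lf. Qed.
Let mulr_lin (B C : algType (series k)) (f : B -> C) X :
  linear f -> linear (fun Y => X * f Y).
Proof. by move=> lf c x y; rewrite lf mulrDr -scalerAr. Qed.
Let mull_lin (B C : algType (series k)) (f : B -> C) X :
  linear f -> linear (fun Y => f Y * X).
Proof. by move=> lf c x y; rewrite lf mulrDl -scalerAl. Qed.

(** Because S reverses products, S(x_1 y_1) g x_2 y_2 = S(y_1) (S(x_1) g x_2) y_2: the left factor
    is contracted innermost. In [contr2'] it is the right one. *)
Lemma contr2M g X Y : contr2 g (X * Y) = contr2 (contr2 g X) Y.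
Proof.
move: Y; apply: series_tens_ext => [||b].
- exact/flin_mulr/contr2_linear.
- exact: contr2_linear.
rewrite contr2_pure; move: X; apply: series_tens_ext => [||a].
- exact/flin_mull/contr2_linear.
- exact/mull_lin/mulr_lin/contr2_linear.
by rewrite -cst_mul pureM !contr2_pure !ffunE !cst_mul SM !mulrA.
Qed.

Lemma contr2'M g X Y : contr2' g (X * Y) = contr2' (contr2' g Y) X.
Proof.
move: X; apply: series_tens_ext => [||a].
- exact/flin_mull/contr2'_linear.
- exact: contr2'_linear.
rewrite contr2'_pure; move: Y; apply: series_tens_ext => [||b].
- exact/flin_mulr/contr2'_linear.
- exact/mull_lin/mulr_lin/contr2'_linear.
by rewrite -cst_mul pureM !contr2'_pure !ffunE !cst_mul SM !mulrA.
Qed.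

Local Notation pl12 := (smap (@place k A 2 3 [:: 1; 2]%N)).
Local Notation pl23 := (smap (@place k A 2 3 [:: 2; 3]%N)).
Let pl12_alg : is_alg_morph (pl12 : series (tens 2 A) -> series (tens 3 A)).
Proof. by apply: smap_alg; apply: place_alg. Qed.
Let pl23_alg : is_alg_morph (pl23 : series (tens 2 A) -> series (tens 3 A)).
Proof. by apply: smap_alg; apply: place_alg. Qed.
Let pl12_pure b : pl12 (cst (pure b)) = cst (place 3 [:: 1; 2]%N (pure b)) :> series (tens 3 A).
Proof. by apply: smap_cst; apply: alg_lin; apply: place_alg. Qed.
Let pl23_pure b : pl23 (cst (pure b)) = cst (place 3 [:: 2; 3]%N (pure b)) :> series (tens 3 A).
Proof. by apply: smap_cst; apply: alg_lin; apply: place_alg. Qed.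

Let comp_lin (B C D : lmodType (series k)) (f : C -> D) (h : B -> C) :
  linear f -> linear h -> linear (fun x => f (h x)).
Proof. by move=> lf lh c x y; rewrite lh lf. Qed.

(** In S(b_0 a_1) d b_1 a_2 the components of Y enclose d directly, so Y^23 is absorbed into that
    insertion. The three lemmas after this one treat the other side and the other contraction. *)
Lemma contr3_pl23 g d X Y : contr3 g d (pl23 Y * X) = contr3 g (contr2 d Y) X.
Proof.
move: X; apply: series_tens_ext => [||a].
- exact/flin_mulr/contr3_linear.
- exact: contr3_linear.
rewrite contr3_pure; move: Y; apply: series_tens_ext => [||b].
- apply: (comp_lin (f := fun Z => contr3 g d (Z * _))).
    exact/flin_mull/contr3_linear.
  exact: alg_lin.
- exact/mull_lin/mulr_lin/contr2_linear.
rewrite pl23_pure -cst_mul place23_pure pureM contr3_pure contr2_pure !ffunE.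
by rewrite /= mul1r !cst_mul SM !mulrA.
Qed.

Lemma contr3_pl12 g d X Y : contr3 g d (X * pl12 Y) = contr3 (contr2' g Y) d X.
Proof.
move: X; apply: series_tens_ext => [||a].
- exact/flin_mull/contr3_linear.
- exact: contr3_linear.
rewrite contr3_pure; move: Y; apply: series_tens_ext => [||b].
- apply: (comp_lin (f := fun Z => contr3 g d (_ * Z))).
    exact/flin_mulr/contr3_linear.
  exact: alg_lin.
- exact/mull_lin/mull_lin/mull_lin/mulr_lin/contr2'_linear.
rewrite pl12_pure -cst_mul place12_pure pureM contr3_pure contr2'_pure !ffunE.
by rewrite /= mulr1 !cst_mul SM !mulrA.
Qed.

Lemma contr3'_pl12 g d X Y : contr3' g d (pl12 Y * X) = contr3' (contr2 g Y) d X.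
Proof.
move: X; apply: series_tens_ext => [||a].
- exact/flin_mulr/contr3'_linear.
- exact: contr3'_linear.
rewrite contr3'_pure; move: Y; apply: series_tens_ext => [||b].
- apply: (comp_lin (f := fun Z => contr3' g d (Z * _))).
    exact/flin_mull/contr3'_linear.
  exact: alg_lin.
- exact/mull_lin/mull_lin/mull_lin/mulr_lin/contr2_linear.
rewrite pl12_pure -cst_mul place12_pure pureM contr3'_pure contr2_pure !ffunE.
by rewrite /= mul1r !cst_mul SM !mulrA.
Qed.

Lemma contr3'_pl23 g d X Y : contr3' g d (X * pl23 Y) = contr3' g (contr2' d Y) X.
Proof.
move: X; apply: series_tens_ext => [||a].
- exact/flin_mull/contr3'_linear.
- exact: contr3'_linear.
rewrite contr3'_pure; move: Y; apply: series_tens_ext => [||b].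
- apply: (comp_lin (f := fun Z => contr3' g d (_ * Z))).
    exact/flin_mulr/contr3'_linear.
  exact: alg_lin.
- exact/mull_lin/mulr_lin/contr2'_linear.
rewrite pl23_pure -cst_mul place23_pure pureM contr3'_pure contr2'_pure !ffunE.
by rewrite /= mulr1 !cst_mul SM !mulrA.
Qed.

Lemma contr3_1 : contr3 1 1 1 = 1.
Proof.
by rewrite [X in contr3 _ _ X](_ : _ = cst (pure [ffun=> 1])) // contr3_pure !ffunE S1 !mulr1.
Qed.
Lemma contr3'_1 : contr3' 1 1 1 = 1.
Proof.
by rewrite [X in contr3' _ _ X](_ : _ = cst (pure [ffun=> 1])) // contr3'_pure !ffunE S1 !mulr1.
Qed.

Let lin_0 (B C : lmodType (series k)) : linear (fun _ : B => 0 : C).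
Proof. by move=> c x y; rewrite scaler0 addr0. Qed.

Lemma contr3_0r g X : contr3 g 0 X = 0.
Proof.
move: X; apply: series_tens_ext => [||a]; [exact: contr3_linear | exact: lin_0 |].
by rewrite contr3_pure mulr0 mul0r.
Qed.
Lemma contr3_0l d X : contr3 0 d X = 0.
Proof.
move: X; apply: series_tens_ext => [||a]; [exact: contr3_linear | exact: lin_0 |].
by rewrite contr3_pure mulr0 !mul0r.
Qed.
Lemma contr3'_0r g X : contr3' g 0 X = 0.
Proof.
move: X; apply: series_tens_ext => [||a]; [exact: contr3'_linear | exact: lin_0 |].
by rewrite contr3'_pure mulr0 mul0r.
Qed.
Lemma contr3'_0l d X : contr3' 0 d X = 0.
Proof.
move: X; apply: series_tens_ext => [||a]; [exact: contr3'_linear | exact: lin_0 |].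
by rewrite contr3'_pure mulr0 !mul0r.
Qed.

Lemma contr2_0 X : contr2 0 X = 0.
Proof.
move: X; apply: series_tens_ext => [||a]; [exact: contr2_linear | exact: lin_0 |].
by rewrite contr2_pure mulr0 mul0r.
Qed.
Lemma contr2'_0 X : contr2' 0 X = 0.
Proof.
move: X; apply: series_tens_ext => [||a]; [exact: contr2'_linear | exact: lin_0 |].
by rewrite contr2'_pure mulr0 mul0r.
Qed.

Let lin_Z (B C : lmodType (series k)) (f : B -> C) (c : series k) :
  linear f -> linear (fun x => c *: f x).
Proof. by move=> lf d x y; rewrite lf scalerDr !scalerA mulrC. Qed.

Lemma contr2Z c g X : contr2 (c *: g) X = c *: contr2 g X.
Proof.
move: X; apply: series_tens_ext => [||a]; [exact: contr2_linear | |].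
  exact/lin_Z/contr2_linear.
by rewrite !contr2_pure -scalerAr -scalerAl.
Qed.
Lemma contr2'Z c g X : contr2' (c *: g) X = c *: contr2' g X.
Proof.
move: X; apply: series_tens_ext => [||a]; [exact: contr2'_linear | |].
  exact/lin_Z/contr2'_linear.
by rewrite !contr2'_pure -scalerAr -scalerAl.
Qed.
End Contractions.

Lemma mulr3_comm (R : nzRingType) (z a b c : R) :
  z * a = a * z -> z * b = b * z -> z * c = c * z -> z * (a * b * c) = a * b * c * z.
Proof. by move=> za zb zc; rewrite !mulrA za -(mulrA a) zb -!mulrA zc. Qed.

Lemma twist_left_words (R : nzRingType) (a b x y : R) : a * b = 1 -> b * a = 1 ->
  a * (b * x * a + a * y * b) = (x + a * a * y * (b * b)) * a.
Proof.
move=> ab ba; rewrite mulrDr mulrDl !mulrA ab mul1r; congr (_ + _).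
by rewrite -(mulrA _ b a) ba mulr1.
Qed.

Lemma twist_right_words (R : nzRingType) (a b x y : R) : a * b = 1 -> b * a = 1 ->
  (b * x * a + a * y * b) * b = b * (x + a * a * y * (b * b)).
Proof.
move=> ab ba; rewrite mulrDr mulrDl !mulrA ba mul1r; congr (_ + _).
by rewrite -(mulrA _ a b) ab mulr1.
Qed.

(** * Untwisting the antipode axioms *)

Section TwistedAntipode.
Variable k : fieldType.
Hypothesis k0 : [pchar k] =i pred0.
Variables (A : algType k) (v w : A) (q : k).
Variable Delta : {lrmorphism series A -> series (tens 2 A)}.
Variable S : series A -> series A.
Hypotheses (linS : linear S) (S1 : S 1 = 1).
Hypothesis SM : forall x y, S (x * y) = S y * S x.
Local Notation E := (legexp v w).
Local Notation J := (E (- q) 2 1 2).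
Local Notation J' := (E q 2 1 2).
Local Notation pl12 := (smap (@place k A 2 3 [:: 1; 2]%N)).
Local Notation pl23 := (smap (@place k A 2 3 [:: 2; 3]%N)).

(** J Δ(x) J^-1. *)
Definition twisted_cop (x : A) : series (tens 2 A) :=
  cst (leg 2 1 x) + E (- q - q) 2 1 2 * cst (leg 2 2 x) * E (q + q) 2 1 2.

Definition twist_alpha := contr2 S 1 J.
Definition twist_beta := contr2' S 1 J'.

(** Since J Δ(x) = Δ_J(x) J, contracting Δ(x) around α = contr2(J) amounts to contracting Δ_J(x)
    first, which gives 0. *)
Lemma contr2_twist x : twisted_primitive v w q Delta x ->
  contr2 S 1 (twisted_cop x) = 0 -> contr2 S twist_alpha (Delta (cst x)) = 0.
Proof.
move=> Dx Px; rewrite -(contr2M linS SM).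
have -> : J * Delta (cst x) = twisted_cop x * J.
  rewrite Dx /twisted_cop !legexpD //.
  by apply: (@twist_left_words _ J J'); [exact: legexpNK | exact: legexpK].
by rewrite (contr2M linS SM) Px contr2_0.
Qed.

Lemma contr2'_twist x : twisted_primitive v w q Delta x ->
  contr2' S 1 (twisted_cop x) = 0 -> contr2' S twist_beta (Delta (cst x)) = 0.
Proof.
move=> Dx Px; rewrite -(contr2'M linS SM).
have -> : Delta (cst x) * J' = J' * twisted_cop x.
  rewrite Dx /twisted_cop !legexpD //.
  by apply: (@twist_right_words _ J J'); [exact: legexpNK | exact: legexpK].
by rewrite (contr2'M linS SM) Px contr2'_0.
Qed.

Hypotheses (Pv : contr2 S 1 (twisted_cop v) = 0) (Pw : contr2 S 1 (twisted_cop w) = 0).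
Hypotheses (Pv' : contr2' S 1 (twisted_cop v) = 0) (Pw' : contr2' S 1 (twisted_cop w) = 0).

(** The letter w_2 commutes with s_12 = v_1 w_2, so the conjugation acts trivially on it. *)
Lemma twisted_cop_w : twisted_cop w = cst (leg 2 1 w + leg 2 2 w).
Proof.
rewrite cstD /twisted_cop; congr (_ + _).
have -> : E (- q - q) 2 1 2 * cst (leg 2 2 w) = cst (leg 2 2 w) * E (- q - q) 2 1 2.
  rewrite /legexp -sexp_cst sexp_comm // -!cst_mul; congr cst.
  by rewrite -scalerAl -scalerAr; congr (_ *: _); rewrite [RHS]mulrA (leg_comm w v).
by rewrite -mulrA -opprD legexpNK // mulr1.
Qed.

Let p12 : places 2 3 [:: 1; 2]%N. Proof. by []. Qed.
Let p23 : places 2 3 [:: 2; 3]%N. Proof. by []. Qed.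

(** The image of e^{chs} under id⊗Δ_J; [sexp_twisted_v] gives the one under Δ_J⊗id. *)
Lemma sexp_twisted_w c :
  sexp (cst c *: (cst (leg 3 1 v) * pl23 (twisted_cop w))) = E c 3 1 2 * E c 3 1 3.
Proof.
rewrite twisted_cop_w (smap_cst (alg_lin (place_alg p23))).
rewrite (linD (alg_lin (place_alg p23))) !(place_leg _ p23) //= -cst_mul kscaleE.
rewrite -(linZ (@cst_linear k (tens 3 A))) sexp_cst mulrDr scalerDr hexpD //.
by rewrite -!scalerAl -!scalerAr leg_prod_comm.
Qed.

Lemma sexp_twisted_v c :
  sexp (cst c *: (pl12 (twisted_cop v) * cst (leg 3 3 w))) =
  E c 3 1 3 * (E (- q - q) 3 1 2 * E c 3 2 3 * E (q + q) 3 1 2).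
Proof.
have ap := smap_alg (place_alg (A := A) p12).
have -> : pl12 (twisted_cop v) * cst (leg 3 3 w) =
    cst (leg 3 1 v * leg 3 3 w) +
    E (- q - q) 3 1 2 * cst (leg 3 2 v * leg 3 3 w) * E (q + q) 3 1 2.
  rewrite (series_tensD _ _ ap) !(series_tensM _ _ ap) !(smap_cst (alg_lin (place_alg p12))).
  rewrite !(place_leg _ p12) //=.
  rewrite !(place_legexp v w _ p12 (i := 0) (j := 1)) // mulrDl -cst_mul; congr (_ + _).
  by rewrite -mulrA legexp_leg // mulrA -(mulrA (E _ _ _ _)) -cst_mul.
rewrite kscaleE sexp_scale_conj //.
- by rewrite -opprD legexpK.
- by rewrite -opprD legexpNK.
apply: mulr3_comm; try by rewrite legexp_prod.
by rewrite -!cst_mul leg_prod_comm.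
Qed.

Let L := contr3 S 1 1.
Let L' := contr3' S 1 1.

(** In the exponent v_1 commutes with Δ_J(w)^23, which can therefore be moved to the outside, where
    it is absorbed as a contraction of Δ_J(w) and gives 0. The next three lemmas follow the same
    pattern. *)
Lemma contr3_twisted_w c Z :
  L ((sexp (cst c *: (cst (leg 3 1 v) * pl23 (twisted_cop w))) : series (tens 3 A)) * Z) = L Z.
Proof.
apply: sexp_kill_left => [|{}Z]; first exact: contr3_linear.
have -> : cst c *: (cst (leg 3 1 v) * pl23 (twisted_cop w)) * Z =
          pl23 (twisted_cop w) * (cst c *: (cst (leg 3 1 v) * Z)).
  rewrite -scalerAr mulrA -scalerAl; congr (_ *: (_ * _)).
  apply: seriesP => m; rewrite coef_Mcst coef_cstM.
  by rewrite [pl23 _ _]/= place_leg_comm.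
by rewrite /L (contr3_pl23 linS SM) Pw contr3_0r.
Qed.

Lemma contr3_twisted_v c Z :
  L (Z * (sexp (cst c *: (pl12 (twisted_cop v) * cst (leg 3 3 w))) : series (tens 3 A))) = L Z.
Proof.
apply: sexp_kill_right => [|{}Z]; first exact: contr3_linear.
have -> : Z * (cst c *: (pl12 (twisted_cop v) * cst (leg 3 3 w))) =
          (cst c *: (Z * cst (leg 3 3 w))) * pl12 (twisted_cop v).
  rewrite -scalerAr -scalerAl -mulrA; congr (_ *: (_ * _)).
  apply: seriesP => m; rewrite coef_Mcst coef_cstM.
  by rewrite [pl12 _ _]/= place_leg_comm.
by rewrite /L (contr3_pl12 linS SM) Pv' contr3_0l.
Qed.

Lemma contr3'_twisted_v c Z :
  L' ((sexp (cst c *: (pl12 (twisted_cop v) * cst (leg 3 3 w))) : series (tens 3 A)) * Z) = L' Z.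
Proof.
apply: sexp_kill_left => [|{}Z]; first exact: contr3'_linear.
have -> : cst c *: (pl12 (twisted_cop v) * cst (leg 3 3 w)) * Z =
          pl12 (twisted_cop v) * (cst c *: (cst (leg 3 3 w) * Z)).
  by rewrite -scalerAr -scalerAl mulrA.
by rewrite /L' (contr3'_pl12 linS SM) Pv contr3'_0l.
Qed.

Lemma contr3'_twisted_w c Z :
  L' (Z * (sexp (cst c *: (cst (leg 3 1 v) * pl23 (twisted_cop w))) : series (tens 3 A))) = L' Z.
Proof.
apply: sexp_kill_right => [|{}Z]; first exact: contr3'_linear.
have -> : Z * (cst c *: (cst (leg 3 1 v) * pl23 (twisted_cop w))) =
          (cst c *: (Z * cst (leg 3 1 v))) * pl23 (twisted_cop w).
  by rewrite -scalerAr -scalerAl mulrA.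
by rewrite /L' (contr3'_pl23 linS SM) Pw' contr3'_0r.
Qed.

Let pl12E c : pl12 (E c 2 1 2) = E c 3 1 2.
Proof. exact: (place_legexp v w c p12 (i := 0) (j := 1)). Qed.
Let pl23E c : pl23 (E c 2 1 2) = E c 3 2 3.
Proof. exact: (place_legexp v w c p23 (i := 0) (j := 1)). Qed.

Definition assoc3_inv : series (tens 3 A) :=
  E (- q) 3 1 2 * E q 3 2 3 * E q 3 1 2 * E (- q) 3 2 3.

Lemma assoc3K : assoc3 v w q * assoc3_inv = 1 /\ assoc3_inv * assoc3 v w q = 1.
Proof.
have H (R : nzRingType) (a a' b b' : R) : a * a' = 1 -> b * b' = 1 ->
    b' * b = 1 -> a' * a = 1 -> b' * a * b * a' * (a * b' * a' * b) = 1.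
  move=> aa bb b'b a'a; rewrite -!mulrA (mulrA a') a'a mul1r (mulrA b) bb mul1r.
  by rewrite (mulrA a) aa mul1r.
have H' (R : nzRingType) (a a' b b' : R) : a * a' = 1 -> b * b' = 1 ->
    b' * b = 1 -> a' * a = 1 -> a * b' * a' * b * (b' * a * b * a') = 1.
  move=> aa bb b'b a'a; rewrite -!mulrA (mulrA b) bb mul1r (mulrA a') a'a mul1r.
  by rewrite (mulrA b') b'b mul1r.
split.
  by apply: (H _ (E (- q) 3 1 2) (E q 3 1 2) (E (- q) 3 2 3) (E q 3 2 3));
     [exact: legexpNK | exact: legexpNK | exact: legexpK | exact: legexpK].
by apply: (H' _ (E (- q) 3 1 2) (E q 3 1 2) (E (- q) 3 2 3) (E q 3 2 3));
   [exact: legexpNK | exact: legexpNK | exact: legexpK | exact: legexpK].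
Qed.

(** Absorbing α and β multiplies Φ by J^23 on the left and by (J^12)^-1 on the right. The result
    J^12 J^23 (J^12)^-2 is (id⊗Δ_J)(J^-1) times (Δ_J⊗id)(J), the factors in leg pair 13 cancelling,
    and both contract to 1. *)
Lemma contr3_assoc3 : contr3 S twist_beta twist_alpha (assoc3 v w q) = 1.
Proof.
rewrite -(contr3_pl23 linS SM) -(contr3_pl12 linS SM) pl12E pl23E -/L.
have -> : E (- q) 3 2 3 * assoc3 v w q * E q 3 1 2 =
    (sexp (cst q *: (cst (leg 3 1 v) * pl23 (twisted_cop w))) : series (tens 3 A)) *
    (* The factor 1 is the remaining tensor [Z] on which the two killing lemmas end. *)
    (1 * (sexp (cst (- q) *: (pl12 (twisted_cop v) * cst (leg 3 3 w))) : series (tens 3 A))).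
  rewrite (sexp_twisted_w q) (sexp_twisted_v (- q)) mul1r !(legexpD k0) /assoc3.
  have H (R : nzRingType) (a a' b b' c c' : R) : a' * a = 1 -> b * b' = 1 ->
      c' * c = 1 -> b * (b' * a * b * a') * a' = a' * c' * (c * (a * a * b * (a' * a'))).
    move=> aa bb cc; rewrite -!mulrA (mulrA c') cc mul1r (mulrA b) bb mul1r.
    by rewrite (mulrA a' a) aa mul1r.
  by apply: (H _ (E (- q) 3 1 2) (E q 3 1 2) (E (- q) 3 2 3) (E q 3 2 3)
    (E (- q) 3 1 3) (E q 3 1 3)); [exact: legexpK | exact: legexpNK | exact: legexpK].
by rewrite contr3_twisted_w contr3_twisted_v; apply: contr3_1.
Qed.

(** As for Φ, with (Δ_J⊗id)(J^-1) now on the left of (id⊗Δ_J)(J); the two factors in leg pair 13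
    stand at the ends and meet only after commuting through the word. *)
Lemma contr3'_assoc3 : contr3' S twist_alpha twist_beta assoc3_inv = 1.
Proof.
rewrite -(contr3'_pl12 linS SM) -(contr3'_pl23 linS SM) pl12E pl23E -/L'.
have -> : E (- q) 3 1 2 * assoc3_inv * E q 3 2 3 =
    (sexp (cst q *: (pl12 (twisted_cop v) * cst (leg 3 3 w))) : series (tens 3 A)) *
    (1 * (sexp (cst (- q) *: (cst (leg 3 1 v) * pl23 (twisted_cop w))) : series (tens 3 A))).
  rewrite (sexp_twisted_v q) (sexp_twisted_w (- q)).
  rewrite mul1r.
  rewrite !(legexpD k0).
  rewrite /assoc3_inv.
  have H (R : nzRingType) (a a' b b' c c' : R) : a' * a = 1 -> b * b' = 1 ->
      c' * c = 1 -> c * a = a * c -> c * a' = a' * c -> c * b' = b' * c ->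
      a * (a * b' * a' * b) * b' = c' * (a * a * b' * (a' * a')) * (a * c).
    move=> aa bb cc ca ca' cb; rewrite -!mulrA bb mulr1 (mulrA a' a) aa mul1r.
    rewrite -ca' (mulrA b') -cb -!mulrA.
    have caz z : a * (c * z) = c * (a * z) by rewrite !mulrA ca.
    by rewrite !caz (mulrA c') cc mul1r.
  by apply: (H _ (E (- q) 3 1 2) (E q 3 1 2) (E (- q) 3 2 3) (E q 3 2 3)
    (E (- q) 3 1 3) (E q 3 1 3)); [exact: legexpK | exact: legexpNK | exact: legexpK
    | exact: legexp_comm | exact: legexp_comm | exact: legexp_comm].
by rewrite contr3'_twisted_v contr3'_twisted_w; apply: contr3'_1.
Qed.
End TwistedAntipode.

Section ConjExpLegs.
Variable k : fieldType.

Lemma hexp_mul_coef (B : algType k) (p u : B) n :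
  p * u = u * p -> hexp (p * u) n = p ^+ n * hexp u n.
Proof. by move=> pu; rewrite /= exprMn_comm // scalerAr. Qed.

(** Used with p = v⊗1, u = 1⊗w and z = 1⊗x; it separates the powers of v from the iterated
    commutators with w. *)
Lemma conjexp_mul_coef (B : algType k) (p u z : B) n :
  p * u = u * p -> p * z = z * p ->
  conjexp (p * u) z n = p ^+ n * conjexp u z n.
Proof.
move=> pu pz; rewrite !conjexp_coef mulr_sumr; apply: eq_bigr => i _.
have le_in : (i <= n)%N by rewrite -ltnS.
have pNu : p * (- u) = - u * p by rewrite mulrN mulNr pu.
rewrite -mulrN !hexp_mul_coef //.
have pz' : hexp (- u) i * z * p ^+ (n - i) = p ^+ (n - i) * (hexp (- u) i * z).
  have pX : p * (- u) ^+ i = (- u) ^+ i * p by apply: commrX.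
  apply: commrX; apply: esym.
  by rewrite /= -!scalerAl -scalerAr mulrA pX -(mulrA _ p) pz mulrA.
have pn : p ^+ n = p ^+ i * p ^+ (n - i) by rewrite -exprD subnKC.
rewrite pn; transitivity (p ^+ i * (hexp (- u) i * z * p ^+ (n - i)) * hexp u (n - i)%N).
  by rewrite !mulrA.
by rewrite pz' !mulrA.
Qed.
End ConjExpLegs.

Section TalgExt.
Variables (k : comNzRingType) (V : lmodType k) (B : algType k).
Lemma talg_morph_ext (f g : talg V -> B) : is_alg_morph f -> is_alg_morph g ->
  (forall x, f (talg_gen x) = g (talg_gen x)) -> f =1 g.
Proof.
move=> mf mg fg; apply: talg_ind => [//||x y fx fy|c x fx|x y fx fy].
- by rewrite (alg1 mf) (alg1 mg).
- by rewrite (linD (alg_lin mf)) fx fy (linD (alg_lin mg)).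
- by rewrite (linZ (alg_lin mf)) fx (linZ (alg_lin mg)).
by rewrite (algM mf) fx fy (algM mg).
Qed.
End TalgExt.

Section ExtendScalars.
Variables (k : comNzRingType) (A B : algType k) (S0 : A -> kser B).
Hypothesis mS : is_antimorph S0.
Definition ext_scalars (X : series A) : series B := hsum (smap S0 X).

Let lS : linear S0. Proof. by case: mS. Qed.

Lemma ext_scalars_linear : linear ext_scalars.
Proof. by move=> c X Y; rewrite /ext_scalars (smap_linear lS) -hsumZ -hsumD. Qed.

Lemma ext_scalars_cst x : ext_scalars (cst x) = S0 x.
Proof. by rewrite /ext_scalars smap_cst // hsum_head. Qed.

Lemma ext_scalars1 : ext_scalars 1 = 1.
Proof. by rewrite [X in ext_scalars X](_ : _ = cst 1) // ext_scalars_cst; case: mS. Qed.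

Lemma ext_scalarsM X Y : ext_scalars (X * Y) = ext_scalars Y * ext_scalars X.
Proof.
rewrite /ext_scalars -hsumM; apply: eq_hsum => n.
rewrite coefM /= (lin_sum lS) [RHS](reindex_inj rev_ord_inj) /=.
apply: eq_bigr => i _; rewrite subSS subKn; last by rewrite -ltnS.
by case: mS.
Qed.
End ExtendScalars.

(** * The antipode of the twisted bialgebra *)

Section TalgAntipode.
Variable k : fieldType.
Hypothesis k0 : [pchar k] =i pred0.
Variables (V : lmodType k) (v w : V).
Local Notation A := (talg V).
Local Notation gen := (@talg_gen k V).
Variable y : series A.
Hypothesis y_def : nord (gen w) (cst (gen v)) y = - cst (gen v).

Lemma exists_antimorph : exists S0 : A -> kser A, is_antimorph S0 /\
  forall x, S0 (gen x) = - nord (gen w) y (cst (gen x)).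
Proof.
apply: (@talg_antimorph k V (kser A) (fun x => - nord (gen w) y (cst (gen x)))).
move=> c a b; rewrite linearP (@cst_linear k A) -kscaleE nord_linear opprD -scalerN.
by rewrite kscaleE.
Qed.

Variable S0 : A -> kser A.
Hypothesis mS : is_antimorph S0.
Hypothesis S0g : forall x, S0 (gen x) = - nord (gen w) y (cst (gen x)).
Local Notation S := (ext_scalars S0).

Let linS : linear S. Proof. exact: ext_scalars_linear. Qed.
Let SM X Y : S (X * Y) = S Y * S X. Proof. exact: ext_scalarsM. Qed.
Let S1 : S 1 = 1. Proof. exact: ext_scalars1. Qed.

Lemma antipode_gen x : S (cst (gen x)) = - nord (gen w) y (cst (gen x)).
Proof. by rewrite ext_scalars_cst // S0g. Qed.

Lemma antipode_w : S (cst (gen w)) = - cst (gen w).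
Proof.
rewrite antipode_gen; congr (- _); rewrite /nord hsum_head ?divad_self ?mul1r //.
by move=> n; rewrite divad_self // mulr0.
Qed.

(** S is defined through y, and the left antipode axiom needs y to be S(v). Both have the image -v
    under N_v, by [nordK] and [y_def], and N_v is injective. *)
Lemma antipode_v : S (cst (gen v)) = y.
Proof.
rewrite antipode_gen; apply: (bij_inj (nord_bij (gen w) (cst (gen v)))).
by rewrite (linN (nord_linear _ _)) nordK ?y_def.
Qed.

Lemma antipodeX X n : S (X ^+ n) = S X ^+ n.
Proof. by elim: n => [|n IH]; rewrite ?S1 // exprS SM IH exprSr. Qed.

(** As S(w) = -w, the antimorphism S exchanges the exponentials of w and -w as well as the two sides
    of the conjugation. *)
Lemma antipode_divad n X : S (divad (gen w) n X) = divad (gen w) n (S X).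
Proof.
have Sh u u' m : S (cst u) = cst u' -> S (cst (hexp u m)) = cst (hexp u' m).
  move=> Su; rewrite /= !(linZ (@cst_linear k A)) -!kscaleE (linZ linS).
  by rewrite !(algX (@cst_alg k A)) antipodeX Su.
have Sw : S (cst (gen w)) = cst (- gen w) by rewrite antipode_w cstN.
have SNw : S (cst (- gen w)) = cst (gen w) by rewrite cstN (linN linS) antipode_w opprK.
rewrite /divad (lin_sum linS) [RHS](reindex_inj rev_ord_inj).
apply: eq_bigr => i _; rewrite [nat_of_ord (rev_ord i)]/= subSS subKn; last by rewrite -ltnS.
by rewrite !SM (Sh _ _ _ Sw) (Sh _ _ _ SNw) mulrA.
Qed.

(** Mod h, S is the antiautomorphism of T(V) with x ↦ -x on V, which is an involution. *)
Lemma antipode_unit_mod_h X : S (S X) 0%N = X 0%N.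
Proof.
pose s a : A := S0 a 0%N.
have S_0 Z : S Z 0%N = s (Z 0%N) by rewrite /ext_scalars coef_hsum big_ord1.
rewrite !S_0; move: (X 0%N) => {X}.
have [lS0 S01 S0M] := mS.
have sM a b : s (a * b) = s b * s a by rewrite /s S0M coefM big_ord1.
have sD a b : s (a + b) = s a + s b by rewrite /s (linD lS0).
have sZ c a : s (c *: a) = c *: s a by rewrite /s (linZ lS0).
apply: talg_ind => [x||a b sa sb|c a sa|a b sa sb].
- have sg z : s (gen z) = - gen z.
    by rewrite /s S0g coefN /nord coef_hsum big_ord1 divad0 mul1r.
  have sN a : s (- a) = - s a by rewrite /s (linN lS0).
  by rewrite sg sN sg opprK.
- by rewrite /s !S01.
- by rewrite !sD sa sb.
- by rewrite !sZ sa.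
by rewrite !sM sa sb.
Qed.

(** S itself is not the identity mod h, but its square is, so the square is bijective, hence S
    too. *)
Lemma antipode_bijective : bijective S.
Proof.
have linSS : linear (fun X => S (S X)) by move=> c a b; rewrite !linS.
have [G SSK KSS] := linear_unipotent_bij linSS antipode_unit_mod_h.
have injS : injective S by move=> a b /(congr1 S) /(congr1 G); rewrite !SSK.
exists (S \o G) => X /=; last exact: KSS.
by apply: injS; rewrite KSS.
Qed.

Variable q : k.
Hypothesis qq : q + q = 1.
Local Notation cop x := (twisted_cop (gen v) (gen w) q (gen x)).

(** The factor e^{-2qhs} is e^{-hs} because 2q = 1; hence these coefficients match the summands of
    [nord], without extra scalars. *)
Lemma twisted_cop_coef x n :
  (legexp (gen v) (gen w) (- q - q) 2 1 2 * cst (leg 2 2 (gen x)) *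
   legexp (gen v) (gen w) (q + q) 2 1 2) n =
  pure [ffun i : 'I_2 => if i == 0 then gen v ^+ n else conjexp (gen w) (gen x) n].
Proof.
rewrite -opprD qq /legexp scaleN1r scale1r -/(conjexp _ _).
rewrite conjexp_mul_coef; [|exact: leg_comm|exact: leg_comm].
have l1 : is_alg_morph (leg 2 1 : A -> tens 2 A) by apply: leg_alg.
have l2 : is_alg_morph (leg 2 2 : A -> tens 2 A) by apply: leg_alg.
have -> : conjexp (leg 2 2 (gen w)) (leg 2 2 (gen x)) n =
          leg 2 2 (conjexp (gen w) (gen x) n) :> tens 2 A.
  by rewrite -(smap_conjexp _ _ l2).
by rewrite -(algX l1) -tens2E.
Qed.

(** The contraction is S(x) + N_{S(v)}(x) with S(v) = y, and S(x) was chosen as -N_y(x). *)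
Lemma contr2_twisted_cop x : contr2 S 1 (cop x) = 0.
Proof.
rewrite /twisted_cop (linD (contr2_linear linS 1)).
set X := _ * _ * _.
rewrite -[X]hsum_cst (hsum_linear _ (contr2_linear linS 1)).
have -> : hsum (fun n => contr2 S 1 (cst (X n))) = nord (gen w) y (cst (gen x)) :> series A.
  apply: eq_hsum => n; rewrite twisted_cop_coef contr2_pure // !ffunE /= mulr1.
  by rewrite (algX (@cst_alg k A)) antipodeX antipode_v divad_cst.
rewrite /leg contr2_pure // !ffunE /= !mulr1 antipode_gen.
by rewrite addNr.
Qed.

(** Since S commutes with [divad], the contraction is x + N_v(S(x)) = x - N_v(N_y(x)), which
    vanishes by [nordK]. *)
Lemma contr2'_twisted_cop x : contr2' S 1 (cop x) = 0.
Proof.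
rewrite /twisted_cop (linD (contr2'_linear linS 1)).
set X := _ * _ * _.
rewrite -[X]hsum_cst (hsum_linear _ (contr2'_linear linS 1)).
have -> : hsum (fun n => contr2' S 1 (cst (X n))) =
          nord (gen w) (cst (gen v)) (S (cst (gen x))) :> series A.
  apply: eq_hsum => n; rewrite twisted_cop_coef contr2'_pure // !ffunE /= mulr1.
  by rewrite (algX (@cst_alg k A)) -antipode_divad divad_cst.
rewrite /leg contr2'_pure // !ffunE /= mulr1 S1 mulr1 antipode_gen.
by rewrite (linN (nord_linear _ _)) nordK // subrr.
Qed.
End TalgAntipode.

Lemma eq_hlift (k : comNzRingType) n (M W : lmodType k)
    (F G : {ffun 'I_n -> M} -> series W) X : F =1 G -> hlift F X = hlift G X.
Proof.
move=> FG; apply: seriesP => m; apply: eq_bigr => i _; apply: eq_bigr => p _.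
by rewrite FG.
Qed.

(** * Counit and antipode axioms on T(V) *)

Section QuasiHopfTalg.
Variable k : fieldType.
Hypothesis k0 : [pchar k] =i pred0.
Variables (V : lmodType k) (v w : V) (q : k).
Hypothesis qq : q + q = 1.
Local Notation A := (talg V).
Local Notation gen := (@talg_gen k V).
Variable Delta : {lrmorphism series A -> series (tens 2 A)}.
Variable eps : {lrmorphism series A -> (series k)^o}.
Hypothesis Dg : forall x, twisted_primitive (gen v) (gen w) q Delta (gen x).
Hypothesis eps_gen : forall x, eps (cst (gen x)) = 0.
Local Notation E := (legexp (gen v) (gen w)).
Local Notation Phi := (assoc3 (gen v) (gen w) q).

Let kcst : A -> kser A := @cst A.
(** The counit composed with the unit of A[[h]]: as a morphism into an algebra it can be paired with
    others, and its central values commute with everything. *)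
Let keps (x : A) : kser A := (eps (cst x) : series k) *: (1 : series A).

Lemma keps_alg : is_alg_morph keps.
Proof.
rewrite /keps; split=> [c x y||x y].
- rewrite (@cst_linear k A) -kscaleE linearP scalerDl -scalerA.
  by rewrite -!kscaleE.
- by rewrite [X in eps X](_ : _ = 1) // rmorph1 scale1r.
have H (c d : series k) : (c * d) *: (1 : series A) = (c *: 1) * (d *: 1).
  by rewrite -scalerAl mul1r scalerA.
by rewrite cst_mul rmorphM; apply: H.
Qed.

Lemma keps_gen x : keps (gen x) = 0.
Proof. by rewrite /keps eps_gen scale0r. Qed.

Lemma scale1_comm (B : algType k) (c : series k) (X : series B) :
  X * (c *: 1) = (c *: 1) * X.
Proof. by rewrite -scalerAl -scalerAr mulr1 mul1r. Qed.

Lemma keps_commr f : commuting f keps.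
Proof. by move=> x y; apply: scale1_comm. Qed.
Lemma keps_comml f : commuting keps f.
Proof. by move=> x y; apply/esym/scale1_comm. Qed.

Lemma kcst_alg : is_alg_morph kcst. Proof. exact: cst_alg. Qed.

(** X ↦ G(Δ(X)) is an algebra morphism, so generators suffice, and there G sends the conjugating
    factors J and J^-1 to 1. *)
Lemma counit_ext (G : series (tens 2 A) -> series A) : is_alg_morph G ->
  (forall c, G (E c 2 1 2) = 1) ->
  (forall x, G (cst (leg 2 1 (gen x))) + G (cst (leg 2 2 (gen x))) = cst (gen x)) ->
  forall X, G (Delta X) = X.
Proof.
move=> aG GE Gg; apply: linear_series_ext => [||x].
- by move=> c x y; rewrite linearP (alg_lin aG).
- by move=> c x y.
have aD := D_alg Delta.
move: x; apply: (talg_morph_ext (f := fun x => G (Delta (cst x)) : kser A)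
   (g := fun x => cst x : kser A)) => [||x].
- split=> [c x y||x y].
  + by rewrite (alg_lin aD) -kscaleE (linD (alg_lin aG)) (linZ (alg_lin aG)) kscaleE.
  + by rewrite (alg1 aD) (alg1 aG).
  by rewrite (algM aD) (algM aG).
- exact: kcst_alg.
by rewrite Dg (linD (alg_lin aG)) !(algM aG) !GE !mulr1 !mul1r Gg.
Qed.

Lemma counitl X :
  hlift (fun a : {ffun 'I_2 -> A} => (eps (cst (a 0)) : series k) *: cst (a 1))
    (Delta X) = X.
Proof.
pose G : series (tens 2 A) -> series A := hlift (pairF keps kcst : _ -> series A).
transitivity (G (Delta X)).
  apply: eq_hlift => a.
  rewrite /pairF -[keps _ * _]/(((eps (cst (a 0)) : series k) *: 1 : series A) * (cst (a 1))).
  by rewrite -scalerAl mul1r.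
apply: counit_ext => [|c|x].
- by apply: hpair_alg; [exact: keps_alg | exact: kcst_alg | exact: keps_comml].
- rewrite /G hpair_legexp; [|exact: keps_alg | exact: kcst_alg | exact: keps_comml].
  by rewrite keps_gen mul0r scaler0 sexp0.
rewrite /G hpair_leg1 ?hpair_leg2; try exact: keps_alg; try exact: kcst_alg.
by rewrite keps_gen add0r.
Qed.

Lemma counitr X :
  hlift (fun a : {ffun 'I_2 -> A} => (eps (cst (a 1)) : series k) *: cst (a 0))
    (Delta X) = X.
Proof.
pose G : series (tens 2 A) -> series A := hlift (pairF kcst keps : _ -> series A).
transitivity (G (Delta X)).
  apply: eq_hlift => a.
  rewrite /pairF -[_ * keps _]/((cst (a 0) : series A) * ((eps (cst (a 1)) : series k) *: 1)).
  by rewrite -scalerAr mulr1.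
apply: counit_ext => [|c|x].
- by apply: hpair_alg; [exact: kcst_alg | exact: keps_alg | exact: keps_commr].
- rewrite /G hpair_legexp; [|exact: kcst_alg | exact: keps_alg | exact: keps_commr].
  by rewrite keps_gen mulr0 scaler0 sexp0.
rewrite /G hpair_leg1 ?hpair_leg2; try exact: keps_alg; try exact: kcst_alg.
by rewrite keps_gen addr0.
Qed.

(** Both s_12 and s_23 have a letter in the second leg, so applying ε there sends each of the four
    exponentials to 1. *)
Lemma counit_assoc3 :
  hlift (fun a : {ffun 'I_3 -> A} =>
    (eps (cst (a 1)) : series k) *: cst (tens2 (a 0) (a 2%:R))) Phi = 1.
Proof.
pose l1 : A -> kser (tens 2 A) := hleg 2 1.
pose l2 : A -> kser (tens 2 A) := hleg 2 2.
pose e (x : A) : kser (tens 2 A) := (eps (cst x) : series k) *: (1 : series (tens 2 A)).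
have ae : is_alg_morph e.
  rewrite /e; split=> [c x y||x y].
  - rewrite (@cst_linear k A) -kscaleE linearP scalerDl -scalerA.
    by rewrite -!kscaleE.
  - by rewrite [X in eps X](_ : _ = 1) // rmorph1 scale1r.
  have H (c d : series k) : (c * d) *: (1 : series (tens 2 A)) = (c *: 1) * (d *: 1).
    by rewrite -scalerAl mul1r scalerA.
  by rewrite cst_mul rmorphM; apply: H.
have eg x : e (gen x) = 0 by rewrite /e eps_gen scale0r.
have al1 : is_alg_morph l1 by apply: hleg_alg.
have al2 : is_alg_morph l2 by apply: hleg_alg.
have c1 : commuting l1 e by move=> x y; apply: scale1_comm.
have c2 : commuting e l2 by move=> x y; apply/esym/scale1_comm.
have c3 : commuting l1 l2 by apply: hleg_comm.
pose G : series (tens 3 A) -> series (tens 2 A) := hlift (tripleF l1 e l2 : _ -> series _).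
transitivity (G Phi).
  apply: eq_hlift => a; rewrite /tripleF tens2E cst_mul.
  have H (c : series k) (X Y : series (tens 2 A)) : c *: (X * Y) = X * (c *: 1) * Y.
    by rewrite -scalerAr mulr1 scalerAl.
  exact: H.
have aG : is_alg_morph G by apply: htriple_alg.
have G12 c : G (E c 3 1 2) = 1.
  by rewrite /G htriple_legexp12 // eg mulr0 scaler0 sexp0.
have G23 c : G (E c 3 2 3) = 1.
  by rewrite /G htriple_legexp23 // eg mul0r scaler0 sexp0.
by rewrite /assoc3 3!(series_tensM _ _ aG) G23 G12 G23 G12 !mulr1.
Qed.

Section Antipode.
Variables (S : series A -> series A) (a b : series A).
Hypothesis (linS : linear S) (S1 : S 1 = 1).
Hypothesis SM : forall x y, S (x * y) = S y * S x.
Hypothesis Sa : forall x, contr2 S a (Delta (cst (gen x))) = 0.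
Hypothesis Sb : forall x, contr2' S b (Delta (cst (gen x))) = 0.

(** The identity passes to products: by [contr2M] the left factor contracts first and leaves the
    scalar ε(x) times [a], to which the identity for the right factor applies. *)
Lemma antipode_left X : contr2 S a (Delta X) = (eps X : series k) *: a.
Proof.
have lc := contr2_linear linS a.
move: X; apply: linear_series_ext => [c x y|c x y|x].
- by rewrite linearP lc.
- by rewrite linearP scalerDl scalerA.
move: x; apply: talg_ind => [x||x y hx hy|c x hx|x y hx hy].
- by rewrite Sa eps_gen scale0r.
- rewrite -[cst 1]/(1 : series A) !rmorph1 scale1r.
  rewrite -[1]/(cst (pure [ffun=> 1]) : series (tens 2 A)) contr2_pure // !ffunE.
  by rewrite -[cst 1]/(1 : series A) S1 mul1r mulr1.
- by rewrite cstD !rmorphD (linD lc) hx hy scalerDl.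
- rewrite (linZ (@cst_linear k A)) -kscaleE !linearZ (linZ lc) hx.
  by rewrite scalerA.
rewrite cst_mul !rmorphM (contr2M linS SM) hx contr2Z // hy scalerA.
by rewrite mulrC.
Qed.

Lemma antipode_right X : contr2' S b (Delta X) = (eps X : series k) *: b.
Proof.
have lc := contr2'_linear linS b.
move: X; apply: linear_series_ext => [c x y|c x y|x].
- by rewrite linearP lc.
- by rewrite linearP scalerDl scalerA.
move: x; apply: talg_ind => [x||x y hx hy|c x hx|x y hx hy].
- by rewrite Sb eps_gen scale0r.
- rewrite -[cst 1]/(1 : series A) !rmorph1 scale1r.
  rewrite -[1]/(cst (pure [ffun=> 1]) : series (tens 2 A)) contr2'_pure // !ffunE.
  by rewrite -[cst 1]/(1 : series A) S1 mul1r mulr1.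
- by rewrite cstD !rmorphD (linD lc) hx hy scalerDl.
- rewrite (linZ (@cst_linear k A)) -kscaleE !linearZ (linZ lc) hx.
  by rewrite scalerA.
by rewrite cst_mul !rmorphM (contr2'M linS SM) hy contr2'Z // hx scalerA mulrC.
Qed.
End Antipode.
End QuasiHopfTalg.

Lemma intertwine_mul (R : nzRingType) (z a b c d : R) :
  a * z = z * b -> c * z = z * d -> (a * c) * z = z * (b * d).
Proof. by move=> az cz; rewrite -mulrA cz mulrA az mulrA. Qed.

Section QuasiHopfMain.
Variable k : fieldType.
Hypothesis k0 : [pchar k] =i pred0.
Variables (V : lmodType k) (v w : V) (q : k).
Hypothesis qq : q + q = 1.
Local Notation A := (talg V).
Local Notation gen := (@talg_gen k V).
Variable Delta : {lrmorphism series A -> series (tens 2 A)}.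
Variable eps : {lrmorphism series A -> (series k)^o}.
Hypothesis Dg : forall x, twisted_primitive (gen v) (gen w) q Delta (gen x).
Hypothesis eps_gen : forall x, eps (cst (gen x)) = 0.
Local Notation Phi := (assoc3 (gen v) (gen w) q).

Lemma coassoc X : id_Delta Delta (Delta X) * Phi = Phi * Delta_id Delta (Delta X).
Proof.
have ar := id_Delta_alg Delta; have al := Delta_id_alg Delta.
move: X; apply: linear_series_ext => [c x y|c x y|x].
- by rewrite linearP (alg_lin ar) mulrDl -scalerAl.
- by rewrite linearP (alg_lin al) mulrDr -scalerAr.
move: x; apply: talg_ind => [x||x y hx hy|c x hx|x y hx hy].
- exact: (coassoc_gen k0 (Dg v) (Dg w) (Dg x)).
- by rewrite -[cst 1]/(1 : series A) rmorph1 (alg1 ar) (alg1 al) mul1r mulr1.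
- by rewrite cstD rmorphD (linD (alg_lin ar)) (linD (alg_lin al)) mulrDl mulrDr hx hy.
- rewrite (linZ (@cst_linear k A)) -kscaleE linearZ (linZ (alg_lin ar)) (linZ (alg_lin al)).
  by rewrite -scalerAl hx scalerAr.
rewrite cst_mul rmorphM (series_tensM _ _ ar) (series_tensM _ _ al).
exact: (intertwine_mul hx hy).
Qed.

Lemma quasi_antipode_exists : exists S alpha beta,
  quasi_antipode Delta eps Phi (assoc3_inv (gen v) (gen w) q) S alpha beta.
Proof.
have [G NG GN] := nord_bij (gen w) (cst (gen v)).
(* Solves N_v(y) = -v by inverting N_v. *)
pose y := G (- cst (gen v)).
have y_def : nord (gen w) (cst (gen v)) y = - cst (gen v) by rewrite GN.
have [S0 [mS S0g]] := exists_antimorph w y.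
pose S := ext_scalars S0.
have linS : linear S by exact: ext_scalars_linear.
have SM X Y : S (X * Y) = S Y * S X by exact: ext_scalarsM.
have S1 : S 1 = 1 by exact: ext_scalars1.
pose S' : {linear series A -> series A} :=
  HB.pack S (GRing.isLinear.Build (series k) (series A) (series A) *:%R S linS).
have Pl x : contr2 S 1 (twisted_cop (gen v) (gen w) q (gen x)) = 0.
  exact: contr2_twisted_cop.
have Pr x : contr2' S 1 (twisted_cop (gen v) (gen w) q (gen x)) = 0.
  exact: contr2'_twisted_cop.
exists S', (twist_alpha (gen v) (gen w) q S), (twist_beta (gen v) (gen w) q S); split.
- exact: (antipode_bijective mS S0g).
- exact: S1.
- exact: SM.
- apply: (antipode_left eps_gen linS S1 SM) => x.
  exact: contr2_twist.
- apply: (antipode_right eps_gen linS S1 SM) => x.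
  exact: contr2'_twist.
- exact: contr3_assoc3.
exact: contr3'_assoc3.
Qed.

Lemma twisted_quasi_hopf : quasi_hopf Delta eps Phi.
Proof.
split.
- exact: coassoc.
- exact: (counitl Dg eps_gen).
- exact: (counitr Dg eps_gen).
- exact: (counit_assoc3 _ _ _ eps_gen).
- exact: (pentagon k0 (Dg v) (Dg w)).
have [PQ QP] := assoc3K k0 (gen v) (gen w) q.
by exists (assoc3_inv (gen v) (gen w) q); split; last exact: quasi_antipode_exists.
Qed.
End QuasiHopfMain.

(** * Low-order terms *)

Section LowCoefficients.
Variable B : nzRingType.
Implicit Types X Y : series B.
Lemma coefM0 X Y : (X * Y) 0%N = X 0%N * Y 0%N.
Proof. by rewrite coefM big_ord1. Qed.
Lemma coefM1 X Y : (X * Y) 1%N = X 0%N * Y 1%N + X 1%N * Y 0%N.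
Proof. by rewrite coefM !big_ord_recl big_ord0 addr0. Qed.
Lemma coefM2 X Y :
  (X * Y) 2%N = X 0%N * Y 2%N + X 1%N * Y 1%N + X 2%N * Y 0%N.
Proof. by rewrite coefM !big_ord_recl big_ord0 addr0 addrA. Qed.
End LowCoefficients.

Lemma hexp_coef0 (k : fieldType) (B : algType k) (a : B) : hexp a 0%N = 1.
Proof. by rewrite /= invr1 scale1r. Qed.
Lemma hexp_coef1 (k : fieldType) (B : algType k) (a : B) : hexp a 1%N = a.
Proof. by rewrite /= invr1 scale1r. Qed.

Section GroupCommutator.
Variables (k : fieldType) (B : algType k) (P Q : B).
Hypothesis k0 : [pchar k] =i pred0.
Let X := hexp Q * hexp (- P) * hexp (- Q) * hexp P.

(* X - 1 = [hexp Q, hexp (- P)] * hexp (- Q) * hexp P, and that commutator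
   starts in degree 2. *)
Lemma group_commutator_coef :
  [/\ X 0%N = 1, X 1%N = 0 & X 2%N = comm P Q].
Proof.
pose D := hexp Q * hexp (- P) - hexp (- P) * hexp Q.
have XD : X = 1 + D * (hexp (- Q) * hexp P).
  rewrite /D mulrBl (mulrA (hexp (- P) * _)) -(mulrA (hexp (- P))) hexp_mulN //.
  by rewrite mulr1 hexpNK // addrC subrK /X !mulrA.
have D0 : D 0%N = 0 by rewrite /D coefD coefN !coefM0 !hexp_coef0 subrr.
have D1 : D 1%N = 0.
  rewrite /D coefD coefN !coefM1 !hexp_coef0 !hexp_coef1 !mul1r !mulr1.
  by rewrite [Q + _]addrC subrr.
have D2 : D 2%N = comm P Q.
  rewrite /D coefD coefN !coefM2 !hexp_coef0 !hexp_coef1 !mul1r !mulr1.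
  move: (hexp Q _) (hexp _ _) => y x.
  rewrite /comm mulrN mulNr; move: (P * Q) (Q * P) => pq qp.
  have -> : x - qp + y = - qp + (x + y) by rewrite [x - qp]addrC addrA.
  have -> : y - pq + x = - pq + (x + y) by rewrite [y - pq]addrC -addrA [y + x]addrC.
  by rewrite opprD addrACA subrr addr0 opprK addrC.
rewrite XD !coefD coefM0 coefM1 coefM2 D0 D1 D2 coefM0 !hexp_coef0 !mulr1 !mul0r.
by split; [exact: addr0 | rewrite !addr0 | by rewrite !add0r].
Qed.
End GroupCommutator.

(** * The alternation of Φ in degree two *)

Section Sum3.
Let t01 : 'S_3 := tperm 0 1.
Let t02 : 'S_3 := tperm 0 2%:R.
Let t12 : 'S_3 := tperm 1 2%:R.

Lemma sum_S3 (M : zmodType) (F : 'S_3 -> M) :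
  \sum_s F s = F 1%g + F t01 + F t02 + F t12 + F (t01 * t12)%g + F (t12 * t01)%g.
Proof.
pose r := [:: 1%g; t01; t02; t12; (t01 * t12)%g; (t12 * t01)%g].
have ur : uniq r.
  (* The images of 0 and 1 already tell the six listed permutations apart; by counting they exhaust
     S_3. *)
  pose f (s : 'S_3) : nat * nat := (s 0 : nat, s 1 : nat).
  by apply: (@map_uniq _ _ f); rewrite /f /= !permM !perm1 !permE /=.
have rE : perm_eq (index_enum 'S_3) r.
  rewrite perm_sym; apply: uniq_perm => //; first exact: index_enum_uniq.
  apply: (uniq_min_size ur _ _).2 => [s _|]; first exact: mem_index_enum.
  by rewrite -sum1_size sum1_card card_Sn.
by rewrite (perm_big _ rE) /= !big_cons big_nil addr0 !addrA.
Qed.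

Variables (k : comNzRingType) (M : lmodType k).
Implicit Types x y z : M.

Definition tens3 x y z : tens 3 M :=
  pure [ffun i : 'I_3 => if i == 0 then x else if i == 1 then y else z].

Lemma tens3_pure (a : {ffun 'I_3 -> M}) : pure a = tens3 (a 0) (a 1) (a 2%:R).
Proof.
congr pure; apply/ffunP => i; rewrite !ffunE.
by case: i => -[|[|[|//]]] i /=; congr (a _); apply: val_inj.
Qed.

Lemma tens3_upd (x y z : M) :
  [/\ forall u, tens3 u y z = pure (upd [ffun i : 'I_3 =>
         if i == 0 then x else if i == 1 then y else z] 0 u),
       forall u, tens3 x u z = pure (upd [ffun i : 'I_3 =>
         if i == 0 then x else if i == 1 then y else z] 1 u)
     & forall u, tens3 x y u = pure (upd [ffun i : 'I_3 =>
         if i == 0 then x else if i == 1 then y else z] 2%:R u)].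
Proof.
by split=> u; congr pure; apply/ffunP => i; rewrite !ffunE;
  case: i => -[|[|[|//]]] i /=.
Qed.

Lemma tens3_linear1 y z : linear (fun x => tens3 x y z).
Proof. by move=> c x x'; have [E _ _] := tens3_upd x y z; rewrite !E pure_multilinear. Qed.
Lemma tens3_linear2 x z : linear (fun y => tens3 x y z).
Proof. by move=> c y y'; have [_ E _] := tens3_upd x y z; rewrite !E pure_multilinear. Qed.
Lemma tens3_linear3 x y : linear (fun z => tens3 x y z).
Proof. by move=> c z z'; have [_ _ E] := tens3_upd x y z; rewrite !E pure_multilinear. Qed.

Lemma tpermute_multilinear n (s : 'S_n) :
  multilinear (fun a : {ffun 'I_n -> M} => pure [ffun i => a (s i)]).
Proof.
move=> a i c x y.
have E u : [ffun j => upd a i u (s j)] = upd [ffun j => a (s j)] ((s^-1)%g i) u.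
  by apply/ffunP => j; rewrite !ffunE (can2_eq (permK s) (permKV s)).
by rewrite !E pure_multilinear.
Qed.

Lemma talt_linear n : linear (@talt k M n).
Proof.
move=> c x y; rewrite /talt scaler_sumr -big_split; apply: eq_bigr => s _ /=.
rewrite /tpermute tlift_linear; last exact: tpermute_multilinear.
by rewrite scalerDr !scalerA mulrC.
Qed.

Lemma talt_tens3 x y z : talt (tens3 x y z) =
  tens3 x y z - tens3 y x z - tens3 z y x - tens3 x z y + tens3 z x y + tens3 y z x.
Proof.
rewrite /talt sum_S3.
have E (s : 'S_3) : tpermute s (tens3 x y z) = pure [ffun i =>
    if s i == 0 then x else if s i == 1 then y else z].
  rewrite /tpermute tlift_pure; last exact: tpermute_multilinear.
  by congr pure; apply/ffunP => i; rewrite !ffunE.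
rewrite !E !tens3_pure !ffunE !odd_permM !odd_tperm odd_perm1 !permM !perm1 !permE /=.
by rewrite expr0 expr1 !scale1r !scaleN1r.
Qed.
End Sum3.

Section Comm.
Variables (k : comNzRingType) (A : algType k).
Implicit Types x y z : A.
Lemma commDl x y z : comm (x + y) z = comm x z + comm y z.
Proof. by rewrite /comm mulrDl mulrDr opprD addrACA. Qed.
Lemma commDr x y z : comm z (x + y) = comm z x + comm z y.
Proof. by rewrite /comm mulrDl mulrDr opprD addrACA. Qed.
Lemma commNr x y : comm x (- y) = - comm x y.
Proof. by rewrite /comm mulNr mulrN opprB opprK addrC. Qed.
Lemma commZ c d x y : comm (c *: x) (d *: y) = (c * d) *: comm x y.
Proof. by rewrite /comm -!scalerAl -!scalerAr !scalerA scalerBr (mulrC d). Qed.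
End Comm.

Section CoassociatorAlt.
Variables (k : comNzRingType) (A : algType k) (v w : A) (q : k).
Local Notation t3 := (@tens3 k A).
Local Notation c := (comm v w).

Lemma tens3M x y z x' y' z' : t3 x y z * t3 x' y' z' = t3 (x * x') (y * y') (z * z').
Proof.
rewrite pureM; congr pure; apply/ffunP => i; rewrite !ffunE.
by case: i => -[|[|[|//]]] i /=.
Qed.

Lemma comm_tens3 x y z x' y' z' :
  comm (t3 x y z) (t3 x' y' z') = t3 (x * x') (y * y') (z * z') - t3 (x' * x) (y' * y) (z' * z).
Proof. by rewrite /comm !tens3M. Qed.

Lemma legs_tens3 x : [/\ leg 3 1 x = t3 x 1 1, leg 3 2 x = t3 1 x 1 & leg 3 3 x = t3 1 1 x].
Proof.
by split; congr pure; apply/ffunP => i; rewrite !ffunE; case: i => -[|[|[|//]]] i /=.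
Qed.

Lemma place_tens2 n i j x y : places 2 n [:: i; j] ->
  place n [:: i; j] (tens2 x y) = leg n i x * leg n j y :> tens n A.
Proof. by move=> p; rewrite tens2E (algM (place_alg p)) !(place_leg _ p). Qed.

Let s := tens2 v w.
Let g := q *: (s + place 2 [:: 2; 1]%N s).

Let g_place i j : places 2 3 [:: i; j] -> place 3 [:: i; j] g =
  q *: (leg 3 i v * leg 3 j w + leg 3 i w * leg 3 j v) :> tens 3 A.
Proof.
move=> p; have lp := alg_lin (place_alg (A := A) p).
by rewrite (linZ lp) (linD lp) (@place_tens2 2) // leg_comm // -tens2E !place_tens2.
Qed.

(** On the left [v_1 w_2, v_2 w_3] = -v⊗[v,w]⊗w, whose alternation has six terms. On the right each
    of the three commutators keeps two terms, with [v,w] in the leg shared by the two copies of g;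
    these are the same six tensors with the same signs. *)
Lemma alt_comm_legs :
  talt (comm (q *: (leg 3 1 v * leg 3 2 w)) (q *: (leg 3 2 v * leg 3 3 w))) =
  - comm (place 3 [:: 1; 2]%N g) (place 3 [:: 1; 3]%N g)
  + comm (place 3 [:: 1; 2]%N g) (place 3 [:: 2; 3]%N g)
  - comm (place 3 [:: 1; 3]%N g) (place 3 [:: 2; 3]%N g).
Proof.
rewrite !g_place // !commZ (linZ (@talt_linear _ _ _)) -!scalerN -!scalerDr.
congr (_ *: _).
have lE x : [/\ leg 3 1 x = t3 x 1 1, leg 3 2 x = t3 1 x 1 & leg 3 3 x = t3 1 1 x].
  exact: legs_tens3.
have [v1 v2 v3] := lE v; have [w1 w2 w3] := lE w.
rewrite v1 v2 v3 w1 w2 w3 !tens3M !(mulr1, mul1r) !(commDl, commDr).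
(* On the right, the terms with the same letter twice in the shared leg vanish. *)
rewrite !comm_tens3 !(mulr1, mul1r) !subrr.
rewrite !(addr0, add0r).
have E1 x y : t3 (v * w) x y - t3 (w * v) x y = t3 c x y.
  by rewrite -(linB (tens3_linear1 x y)).
have E2 x y : t3 x (v * w) y - t3 x (w * v) y = t3 x c y.
  by rewrite -(linB (tens3_linear2 x y)).
have E3 x y : t3 x y (v * w) - t3 x y (w * v) = t3 x y c.
  by rewrite -(linB (tens3_linear3 x y)).
have N1 x y : t3 (w * v) x y - t3 (v * w) x y = - t3 c x y by rewrite -E1 opprB.
have N2 x y : t3 x (w * v) y - t3 x (v * w) y = - t3 x c y by rewrite -E2 opprB.
have N3 x y : t3 x y (w * v) - t3 x y (v * w) = - t3 x y c by rewrite -E3 opprB.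
rewrite E1 !N1 E2 !N2 E3 !N3 (linN (@talt_linear _ _ _)) talt_tens3.
move: (t3 v c w) (t3 c v w) (t3 w c v) (t3 v w c) (t3 w v c) (t3 c w v) => x1 x2 x3 x4 x5 x6.
rewrite !opprD !opprK !addrA.
by rewrite [RHS](+%R.[ACl 3*2*4*5*6*1]).
Qed.
End CoassociatorAlt.

(** * The cobracket as the first-order term of Δ *)

Section TensorMap.
Variables (k : comNzRingType) (M N : lmodType k) (f : M -> N).
Hypothesis lf : linear f.

Lemma tmap_multilinear n :
  multilinear (fun a : {ffun 'I_n -> M} => pure [ffun i => f (a i)]).
Proof.
move=> a i c x y.
have E u : [ffun j => f (upd a i u j)] = upd [ffun j => f (a j)] i (f u).
  by apply/ffunP => j; rewrite !ffunE; case: eqP.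
by rewrite !E lf pure_multilinear.
Qed.

Lemma tmap_linear n : linear (@tmap k M N n f).
Proof. by move=> c x y; apply: tlift_linear; apply: tmap_multilinear. Qed.

Lemma tmap_pure n a : tmap f (pure a) = pure [ffun i : 'I_n => f (a i)].
Proof. by apply: tlift_pure; apply: tmap_multilinear. Qed.
End TensorMap.

Section Tens2.
Variables (k : comNzRingType) (M : lmodType k).
Implicit Types x y : M.

Lemma tens2_upd x y :
  (forall u, tens2 u y = pure (upd [ffun i : 'I_2 => if i == 0 then x else y] 0 u)) /\
  (forall u, tens2 x u = pure (upd [ffun i : 'I_2 => if i == 0 then x else y] 1 u)).
Proof.
by split=> u; congr pure; apply/ffunP => i; rewrite !ffunE; case: i => -[|[|//]] i /=.
Qed.
Lemma tens2_linear1 y : linear (fun x => tens2 x y).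
Proof. by move=> c x x'; have [E _] := tens2_upd x y; rewrite !E pure_multilinear. Qed.
Lemma tens2_linear2 x : linear (tens2 x).
Proof. by move=> c y y'; have [_ E] := tens2_upd x y; rewrite !E pure_multilinear. Qed.
Lemma tens2_pure (a : {ffun 'I_2 -> M}) : pure a = tens2 (a 0) (a 1).
Proof.
congr pure; apply/ffunP => i; rewrite !ffunE.
by case: i => -[|[|//]] i /=; congr (a _); apply: val_inj.
Qed.
Lemma tmap_tens2 (N : lmodType k) (f : M -> N) x y : linear f ->
  tmap f (tens2 x y) = tens2 (f x) (f y).
Proof.
move=> lf; rewrite tmap_pure //; congr pure; apply/ffunP => i.
by rewrite !ffunE; case: eqP.
Qed.
End Tens2.

Lemma tens2M (k : comNzRingType) (A : algType k) (x y x' y' : A) :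
  tens2 x y * tens2 x' y' = tens2 (x * x') (y * y').
Proof. by rewrite pureM tens2_pure !ffunE. Qed.

Lemma comm_linear (k : comNzRingType) (A : algType k) (x : A) : linear (comm x).
Proof.
move=> c y z; rewrite /comm mulrDr mulrDl -scalerAr -scalerAl scalerBr opprD.
by rewrite addrACA.
Qed.

Section LieAct.
Variables (k : comNzRingType) (g : lieAlgType k) (A : algType k).
Variable f : {linear g -> A}.
Hypothesis fL : lie_to_alg f.

Lemma lie_act_multilinear x : multilinear (fun a : {ffun 'I_2 -> g} =>
  \sum_(i < 2) pure (upd a i (lie x (a i)))).
Proof.
pose G a b := tens2 (lie x a) b + tens2 a (lie x b).
have E a : \sum_(i < 2) pure (upd a i (lie x (a i))) = G (a 0) (a 1).
  rewrite !big_ord_recl big_ord0 addr0 !tens2_pure !ffunE /=.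
  by congr (_ + tens2 _ (lie x (a _))); apply: val_inj.
have G1 b : linear (G^~ b).
  by move=> c a a'; rewrite /G lieZDr !tens2_linear1 scalerDr addrACA.
have G2 a : linear (G a).
  by move=> c b b'; rewrite /G lieZDr !tens2_linear2 scalerDr addrACA.
by move=> a i c u u'; rewrite !E; apply: (multilinear2 G1 G2).
Qed.

Lemma tmap_lie_act x (t : tens 2 g) : tmap f (lie_act x t) =
  comm (leg 2 1 (f x) + leg 2 2 (f x)) (tmap f t).
Proof.
have lf : linear f by exact: linearP.
move: t; apply: linear_tens_ext => [c t u|c t u|a].
- by rewrite /lie_act tlift_linear ?(tmap_linear lf) //; apply: lie_act_multilinear.
- by rewrite tmap_linear // comm_linear.
rewrite /lie_act tlift_pure; last exact: lie_act_multilinear.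
rewrite !big_ord_recl big_ord0 addr0 !tens2_pure !ffunE /=.
have -> : lift ord0 ord0 = 1 :> 'I_2 by apply: val_inj.
have -> : ord0 = 0 :> 'I_2 by apply: val_inj.
rewrite (linD (@tmap_linear _ _ _ _ lf 2)) !tmap_tens2 // !fL /comm /leg !tens2_pure !ffunE /=.
rewrite mulrDl mulrDr !tens2M !mul1r !mulr1 opprD addrACA.
by rewrite (linB (tens2_linear1 _)) (linB (tens2_linear2 _)).
Qed.
End LieAct.

Section Enveloping.
Variables (k : comNzRingType) (V : lmodType k).
Lemma flie_talg_enveloping : is_enveloping (@flie_talg k V : {linear flie V -> talg V}).
Proof.
split; first exact: flie_talg_lie.
- move=> B f fL; exists (talg_lift (f \o @flie_gen k V)) => x.
  elim/flie_ind: x => [x|x y hx hy|c x hx|x y hx hy].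
  + by rewrite /= flie_talg_gen; apply: talg_lift_gen.
  + by rewrite !linearD /= hx hy.
  + by rewrite !linearZ /= hx.
  by rewrite /= flie_talg_lie fL /comm rmorphB !rmorphM /= hx hy.
move=> B F G FG; apply: talg_lift_unique => x.
by rewrite -!flie_talg_gen; apply: FG.
Qed.
End Enveloping.

Lemma coef_sandwich (R : nzRingType) (X Y : series R) l :
  (X * cst l * Y) 0%N = X 0%N * l * Y 0%N /\
  (X * cst l * Y) 1%N = X 0%N * l * Y 1%N + X 1%N * l * Y 0%N.
Proof.
split; first by rewrite (coefM0 (X * _)) (coef_Mcst l X 0).
by rewrite (coefM1 (X * _)) (coef_Mcst l X 0) (coef_Mcst l X 1).
Qed.

Section LowOrder.
Variable k : fieldType.
Hypothesis k0 : [pchar k] =i pred0.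
Variables (V : lmodType k) (v w : V) (q : k).
Local Notation A := (talg V).
Local Notation gen := (@talg_gen k V).
Variable Delta : {lrmorphism series A -> series (tens 2 A)}.
Variable eps : {lrmorphism series A -> (series k)^o}.
Hypothesis Dg : forall x, twisted_primitive (gen v) (gen w) q Delta (gen x).
Hypothesis eps_gen : forall x, eps (cst (gen x)) = 0.
Variable B : quasiLieBialg (flie V).
Local Notation i := (@flie_talg k V).
Local Notation s := (leg 2 1 (gen v) * leg 2 2 (gen w) : tens 2 A).
Local Notation flip := (@place k A 2 2 [:: 2; 1]%N).
Hypothesis cobr_gen : forall x, tmap i (cobr B (flie_gen x)) =
  comm (q *: (s + flip s)) (leg 2 1 (gen x) - leg 2 2 (gen x)).

Let prim (a : A) : tens 2 A := leg 2 1 a + leg 2 2 a.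
Let D0 (a : A) : tens 2 A := Delta (cst a) 0%N.
Let D1 (a : A) : tens 2 A := Delta (cst a) 1%N.

Let flip_alg : is_alg_morph flip. Proof. exact: place_alg. Qed.
Let flip1 (a : A) : flip (leg 2 1 a) = leg 2 2 a.
Proof. exact: (place_leg (i := 0) (s := [:: 2; 1]%N)). Qed.
Let flip2 (a : A) : flip (leg 2 2 a) = leg 2 1 a.
Proof. exact: (place_leg (i := 1) (s := [:: 2; 1]%N)). Qed.
Let l1 : is_alg_morph (leg 2 1 : A -> tens 2 A). Proof. exact: leg_alg. Qed.
Let l2 : is_alg_morph (leg 2 2 : A -> tens 2 A). Proof. exact: leg_alg. Qed.
Let aD := D_alg Delta.

Lemma flip_comm x y : flip (comm x y) = comm (flip x) (flip y).
Proof. by rewrite /comm (linB (alg_lin flip_alg)) !(algM flip_alg). Qed.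

Lemma flip_prim a : flip (prim a) = prim a.
Proof. by rewrite (linD (alg_lin flip_alg)) flip1 flip2 addrC. Qed.

Lemma prim_comm a b : comm (prim a) (prim b) = prim (comm a b).
Proof.
rewrite /prim commDl !commDr /comm !(leg_comm _ _ (i := 2) (j := 1)) // !subrr addr0 add0r.
by rewrite -!(algM l1) -!(algM l2) -(linB (alg_lin l1)) -(linB (alg_lin l2)).
Qed.

(** Δ conjugates the two legs of x in opposite directions, so to first order the commutators with q
    s enter with opposite signs. *)
Lemma cop_gen_low x : D0 (gen x) = prim (gen x) /\
  D1 (gen x) = comm (q *: s) (leg 2 1 (gen x) - leg 2 2 (gen x)).
Proof.
have e0 c : legexp (gen v) (gen w) c 2 1 2 0%N = 1 by apply: hexp_coef0.
have e1 c : legexp (gen v) (gen w) c 2 1 2 1%N = c *: s by apply: hexp_coef1.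
rewrite /D0 /D1 Dg !coefD.
have [H0 H1] := coef_sandwich (legexp (gen v) (gen w) q 2 1 2)
  (legexp (gen v) (gen w) (- q) 2 1 2) (leg 2 1 (gen x)).
have [H2 H3] := coef_sandwich (legexp (gen v) (gen w) (- q) 2 1 2)
  (legexp (gen v) (gen w) q 2 1 2) (leg 2 2 (gen x)).
rewrite H0 H1 H2 H3 !e0 !e1 !mul1r !mulr1 !scaleNr; split=> //.
rewrite /comm mulrBl mulrBr mulrN mulNr.
move: (q *: s) (leg 2 1 (gen x)) (leg 2 2 (gen x)) => t a b.
by rewrite opprB !addrA [RHS](+%R.[ACl 4*1*3*2]).
Qed.

(** Induction on L(V). In the bracket step, multiplicativity of Δ gives the first-order term a
    Leibniz rule, which becomes the cocycle rule of [cobr] because the constant terms are primitive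
    and flip-invariant; so both claims are proved together. *)
Lemma cop_low u : D0 (i u) = prim (i u) /\
  D1 (i u) - flip (D1 (i u)) = tmap i (cobr B u).
Proof.
have lD0 : linear D0 by move=> c a b; rewrite /D0; have := alg_lin aD c a b => ->.
have lD1 : linear D1 by move=> c a b; rewrite /D1; have := alg_lin aD c a b => ->.
have lt := @tmap_linear _ _ _ _ (@flie_talg_linear k V) 2.
have lf := alg_lin flip_alg.
have lp : linear prim.
  by move=> c a b; rewrite /prim (alg_lin l1) (alg_lin l2) scalerDr addrACA.
elim/flie_ind: u => [x|x y [x0 x1] [y0 y1]|c x [x0 x1]|x y [x0 x1] [y0 y1]].
- rewrite flie_talg_gen; have [-> ->] := cop_gen_low x; split=> //.
  (* The flip negates x_1 - x_2, so subtracting the flipped commutator adds s^21 to s and produces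
     g. *)
  rewrite cobr_gen flip_comm (linZ lf) (linB lf) flip1 flip2.
  by rewrite -[leg 2 2 _ - _]opprB commNr opprK scalerDr commDl.
- rewrite linearD (linD lD0) x0 y0 (linD lp); split=> //.
  by rewrite (linD lD1) (linD lf) opprD addrACA x1 y1 linearD (linD lt).
- rewrite linearZ (linZ lD0) x0 (linZ lp); split=> //.
  by rewrite (linZ lD1) (linZ lf) -scalerBr x1 linearZ (linZ lt).
have DM a b : Delta (cst (a * b)) = Delta (cst a) * Delta (cst b).
  by rewrite cst_mul rmorphM.
have D0c a b : D0 (comm a b) = comm (D0 a) (D0 b).
  by rewrite /comm (linB lD0) /D0 !DM !coefM0.
have D1c a b : D1 (comm a b) = comm (D0 a) (D1 b) + comm (D1 a) (D0 b).
  rewrite /comm (linB lD1) /D1 !DM !coefM1 -!/(D0 _) -!/(D1 _).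
  by rewrite [D0 b * _ + _]addrC opprD addrACA.
rewrite flie_talg_lie D0c D1c x0 y0 prim_comm; split=> //.
rewrite cobr_cocycle (linB lt) !(tmap_lie_act (@flie_talg_lie k V)) -x1 -y1.
rewrite -!/(prim _) (linD lf) !flip_comm !flip_prim.
move: (prim (i x)) (prim (i y)) (D1 (i x)) (D1 (i y)) => p r a b.
have anti (c d : tens 2 A) : comm c d = - comm d c by rewrite /comm opprB.
rewrite !commDr !commNr (anti r) (anti r (flip a)) opprK.
move: (comm p b) (comm p (flip b)) (comm a r) (comm (flip a) r) => c1 c2 c3 c4.
by rewrite !opprD !opprK !addrA [RHS](+%R.[ACl 1*3*2*4]).
Qed.

Lemma eps_talg u : eps (cst (i u)) = 0.
Proof.
have li := @flie_talg_linear k V.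
have eD x y : eps (x + y) = eps x + eps y by exact: rmorphD.
have eN x : eps (- x) = - eps x by exact: rmorphN.
have eM x y : eps (x * y) = eps x * eps y by exact: rmorphM.
have eZ c x : eps (c *: x) = c *: eps x by exact: linearZ.
elim/flie_ind: u => [x|x y hx hy|c x hx|x y hx hy].
- by rewrite flie_talg_gen.
- by rewrite (linD li) cstD eD hx hy addr0.
- by rewrite (linZ li) (linZ (@cst_linear k A)) -kscaleE eZ hx scaler0.
by rewrite flie_talg_lie /comm cstD cstN !cst_mul eD eN !eM hx hy !mul0r subr0.
Qed.

Hypothesis coass_val : tmap i (coass B) =
  talt (comm (q *: (leg 3 1 (gen v) * leg 3 2 (gen w)))
             (q *: (leg 3 2 (gen v) * leg 3 3 (gen w)))).
Hypothesis qq : q + q = 1.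
Local Notation Phi := (assoc3 (gen v) (gen w) q).

Lemma assoc3_coef : [/\ Phi 0%N = 1, Phi 1%N = 0 & Phi 2%N =
  comm (q *: (leg 3 1 (gen v) * leg 3 2 (gen w)))
       (q *: (leg 3 2 (gen v) * leg 3 3 (gen w)))].
Proof.
have := group_commutator_coef (q *: (leg 3 1 (gen v) * leg 3 2 (gen w)) : tens 3 A)
       (q *: (leg 3 2 (gen v) * leg 3 3 (gen w))) k0.
by rewrite -!scaleNr.
Qed.

Lemma twisted_is_quantization : is_quantization Delta eps Phi B i.
Proof.
have [P0 P1 P2] := assoc3_coef.
split.
- exact: twisted_quasi_hopf.
- by apply: eqmodhP => -[|[|//]] _; rewrite ?P0 ?P1.
- exact: flie_talg_enveloping.
- move=> u; apply: eqmodhP => -[|//] _.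
  have [] := cop_low u; rewrite /D0 => -> _.
  by rewrite !tens2E (alg1 l1) (alg1 l2) mulr1 mul1r.
- by move=> u; rewrite eps_talg; apply: eqmodhP.
- move=> u; have [c0 c1] := cop_low u; apply: eqmodhP => -[|[|//]] _.
    rewrite coefD coefN coef_hZ /= -/(D0 (i u)) c0 flip_prim subrr.
    done.
  by rewrite coefD coefN coef_hZ /= -c1.
have sE j : smap (@talt k A 3) Phi j = talt (Phi j) by [].
apply: eqmodhP => -[|[|[|//]]] _; rewrite sE coef_hXZ.
(* The constant term 1⊗1⊗1 is symmetric: its six signed copies cancel. *)
- rewrite P0 -[1]/(pure [ffun=> 1] : tens 3 A) tens3_pure !ffunE talt_tens3.
  by rewrite subrr sub0r -addrA addrACA addNr addr0.
- by rewrite P1 (lin0 (@talt_linear _ _ _)).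
by rewrite P2 coass_val.
Qed.
End LowOrder.

Theorem theorem2p6 (k : fieldType) (V : vectType k) (v w : V)
    (B : quasiLieBialg (flie V))
    (Delta : {lrmorphism series (talg V) -> series (tens 2 (talg V))})
    (eps : {lrmorphism series (talg V) -> (series k)^o}) :
  [pchar k] =i pred0 ->
  let x_ : V -> talg V := @talg_gen k V in
  let s := tens2 (x_ v) (x_ w) in
  let g := 2^-1 *: (s + place 2 [:: 2; 1]%N s) in
  let g12 := place 3 [:: 1; 2]%N g in
  let g13 := place 3 [:: 1; 3]%N g in
  let g23 := place 3 [:: 2; 3]%N g in
  let J := hexp (- (2^-1 *: s)) in
  let J' := hexp (2^-1 *: s) in
  let J12 := smap (place 3 [:: 1; 2]%N) in
  let J23 := smap (place 3 [:: 2; 3]%N) in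
  (forall x : V, tmap (@flie_talg k V) (cobr B (flie_gen x)) =
             comm g (tens2 (x_ x) 1 - tens2 1 (x_ x))) ->
  tmap (@flie_talg k V) (coass B) =
    - comm g12 g13 + comm g12 g23 - comm g13 g23 ->
  (forall x : V, Delta (cst (x_ x)) =
             J' * cst (tens2 (x_ x) 1) * J + J * cst (tens2 1 (x_ x)) * J') ->
  (forall x : V, eps (cst (x_ x)) = 0) ->
  is_quantization Delta eps (J23 J' * J12 J * J23 J * J12 J') B (@flie_talg k V).
Proof.
move=> k0 x_ s g g12 g13 g23 J J' J12 J23 Hcobr Hcoass HDelta Heps.
pose q : k := 2^-1.
(* Characteristic 0 makes 2 invertible; q = 1/2 is the constant in J = e^{-qhs} and in g = q(s +
   s^21). *)
have qq : q + q = 1.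
  have n2 : 2 != 0 :> k by rewrite (pcharf0P k).1.
  by rewrite -mulr2n -[q *+ 2]mulr_natl divff.
have sE : s = leg 2 1 (x_ v) * leg 2 2 (x_ w) by exact: tens2E.
have J'E : J' = legexp (x_ v) (x_ w) q 2 1 2 by rewrite /J' sE.
have JE : J = legexp (x_ v) (x_ w) (- q) 2 1 2 by rewrite /J sE -scaleNr.
have tl x : tens2 (x_ x) 1 = leg 2 1 (x_ x).
  by rewrite tens2E (alg1 (leg_alg _)) // mulr1.
have tr x : tens2 1 (x_ x) = leg 2 2 (x_ x).
  by rewrite tens2E (alg1 (leg_alg _)) // mul1r.
have -> : J23 J' * J12 J * J23 J * J12 J' = assoc3 (x_ v) (x_ w) q.
  have p12 : places 2 3 [:: 1; 2]%N by [].
  have p23 : places 2 3 [:: 2; 3]%N by [].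
  have e12 c : J12 (legexp (x_ v) (x_ w) c 2 1 2) = legexp (x_ v) (x_ w) c 3 1 2.
    exact: (place_legexp (x_ v) (x_ w) c p12 (i := 0) (j := 1)).
  have e23 c : J23 (legexp (x_ v) (x_ w) c 2 1 2) = legexp (x_ v) (x_ w) c 3 2 3.
    exact: (place_legexp (x_ v) (x_ w) c p23 (i := 0) (j := 1)).
  by rewrite J'E JE (e23 q) (e12 (- q)) (e23 (- q)) (e12 q).
have Dg x : twisted_primitive (x_ v) (x_ w) q Delta (x_ x).
  rewrite /twisted_primitive HDelta tl tr J'E JE; reflexivity.
have Cg x : tmap (@flie_talg k V) (cobr B (flie_gen x)) =
    comm (q *: (leg 2 1 (x_ v) * leg 2 2 (x_ w) +
                place 2 [:: 2; 1]%N (leg 2 1 (x_ v) * leg 2 2 (x_ w))))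
         (leg 2 1 (x_ x) - leg 2 2 (x_ x)).
  rewrite Hcobr tl tr -sE; reflexivity.
have Co : tmap (@flie_talg k V) (coass B) =
    talt (comm (q *: (leg 3 1 (x_ v) * leg 3 2 (x_ w)))
               (q *: (leg 3 2 (x_ v) * leg 3 3 (x_ w)))).
  rewrite Hcoass; exact/esym/alt_comm_legs.
exact: (twisted_is_quantization k0 Dg Heps Cg Co qq).
Qed.
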